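(* For all $P_1,P_2,N>0$ and every $2\times 2$ positive semidefinite matrix $\mathsf{K}_W$, $$\mathcal{C}_{\mathrm{NoisyFB}}(P_1,P_2,N,\mathsf{K}_W)\supseteq \mathcal{R}(P_1,P_2,N,\mathsf{K}_W).$$
   Context: Channel model (noisy feedback). Fix $P_1,P_2,N>0$ and a $2\times 2$ positive semidefinite matrix $\mathsf{K}_W=\begin{pmatrix}\sigma_1^2&\varrho\sigma_1\sigma_2\\ \varrho\sigma_1\sigma_2&\sigma_2^2\end{pmatrix}$ with $\sigma_1,\sigma_2\ge 0$, $\varrho\in[-1,1]$. Messages $M_1,M_2$ are independent and uniform on finite sets $\mathcal{M}_1,\mathcal{M}_2$. $\{Z_t\}$ is IID $\mathcal{N}(0,N)$, $\{(W_{1,t},W_{2,t})\}$ is IID zero-mean bivariate Gaussian with covariance $\mathsf{K}_W$, and $M_1,M_2,\{Z_t\},\{(W_{1,t},W_{2,t})\}$ are mutually independent. The output is $Y_t=X_{1,t}+X_{2,t}+Z_t$ and Transmitter $\nu\in\{1,2\}$ observes causally the feedback $V_{\nu,t}=Y_t+W_{\nu,t}$. A blocklength-$n$ code consists of encoders $X_{\nu,t}=\varphi_{\nu,t}(M_\nu,V_{\nu,1},\dots,V_{\nu,t-1})$, $t=1,\dots,n$, satisfying $\frac1n\sum_{t=1}^n\mathbb{E}[X_{\nu,t}^2]\le P_\nu$ ($\nu=1,2$), and a decoder $\phi:\mathbb{R}^n\to\mathcal{M}_1\times\mathcal{M}_2$. A pair $(R_1,R_2)$ is achievable if for every $\delta>0$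 and all sufficiently large $n$ there is such a code with $\frac1n\log|\mathcal{M}_\nu|>R_\nu-\delta$ ($\nu=1,2$), and the error probabilities $\Pr[\phi(Y_1,\dots,Y_n)\ne(M_1,M_2)]$ tend to $0$ as $n\to\infty$. $\mathcal{C}_{\mathrm{NoisyFB}}(P_1,P_2,N,\mathsf{K}_W)$ is the set of achievable pairs. Region $\mathcal{R}$. For a positive integer $\eta$, vectors $\mathbf a_1,\mathbf a_2\in\mathbb{R}^\eta$, strictly lower-triangular $\mathsf B_1,\mathsf B_2\in\mathbb{R}^{\eta\times\eta}$ and $\mathsf C\in\mathbb{R}^{2\times\eta}$, let $\mathsf A=(\mathbf a_1\ \mathbf a_2)\in\mathbb{R}^{\eta\times2}$ and $\mathsf Q=N\mathsf I_\eta+\sigma_1^2\mathsf B_1\mathsf B_1^{\mathsf T}+\sigma_2^2\mathsf B_2\mathsf B_2^{\mathsf T}+\varrho\sigma_1\sigma_2(\mathsf B_1\mathsf B_2^{\mathsf T}+\mathsf B_2\mathsf B_1^{\mathsf T})$ (this equals $N\mathsf I_\eta+(\mathsf B_1\ \mathsf B_2)(\mathsf K_W\otimes \mathsf I_\eta)(\mathsf B_1\ \mathsf B_2)^{\mathsf T}$). If $\mathsf C\mathsf C^{\mathsf T}$ is nonsingular, $\mathcal{R}_\eta^{N,\mathsf K_W}(\mathbf a_1,\mathbf a_2,\mathsf B_1,\mathsf B_2,\mathsf C)$ is the set of nonnegative $(R_1,R_2)$ with $R_1\le\frac{1}{2\eta}\log\frac{\det(\mathsf C(\mathbf a_1\mathbf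 a_1^{\mathsf T}+\mathsf Q)\mathsf C^{\mathsf T})}{\det(\mathsf C\mathsf Q\mathsf C^{\mathsf T})}$, $R_2\le\frac{1}{2\eta}\log\frac{\det(\mathsf C(\mathbf a_2\mathbf a_2^{\mathsf T}+\mathsf Q)\mathsf C^{\mathsf T})}{\det(\mathsf C\mathsf Q\mathsf C^{\mathsf T})}$, $R_1+R_2\le\frac{1}{2\eta}\log\frac{\det(\mathsf C(\mathsf A\mathsf A^{\mathsf T}+\mathsf Q)\mathsf C^{\mathsf T})}{\det(\mathsf C\mathsf Q\mathsf C^{\mathsf T})}$; if $\mathsf C\mathsf C^{\mathsf T}$ is singular but $\mathsf C\neq 0$, the same definition with $\mathsf C$ replaced by any nonzero row of $\mathsf C$; if $\mathsf C=0$, the set $\{(0,0)\}$. Power constraints: let $\mathbb B=\begin{pmatrix}\mathsf B_1&\mathsf B_1\\ \mathsf B_2&\mathsf B_2\end{pmatrix}$, $\mathsf A_d=\begin{pmatrix}\mathbf a_1&\mathbf 0\\ \mathbf 0&\mathbf a_2\end{pmatrix}$, $\mathsf B_t=\begin{pmatrix}\mathsf B_1\\ \mathsf B_2\end{pmatrix}$, $\mathsf B_d=\begin{pmatrix}\mathsf B_1&0\\0&\mathsf B_2\end{pmatrix}$, $\mathsf K_W\otimes\mathsf I_\eta=\begin{pmatrix}\sigma_1^2\mathsf I_\eta&\varrho\sigma_1\sigma_2\mathsf I_\eta\\ \varrho\sigma_1\sigma_2\mathsf I_\eta&\sigma_2^2\mathsf I_\eta\end{pmatrix}$, and $\Sigma=(\mathsf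 I_{2\eta}-\mathbb B)^{-1}(\mathsf A_d\mathsf A_d^{\mathsf T}+N\mathsf B_t\mathsf B_t^{\mathsf T}+\mathsf B_d(\mathsf K_W\otimes\mathsf I_\eta)\mathsf B_d^{\mathsf T})(\mathsf I_{2\eta}-\mathbb B)^{-\mathsf T}$; require the trace of the upper-left $\eta\times\eta$ block of $\Sigma$ to be $\le\eta P_1$ and the trace of the lower-right $\eta\times\eta$ block to be $\le \eta P_2$. Then $\mathcal{R}(P_1,P_2,N,\mathsf K_W)$ is the closure of the union of $\mathcal{R}_\eta^{N,\mathsf K_W}(\mathbf a_1,\mathbf a_2,\mathsf B_1,\mathsf B_2,\mathsf C)$ over all $(\eta,\mathbf a_1,\mathbf a_2,\mathsf B_1,\mathsf B_2,\mathsf C)$ satisfying the power constraints. *)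

(* Defs.v *)
From HB Require Import structures.
From mathcomp Require Import all_boot all_order all_algebra.
From mathcomp Require Import all_classical all_reals all_analysis.

Set Implicit Arguments.
Unset Strict Implicit.
Unset Printing Implicit Defensive.

Import Order.TTheory GRing.Theory Num.Theory.
Import numFieldNormedType.Exports.
Local Open Scope classical_set_scope.
Local Open Scope ring_scope.

Section NoisyFB.
Variable R : realType.

(* Expectation over k IID standard normal variables (nonnegative         *)
(* integrands), as an iterated Lebesgue integral against the N(0,1) pdf. *)
Fixpoint gexp (k : nat) : (k.-tuple R -> \bar R) -> \bar R :=
  match k as k0 return (k0.-tuple R -> \bar R) -> \bar R with
  | 0 => fun f => f [tuple]
  | k'.+1 => fun f =>
      (\int[@lebesgue_measure R]_x
         ((normal_pdf 0 1 x)%:E * gexp (fun t => f (cons_tuple x t))))%E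
  end.

Definition Enoise (n : nat) (F : n.-tuple R -> n.-tuple R -> n.-tuple R -> \bar R)
  : \bar R :=
  gexp (fun zs => gexp (fun g1 => gexp (fun g2 => F zs g1 g2))).

(* Noise processes built from standard normals:
   Z_t = sqrt N * zs_t ;  W1_t = s1 * g1_t ;
   W2_t = s2 * (rho * g1_t + sqrt(1-rho^2) * g2_t),
   so that (W1_t, W2_t) has covariance K_W and Z_t ~ N(0,N), all independent. *)
Definition Znoise (N : R) (zs : seq R) (t : nat) : R := Num.sqrt N * nth 0 zs t.
Definition W1noise (s1 : R) (g1 : seq R) (t : nat) : R := s1 * nth 0 g1 t.
Definition W2noise (s2 rho : R) (g1 g2 : seq R) (t : nat) : R :=
  s2 * (rho * nth 0 g1 t + Num.sqrt (1 - rho ^+ 2) * nth 0 g2 t).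

Definition chan_out (h : seq (R * R)) (z : nat -> R) (s : nat) : R :=
  (nth (0, 0) h s).1 + (nth (0, 0) h s).2 + z s.

(* History of channel inputs (X_{1,t}, X_{2,t}), t < k.  Encoder e_nu at
   time t receives exactly the t past feedback values V_{nu,0..t-1}. *)
Fixpoint hist (e1 e2 : nat -> seq R -> R) (z w1 w2 : nat -> R) (k : nat)
  : seq (R * R) :=
  match k with
  | 0 => [::]
  | k'.+1 =>
    let h := hist e1 e2 z w1 w2 k' in
    rcons h (e1 k' [seq chan_out h z s + w1 s | s <- iota 0 k'],
             e2 k' [seq chan_out h z s + w2 s | s <- iota 0 k'])
  end.

Section Code.
Variables (N s1 s2 rho : R) (n m1 m2 : nat).
Variables (enc1 : 'I_m1 -> nat -> seq R -> R) (enc2 : 'I_m2 -> nat -> seq R -> R).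
Variable dec : n.-tuple R -> 'I_m1 * 'I_m2.

Definition run_hist (w1 : 'I_m1) (w2 : 'I_m2) (zs g1 g2 : n.-tuple R) :=
  hist (enc1 w1) (enc2 w2) (Znoise N zs) (W1noise s1 g1) (W2noise s2 rho g1 g2) n.

Definition run_out (w1 : 'I_m1) (w2 : 'I_m2) (zs g1 g2 : n.-tuple R) : n.-tuple R :=
  [tuple chan_out (run_hist w1 w2 zs g1 g2) (Znoise N zs) i | i < n].

(* E[X_{1,t}^2], E[X_{2,t}^2]  (messages uniform, independent of the noise) *)
Definition EX1sq (t : nat) : \bar R :=
  (((m1 * m2)%:R)^-1%:E *
   \sum_(w1 < m1) \sum_(w2 < m2)
     Enoise (fun zs g1 g2 => ((nth (0, 0) (run_hist w1 w2 zs g1 g2) t).1 ^+ 2)%:E))%E.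
Definition EX2sq (t : nat) : \bar R :=
  (((m1 * m2)%:R)^-1%:E *
   \sum_(w1 < m1) \sum_(w2 < m2)
     Enoise (fun zs g1 g2 => ((nth (0, 0) (run_hist w1 w2 zs g1 g2) t).2 ^+ 2)%:E))%E.

Definition err_prob : \bar R :=
  (((m1 * m2)%:R)^-1%:E *
   \sum_(w1 < m1) \sum_(w2 < m2)
     Enoise (fun zs g1 g2 => ((dec (run_out w1 w2 zs g1 g2) != (w1, w2))%:R)%:E))%E.

Definition is_code (P1 P2 : R) : Prop :=
  [/\ (0 < m1)%N, (0 < m2)%N,
      (forall (w : 'I_m1) (t : nat),
          measurable_fun [set: t.-tuple R] (fun v : t.-tuple R => enc1 w t v)),
      (forall (w : 'I_m2) (t : nat),
          measurable_fun [set: t.-tuple R] (fun v : t.-tuple R => enc2 w t v))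
    & (forall ij : 'I_m1 * 'I_m2, measurable [set y : n.-tuple R | dec y = ij])] /\
  ((n%:R)^-1%:E * \sum_(t < n) EX1sq t <= P1%:E)%E /\
  ((n%:R)^-1%:E * \sum_(t < n) EX2sq t <= P2%:E)%E.

End Code.

Definition achievable (P1 P2 N s1 s2 rho : R) (r : R * R) : Prop :=
  forall delta : R, 0 < delta ->
  exists (m1 m2 : nat -> nat)
         (enc1 : forall n, 'I_(m1 n) -> nat -> seq R -> R)
         (enc2 : forall n, 'I_(m2 n) -> nat -> seq R -> R)
         (dec : forall n, n.-tuple R -> 'I_(m1 n) * 'I_(m2 n))
         (n0 : nat),
    (forall n, (n0 <= n)%N ->
       [/\ is_code N s1 s2 rho (enc1 n) (enc2 n) (dec n) P1 P2,
           r.1 - delta < ln ((m1 n)%:R) / n%:R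
         & r.2 - delta < ln ((m2 n)%:R) / n%:R]) /\
    ((fun n => err_prob N s1 s2 rho (enc1 n) (enc2 n) (dec n)) @ \oo --> 0%E).

(* C_NoisyFB(P1,P2,N,K_W), K_W = [[s1^2, rho s1 s2],[rho s1 s2, s2^2]] *)
Definition C_NoisyFB (P1 P2 N s1 s2 rho : R) : set (R * R) :=
  [set r | achievable P1 P2 N s1 s2 rho r].

Definition strictly_lower (eta : nat) (B : 'M[R]_eta) : Prop :=
  forall i j : 'I_eta, (i <= j)%N -> B i j = 0.

Definition Qmat (eta : nat) (N s1 s2 rho : R) (B1 B2 : 'M[R]_eta) : 'M[R]_eta :=
  N%:M + (s1 ^+ 2) *: (B1 *m B1^T) + (s2 ^+ 2) *: (B2 *m B2^T)
  + (rho * s1 * s2) *: (B1 *m B2^T + B2 *m B1^T).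

Definition rate_bd (k eta : nat) (c : 'M[R]_(k, eta)) (S Q : 'M[R]_eta) : R :=
  ((2 * eta)%:R)^-1 * ln (\det (c *m (S + Q) *m c^T) / \det (c *m Q *m c^T)).

Definition region_c (k eta : nat) (c : 'M[R]_(k, eta)) (a1 a2 : 'cV[R]_eta)
  (Q : 'M[R]_eta) : set (R * R) :=
  [set r | [/\ 0 <= r.1, 0 <= r.2,
              r.1 <= rate_bd c (a1 *m a1^T) Q,
              r.2 <= rate_bd c (a2 *m a2^T) Q
            & r.1 + r.2 <= rate_bd c (row_mx a1 a2 *m (row_mx a1 a2)^T) Q]].

Definition region_eta (eta : nat) (N s1 s2 rho : R) (a1 a2 : 'cV[R]_eta)
  (B1 B2 : 'M[R]_eta) (C : 'M[R]_(2, eta)) : set (R * R) :=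
  let Q := Qmat N s1 s2 rho B1 B2 in
  if \det (C *m C^T) != 0 then region_c C a1 a2 Q
  else if C != 0 then
    [set r | exists i : 'I_2, row i C != 0 /\ region_c (row i C) a1 a2 Q r]
  else [set (0, 0)].

Definition SigmaX (eta : nat) (N s1 s2 rho : R) (a1 a2 : 'cV[R]_eta)
  (B1 B2 : 'M[R]_eta) : 'M[R]_(eta + eta) :=
  let BB : 'M[R]_(eta + eta) := block_mx B1 B1 B2 B2 in
  let Ad : 'M[R]_(eta + eta, 1 + 1) := block_mx a1 0 0 a2 in
  let Bt : 'M[R]_(eta + eta, eta) := col_mx B1 B2 in
  let Bd : 'M[R]_(eta + eta) := block_mx B1 0 0 B2 in
  let KW : 'M[R]_(eta + eta) :=
    block_mx (s1 ^+ 2)%:M (rho * s1 * s2)%:M (rho * s1 * s2)%:M (s2 ^+ 2)%:M in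
  let Ti := invmx (1%:M - BB) in
  Ti *m (Ad *m Ad^T + N *: (Bt *m Bt^T) + Bd *m KW *m Bd^T) *m Ti^T.

Definition power_ok (eta : nat) (P1 P2 N s1 s2 rho : R) (a1 a2 : 'cV[R]_eta)
  (B1 B2 : 'M[R]_eta) : Prop :=
  let S := SigmaX N s1 s2 rho a1 a2 B1 B2 in
  \tr (ulsubmx S) <= eta%:R * P1 /\ \tr (drsubmx S) <= eta%:R * P2.

Definition R_region (P1 P2 N s1 s2 rho : R) : set (R * R) :=
  closure [set r | exists (eta : nat) (a1 a2 : 'cV[R]_eta) (B1 B2 : 'M[R]_eta)
                          (C : 'M[R]_(2, eta)),
            [/\ (0 < eta)%N, strictly_lower B1, strictly_lower B2,
                power_ok P1 P2 N s1 s2 rho a1 a2 B1 B2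
              & region_eta N s1 s2 rho a1 a2 B1 B2 C r]].

End NoisyFB.

(* Main.v *)
Require Import Defs.
From HB Require Import structures.
From mathcomp Require Import all_boot all_order all_algebra.
From mathcomp Require Import all_classical all_reals all_analysis.
From mathcomp Require Import measurable_realfun ring lra zify.

(** Group the channel uses into blocks of length [eta].  In each block both
    transmitters apply the linear feedback scheme [(a_nu, B_nu)] to one fresh
    codeword symbol.  A receiver that undoes the feedback loop, subtracting
    [(B_1 + B_2) y] from [y], sees the memoryless channel
    [a_1 u_1 + a_2 u_2 + noise] with noise covariance [Q].  The matched filters
    [l_nu = a_nu^T C^T (C Q C^T)^-1 C] turn the two rows of [C] into scalar
    statistics whose signal gains and noise covariance are the same matrix
    [g = (l_i a_j)], and by Sylvester's identity the three determinant ratios of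
    the region are [1 + g_11], [1 + g_22] and [det (1 + g)].

    The codewords are drawn IID standard normal, scaled by a factor slightly
    below one to leave slack in the power constraint, and the receiver thresholds
    three information densities.  For the sent pair each density is a sum of
    centred quadratic forms in Gaussians, so Chebyshev's inequality applies; for
    a wrong message the exponential of the density has expectation one (a change
    of measure in the fresh coordinates), so Markov's inequality and the union
    bound apply.  The sum-rate density is a chain: user 2 given user 1, then user
    1 with user 2 as noise, with gain [g3 = g_11 - g_12^2 / (1 + g_22)].  One
    nonnegative majorant [bad] of all error and power-violation events has small
    mean, so some codebook is good for error and power at once. *)

Set Implicit Arguments.
Unset Strict Implicit.
Unset Printing Implicit Defensive.

Import Order.TTheory GRing.Theory Num.Theory.
Import numFieldNormedType.Exports.
Local Open Scope classical_set_scope.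
Local Open Scope ring_scope.

(** * Gaussian integrals *)

Section GaussianIntegrals.
Variable R : realType.
Local Notation mu := (@lebesgue_measure R).
Local Notation phi := (@normal_pdf R 0 1).

(** Because the filters make signal gain and noise covariance the same matrix, the densities can be
    written without dividing by a noise variance; vanishing or singular gains need no separate
    treatment. Splitting the sum-rate density along the chain rule keeps every change of measure
    one-dimensional: each factor integrates to one over a single fresh coordinate. Only second
    moments and rate margins enter the estimates; the resulting [1 / nb] decay suffices for
    achievability and tolerates unbounded Gaussian letters. The power constraint averages over
    messages, so it is enough to control the average deviation over the codebook, and no codeword is
    expurgated. The run of a code is never shown measurable: its error and power are dominated by
    explicit polynomials and exponentials of the coordinates, for which measurability is
    immediate. *)

Lemma normal_pdf_tilt (m s x : R) : 0 < s ->
  normal_pdf m s x =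
  phi x * expR (x ^+ 2 / 2 - (x - m) ^+ 2 / (2 * s ^+ 2)) / s.
Proof.
move=> s0; rewrite !normal_pdfE ?oner_neq0 ?gt_eqF// /normal_peak /normal_fun.
have pos2 : 0 < (pi : R) *+ 2 by rewrite pmulrn_lgt0// pi_gt0.
rewrite -mulrnAr sqrtrM ?sqr_ge0// sqrtr_sqr gtr0_norm// invfM.
rewrite expr1n mul1r subr0.
have -> : - (x - m) ^+ 2 / (s ^+ 2 *+ 2) =
  - x ^+ 2 / (1 *+ 2) + (x ^+ 2 / 2 - (x - m) ^+ 2 / (2 * s ^+ 2)).
  by field; exact: lt0r_neq0.
by rewrite expRD; ring.
Qed.

Lemma integral_normal_expR (s : R) :
  (\int[mu]_x (phi x * expR (s * x))%:E = (expR (s ^+ 2 / 2))%:E)%E.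
Proof.
under eq_integral => x _.
  rewrite (_ : phi x * _ = expR (s ^+ 2 / 2) * normal_pdf s 1 x); last first.
    rewrite (normal_pdf_tilt s x ltr01) divr1 [RHS]mulrCA -expRD; congr (_ * expR _).
    by field.
  rewrite EFinM; over.
rewrite ge0_integralZl_EFin ?expR_ge0//; first by rewrite integral_normal_pdf mule1.
- by move=> x _; rewrite lee_fin normal_pdf_ge0.
- by apply/measurable_EFinP; exact: measurable_normal_pdf.
Qed.

Lemma measurable_monomial_expR k (s : R) :
  measurable_fun setT (fun x : R => phi x * (x ^+ k * expR (s * x))).
Proof.
apply: measurable_funM; first exact: measurable_normal_pdf.
apply: measurable_funM; first exact: measurable_funX.
apply: measurableT_comp => //; exact: measurable_funM.
Qed.

Lemma integrable_normal_expR (s : R) :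
  mu.-integrable setT (fun x => (phi x * expR (s * x))%:E).
Proof.
apply/integrableP; split.
  apply/measurable_EFinP; have := measurable_monomial_expR 0 s.
  by under eq_fun do rewrite expr0 mul1r.
under eq_integral => x _.
  rewrite gee0_abs ?lee_fin ?mulr_ge0 ?normal_pdf_ge0 ?expR_ge0//; over.
by rewrite integral_normal_expR ltry.
Qed.

(** Reduces the domination of monomials to exponentials, whose Gaussian integrals are known in
    closed form. *)
Lemma normr_exp_le k (x : R) : `|x| ^+ k <= expR (k%:R * x) + expR (- k%:R * x).
Proof.
have h : `|x| ^+ k <= expR (k%:R * `|x|).
  rewrite mulrC expRM_natr lerXn2r ?nnegrE ?expR_ge0//.
  by apply: le_trans (expR_ge1Dx _); rewrite lerDr.
apply: (le_trans h); case: (leP 0 x) => x0.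
  by rewrite (ger0_norm x0) lerDl expR_ge0.
by rewrite ltr0_norm// mulrN mulNr lerDr expR_ge0.
Qed.

Lemma integrable_monomial_expR k (s : R) :
  mu.-integrable setT (fun x => (phi x * (x ^+ k * expR (s * x)))%:E).
Proof.
pose g (x : R) : \bar R := ((phi x * expR ((k%:R + s) * x))%:E +
  (phi x * expR ((- k%:R + s) * x))%:E)%E.
apply: (@le_integrable _ _ _ mu setT measurableT _ g).
- by apply/measurable_EFinP; exact: measurable_monomial_expR.
- move=> x _ /=; rewrite lee_fin -mulrDr !normrM.
  rewrite (ger0_norm (normal_pdf_ge0 _ _ _)) ler_wpM2l ?normal_pdf_ge0//.
  rewrite [leRHS]ger0_norm ?addr_ge0 ?expR_ge0// !mulrDl !expRD -mulrDl.
  by rewrite (ger0_norm (expR_ge0 _)) normrX ler_wpM2r ?expR_ge0// normr_exp_le.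
- by apply: integrableD => //; exact: integrable_normal_expR.
Qed.

(** The [k]-th derivative at [s] of the Gaussian moment generating function; at [s = 0], the [k]-th
    moment. *)
Definition mgf k (s : R) := (\int[mu]_x (phi x * (x ^+ k * expR (s * x))))%R.

Lemma is_derive_mgf k (s : R) : is_derive s 1 (mgf k) (mgf k.+1 s).
Proof.
pose f (s x : R) := phi x * (x ^+ k * expR (s * x)).
have df (t x : R) : is_derive t 1 (f ^~ x) (phi x * (x ^+ k.+1 * expR (t * x))).
  have h : is_derive t 1 (fun s => expR (s * x)) (x * expR (t * x)).
    have -> : (fun s => expR (s * x)) = expR \o ( *%R^~ x) by [].
    rewrite mulrC.
    apply: is_derive1_comp.
    have := @is_deriveM _ _ id (cst x) t 1 1 0 (is_derive_id _ _) (is_derive_cst _ _ _).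
    rewrite /GRing.scale /= mulr1 mulr0 add0r.
    by rewrite (_ : id * cst x = *%R^~ x).
  have := @is_deriveZ _ _ _ (fun s : R => expR (s * x)) (phi x * x ^+ k) t 1 _ h.
  rewrite /GRing.scale /= (_ : _ \*: _ = f ^~ x).
    by rewrite exprSr !mulrA.
  by apply/funext => y; rewrite /f /GRing.scale_fun/= /GRing.scale/= !mulrA.
(* Dominates the derivative for all [t] within one of [s]: the first factor absorbs the monomial,
   and [expR (t * x)] lies below its value at one of the two endpoints. *)
pose G (x : R) := phi x * (expR (k.+1%:R * x) + expR (- k.+1%:R * x)) *
   (expR ((s + 1) * x) + expR ((s - 1) * x)).
have Ia : `](s - 1), (s + 1)[%classic s by rewrite /= in_itv/=; lra.
have d1E (t x : R) : partial1of2 f t x = phi x * (x ^+ k.+1 * expR (t * x)).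
  by rewrite partial1of2E; case: (df t x).
have intf t : `](s - 1), (s + 1)[%classic t -> mu.-integrable setT (EFin \o f t).
  by move=> _; exact: integrable_monomial_expR.
have derf t x : `](s - 1), (s + 1)[%classic t -> setT x -> derivable (f ^~ x) t 1.
  by move=> _ _; case: (df t x).
have G0 x : 0 <= G x by rewrite !mulr_ge0 ?addr_ge0 ?normal_pdf_ge0 ?expR_ge0.
have intG : mu.-integrable setT (EFin \o G).
  rewrite (_ : EFin \o G = fun x =>
     ((phi x * expR ((k.+1%:R + (s + 1)) * x))%:E + (phi x * expR ((k.+1%:R + (s - 1)) * x))%:E +
     ((phi x * expR ((- k.+1%:R + (s + 1)) * x))%:E + (phi x * expR ((- k.+1%:R + (s - 1)) * x))%:E))%E).
    by do ?apply: integrableD => //; exact: integrable_normal_expR.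
  by apply/funext => x /=; rewrite -!EFinD /G !mulrDl !expRD; congr EFin; ring.
have Gub t x : `](s - 1), (s + 1)[%classic t -> setT x -> `|partial1of2 f t x| <= G x.
  rewrite /= in_itv/= => /andP[t1 t2] _; rewrite d1E !normrM /G -mulrA.
  rewrite (ger0_norm (normal_pdf_ge0 _ _ _)) (ger0_norm (expR_ge0 _)) ler_wpM2l ?normal_pdf_ge0//.
  rewrite normrX ler_pM ?exprn_ge0 ?expR_ge0// ?normr_exp_le//.
  case: (leP 0 x) => x0.
    by apply: ler_wpDr; rewrite ?expR_ge0// ler_expR ler_wpM2r// ltW.
  by apply: ler_wpDl; rewrite ?expR_ge0// ler_expR ler_wnM2r// ltW.
have := derivable_under_integral measurableT Ia intf derf G0 intG Gub.
have := differentiation_under_integral measurableT Ia intf derf G0 intG Gub.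
rewrite derive1E => Dm dm; apply: DeriveDef => //.
rewrite Dm; apply: eq_Rintegral => x _; exact: d1E.
Qed.

Lemma mgf0E (s : R) : mgf 0 s = expR (s ^+ 2 / 2).
Proof.
rewrite /mgf /Rintegral; under eq_integral do rewrite expr0 mul1r.
by rewrite integral_normal_expR.
Qed.

(** Differentiating [p.[s] * expR (s ^+ 2 / 2)] gives a Hermite-type recursion, so the moments
    follow by polynomial algebra. *)
Lemma mgf_recur k (p q : {poly R}) : (forall s, mgf k s = p.[s] * expR (s ^+ 2 / 2)) ->
  q = (p^`() + 'X * p)%R ->
  forall s, mgf k.+1 s = q.[s] * expR (s ^+ 2 / 2).
Proof.
move=> H -> s.
have h1 : is_derive s 1 (mgf k) (mgf k.+1 s) by exact: is_derive_mgf.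
have h2 : is_derive s 1 (mgf k) ((p^`() + 'X * p).[s] * expR (s ^+ 2 / 2)).
  rewrite (funext H).
  have he : is_derive s 1 (fun s : R => expR (s ^+ 2 / 2)) (expR (s ^+ 2 / 2) * s).
    have -> : (fun s : R => expR (s ^+ 2 / 2)) = expR \o (fun s => s ^+ 2 / 2) by [].
    apply: is_derive1_comp.
    have := is_derive_poly (2^-1 *: 'X^2) s.
    rewrite (_ : (_ *: _)^`().[s] = s); last first.
      by rewrite derivZ derivXn hornerZ hornerMn expr1 hornerX -[s *+ 2]mulr_natl mulKf.
    by rewrite (_ : horner _ = fun s => s ^+ 2 / 2)//; apply/funext => y; rewrite hornerZ hornerXn mulrC.
  have := @is_deriveM _ _ _ _ s 1 _ _ (is_derive_poly p s) he.
  rewrite /GRing.scale/= hornerD hornerM hornerX => h2.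
  rewrite (_ : (_ + _) * _ = p.[s] * (expR (s ^+ 2 / 2) * s) + expR (s ^+ 2 / 2) * p^`().[s])//.
  by ring.
by rewrite -(@derive_val _ _ _ _ _ _ _ h1) (@derive_val _ _ _ _ _ _ _ h2).
Qed.

Lemma gauss_moments : [/\ mgf 0 0 = 1, mgf 1 0 = 0, mgf 2 0 = 1, mgf 3 0 = 0 & mgf 4 0 = 3].
Proof.
have e0 : expR (0 ^+ 2 / 2) = 1 :> R by rewrite expr0n/= mul0r expR0.
have h0 : forall s, mgf 0 s = (1 : {poly R}).[s] * expR (s ^+ 2 / 2).
  by move=> s; rewrite mgf0E hornerE mul1r.
have h1 : forall s, mgf 1 s = ('X : {poly R}).[s] * expR (s ^+ 2 / 2).
  by apply: (mgf_recur h0); rewrite derivC add0r mulr1.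
have h2 : forall s, mgf 2 s = (1 + 'X^2 : {poly R}).[s] * expR (s ^+ 2 / 2).
  by apply: (mgf_recur h1); rewrite derivX.
have h3 : forall s, mgf 3 s = ('X *+ 3 + 'X^3 : {poly R}).[s] * expR (s ^+ 2 / 2).
  by apply: (mgf_recur h2); rewrite derivD derivC derivXn expr1; ring.
have h4 : forall s, mgf 4 s = (3%:R + 'X^2 *+ 6 + 'X^4 : {poly R}).[s] * expR (s ^+ 2 / 2).
  by apply: (mgf_recur h3); rewrite derivD derivMn derivX derivXn; ring.
by split; rewrite ?(h0, h1, h2, h3, h4) e0 ?hornerD ?hornerMn ?hornerXn ?hornerX ?hornerC
  ?expr0n/= ?mul0rn ?addr0 ?add0r ?mulr1 ?mul0r.
Qed.

(** Degree four is the degree in one coordinate of a squared quadratic form; odd moments vanish and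
    the fourth one is [3]. *)
Lemma normal_quartic (p0 p1 p2 p3 p4 : R) :
  (\int[mu]_x (phi x * (p0 + p1 * x + p2 * x ^+ 2 + p3 * x ^+ 3 + p4 * x ^+ 4))%:E
   = (p0 + p2 + 3 * p4)%:E)%E.
Proof.
have [m0 m1 m2 m3 m4] := gauss_moments.
pose F k (x : R) := (phi x * (x ^+ k * expR (0 * x)))%:E.
have iF k : mu.-integrable setT (F k) by exact: integrable_monomial_expR.
have vF k : (\int[mu]_x F k x = (mgf k 0)%:E)%E.
  by rewrite /mgf /Rintegral fineK//; exact: (integrable_fin_num measurableT (iF k)).
have iZ c k : mu.-integrable setT (fun x => c%:E * F k x)%E by exact: integrableZl.
have i01 := integrableD measurableT (iZ p0 0%N) (iZ p1 1%N).
have i02 := integrableD measurableT i01 (iZ p2 2%N).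
have i03 := integrableD measurableT i02 (iZ p3 3%N).
transitivity (\int[mu]_x (p0%:E * F 0%N x + p1%:E * F 1%N x + p2%:E * F 2%N x
   + p3%:E * F 3%N x + p4%:E * F 4%N x))%E.
  apply: eq_integral => x _; rewrite /F -!EFinM -!EFinD; congr EFin.
  by rewrite mul0r expR0; ring.
rewrite (integralD measurableT i03 (iZ _ _)) (integralD measurableT i02 (iZ _ _)).
rewrite (integralD measurableT i01 (iZ _ _)) (integralD measurableT (iZ _ _) (iZ _ _)).
rewrite !integralZl// !vF m0 m1 m2 m3 m4 -!EFinM -!EFinD; congr EFin; ring.
Qed.

(** The information density of the scalar channel [s = g * th + n] with
    [th ~ N(0,1)] and [n ~ N(0,g)] *)
Definition infod (g th s : R) : R :=
  th * s - g * th ^+ 2 / 2 - s ^+ 2 / (2 * (1 + g)) + ln (1 + g) / 2.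

(** Given the received value [s], the letter is normal with mean [s / (1 + g)] and variance
    [1 / (1 + g)]; the integrand is exactly this posterior density, also for [g = 0]. *)
Lemma integral_infod (g s : R) : 0 <= g ->
  (\int[mu]_x (phi x * expR (infod g x s))%:E = 1)%E.
Proof.
move=> g0; have g1 : 0 < 1 + g by rewrite ltr_pwDl.
rewrite -(@integral_normal_pdf R (s / (1 + g)) (Num.sqrt (1 + g))^-1).
apply: eq_integral => x _; congr EFin.
have s0 : 0 < (Num.sqrt (1 + g))^-1 by rewrite invr_gt0 sqrtr_gt0.
rewrite [RHS]normal_pdf_tilt// exprVn sqr_sqrtr ?ltW// invrK -[RHS]mulrA; congr (_ * _).
have <- : expR (ln (1 + g) / 2) = Num.sqrt (1 + g).
  apply/eqP; rewrite -(@eqrXn2 _ 2) ?expR_ge0 ?sqrtr_ge0// sqr_sqrtr ?ltW//.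
  by rewrite -expRM_natr divfK// lnK ?posrE.
rewrite -expRD; congr expR; rewrite /infod; field.
by rewrite lt0r_neq0.
Qed.

End GaussianIntegrals.

(** * Iterated Gaussian expectations *)

(** The integral of a nonnegative function is a supremum over the simple functions below it, hence
    monotone whatever the measurability. The error and power integrands of a code are compared
    through this fact. *)
Lemma ge0_le_integralT d (T : measurableType d) (R : realType)
    (mu : {measure set T -> \bar R}) (f g : T -> \bar R) :
  (forall x, 0 <= f x)%E -> (forall x, f x <= g x)%E ->
  (\int[mu]_x f x <= \int[mu]_x g x)%E.
Proof.
move=> f0 fg; have g0 x : (0 <= g x)%E by exact: le_trans (fg x).
rewrite !ge0_integralTE//; apply: le_ereal_sup => _ [h hf <-].
by exists h => // x; exact: le_trans (fg x).
Qed.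

Section IteratedExpectation.
Variable R : realType.
Local Notation mu := (@lebesgue_measure R).
Local Notation phi := (@normal_pdf R 0 1).
Local Open Scope ereal_scope.

Lemma measurable_phi : measurable_fun setT phi.
Proof. exact: measurable_normal_pdf. Qed.

Lemma phi_ge0 x : 0 <= (phi x)%:E.
Proof. by rewrite lee_fin normal_pdf_ge0. Qed.
Local Hint Resolve phi_ge0 : core.

Lemma gexp_ge0 k (f : k.-tuple R -> \bar R) : (forall t, 0 <= f t) -> 0 <= gexp f.
Proof.
elim: k f => [|k IH] f f0 //=.
by apply: integral_ge0 => x _; apply: mule_ge0 => //; exact: IH.
Qed.

Lemma gexp_le k (f g : k.-tuple R -> \bar R) :
  (forall t, 0 <= f t) -> (forall t, f t <= g t) -> gexp f <= gexp g.
Proof.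
elim: k f g => [|k IH] f g f0 fg //=.
apply: ge0_le_integralT => x; first by apply: mule_ge0 => //; exact: gexp_ge0.
by apply: lee_wpmul2l => //; exact: IH.
Qed.

(** [gexp] on functions of the underlying sequence, which makes splitting the
    coordinates into consecutive groups cast-free *)
Definition gE k (F : seq R -> \bar R) : \bar R := gexp (fun t : k.-tuple R => F t).

Definition mseq k (F : seq R -> \bar R) : Prop :=
  measurable_fun [set: k.-tuple R] (fun t => F t).

Lemma gE0 F : gE 0 F = F [::].
Proof. by []. Qed.

Lemma gES k F : gE k.+1 F = \int[mu]_x ((phi x)%:E * gE k (fun s => F (x :: s))).
Proof. by []. Qed.

Lemma gE_ge0 k F : (forall s, 0 <= F s) -> 0 <= gE k F.
Proof. by move=> F0; exact: gexp_ge0. Qed.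

Lemma eq_gE k F G : (forall s, size s = k -> F s = G s) -> gE k F = gE k G.
Proof.
move=> FG; rewrite /gE; congr gexp; apply/funext => t; apply: FG.
by rewrite size_tuple.
Qed.

Lemma le_gE k F G : (forall s, 0 <= F s) ->
  (forall s, size s = k -> F s <= G s) -> gE k F <= gE k G.
Proof. by move=> F0 FG; apply: gexp_le => // t; apply: FG; rewrite size_tuple. Qed.

Lemma gE_cat k m F :
  gE (k + m) F = gE k (fun u => gE m (fun v => F (u ++ v))).
Proof.
elim: k F => [|k IH] F //.
by rewrite addSn !gES; apply: eq_integral => x _; rewrite IH.
Qed.

Lemma integral_phi_cst (c : \bar R) : 0 <= c -> \int[mu]_x ((phi x)%:E * c) = c.
Proof.
move=> c0; under eq_integral do rewrite muleC.
rewrite ge0_integralZl//; first by rewrite integral_normal_pdf mule1.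
by apply/measurable_EFinP; exact: measurable_phi.
Qed.

Lemma gE_cst k (c : \bar R) : 0 <= c -> gE k (fun=> c) = c.
Proof.
move=> c0; elim: k => [|k IH] //; rewrite gES.
by under eq_integral do rewrite IH; exact: integral_phi_cst.
Qed.

(** Tonelli with a parameter. The space [T] is arbitrary because the induction moves one coordinate
    at a time from the tuple into the parameter. *)
Lemma measurable_gE_param d (T : measurableType d) k (F : T -> seq R -> \bar R) :
  (forall t s, 0 <= F t s) ->
  measurable_fun [set: T * k.-tuple R] (fun p => F p.1 p.2) ->
  measurable_fun [set: T] (fun t => gE k (F t)).
Proof.
elim: k d T F => [|k IH] d T F F0 mF.
  rewrite (_ : (fun t => _) = (fun p : T * 0.-tuple R => F p.1 p.2) \o (fun t => (t, [tuple]))).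
    apply: measurableT_comp => //; exact: pair1_measurable.
  by apply/funext.
pose G (p : T * R) := (phi p.2)%:E * gE k (fun s => F p.1 (p.2 :: s)).
have mG : measurable_fun setT G.
  apply: emeasurable_funM.
    by apply/measurable_EFinP; apply: (measurableT_comp measurable_phi).
  apply: (IH _ (T * R)%type (fun p s => F p.1 (p.2 :: s))) => //.
  rewrite (_ : (fun p => _) = (fun p : T * k.+1.-tuple R => F p.1 p.2) \o
    (fun p : T * R * k.-tuple R => (p.1.1, [the k.+1.-tuple R of p.1.2 :: p.2]))).
    apply: measurableT_comp => //; apply: measurable_fun_pair => /=.
      exact: measurableT_comp.
    by apply: measurable_cons => //; exact: measurableT_comp.
  by apply/funext.
have G0 p : 0 <= G p by apply: mule_ge0 => //; exact: gE_ge0.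
exact: (@measurable_fun_fubini_tonelli_F _ _ T (measurableTypeR R) R mu G mG G0).
Qed.

Lemma mseq_cons2 k F : mseq k.+1 F ->
  measurable_fun [set: R * k.-tuple R] (fun p => F (p.1 :: p.2)).
Proof.
move=> mF; rewrite (_ : (fun p => _) = (fun t : k.+1.-tuple R => F t) \o
    (fun p : R * k.-tuple R => [the k.+1.-tuple R of p.1 :: p.2]))//.
apply: measurableT_comp => //; exact: measurable_cons.
Qed.

Lemma mseq_cons k F x : mseq k.+1 F -> mseq k (fun s => F (x :: s)).
Proof.
move=> mF; rewrite /mseq (_ : (fun p => _) = (fun t : k.+1.-tuple R => F t) \o
    (fun p : k.-tuple R => [the k.+1.-tuple R of x :: p]))//.
by apply: measurableT_comp => //; exact: measurable_cons.
Qed.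

Lemma measurable_gE_cons k F : (forall s, 0 <= F s) -> mseq k.+1 F ->
  measurable_fun [set: R] (fun x => gE k (fun s => F (x :: s))).
Proof.
move=> F0 mF; apply: (@measurable_gE_param _ R k (fun x s => F (x :: s))) => //.
exact: mseq_cons2.
Qed.

Lemma measurable_phi_gE_cons k F : (forall s, 0 <= F s) -> mseq k.+1 F ->
  measurable_fun [set: R] (fun x => (phi x)%:E * gE k (fun s => F (x :: s))).
Proof.
move=> F0 mF; apply: emeasurable_funM; last exact: measurable_gE_cons.
by apply/measurable_EFinP; exact: measurable_phi.
Qed.

Lemma gED k F G : (forall s, 0 <= F s) -> (forall s, 0 <= G s) ->
  mseq k F -> mseq k G -> gE k (fun s => F s + G s) = gE k F + gE k G.
Proof.
elim: k F G => [|k IH] F G F0 G0 mF mG //; rewrite !gES -ge0_integralD//.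
- apply: eq_integral => x _; rewrite IH//; try exact: mseq_cons.
  by rewrite ge0_muleDr//; exact: gE_ge0.
- by move=> x _; apply: mule_ge0 => //; exact: gE_ge0.
- exact: measurable_phi_gE_cons.
- by move=> x _; apply: mule_ge0 => //; exact: gE_ge0.
- exact: measurable_phi_gE_cons.
Qed.

Lemma gE_sum k (I : Type) (r : seq I) (F : I -> seq R -> \bar R) :
  (forall i s, 0 <= F i s) -> (forall i, mseq k (F i)) ->
  gE k (fun s => \sum_(i <- r) F i s) = \sum_(i <- r) gE k (F i).
Proof.
move=> F0 mF; elim: r => [|i r IH].
  by under eq_gE do rewrite big_nil; rewrite big_nil gE_cst.
under eq_gE do rewrite big_cons.
rewrite big_cons -IH gED//.
  by move=> s; exact: sume_ge0.
exact: emeasurable_sum.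
Qed.

Lemma gEZl k (c : R) F : (0 <= c)%R -> (forall s, 0 <= F s) -> mseq k F ->
  gE k (fun s => c%:E * F s) = c%:E * gE k F.
Proof.
move=> c0; elim: k F => [|k IH] F F0 mF //; rewrite !gES -ge0_integralZl_EFin//.
- by apply: eq_integral => x _; rewrite (IH _ _ (mseq_cons _ mF))// muleCA.
- by move=> x _; apply: mule_ge0 => //; exact: gE_ge0.
- exact: measurable_phi_gE_cons.
Qed.

Lemma gE_integral_swap k (G : R -> seq R -> \bar R) :
  (forall y s, 0 <= G y s) ->
  measurable_fun [set: R * k.-tuple R] (fun p => G p.1 p.2) ->
  gE k (fun s => \int[mu]_y ((phi y)%:E * G y s)) =
  \int[mu]_y ((phi y)%:E * gE k (G y)).
Proof.
elim: k G => [|k IH] G G0 mG //; rewrite gES.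
have mG' (y : R) : mseq k.+1 (G y).
  rewrite /mseq (_ : (fun t => _) = (fun p : R * k.+1.-tuple R => G p.1 p.2) \o
    (fun t => (y, t)))//.
  apply: measurableT_comp => //; exact: pair1_measurable.
pose H (p : R * R) := gE k (fun s => G p.2 (p.1 :: s)).
have mH : measurable_fun setT H.
  apply: (@measurable_gE_param _ (R * R)%type k (fun p s => G p.2 (p.1 :: s))) => //.
  rewrite (_ : (fun p => _) = (fun p : R * k.+1.-tuple R => G p.1 p.2) \o
    (fun p : R * R * k.-tuple R => (p.1.2, [the k.+1.-tuple R of p.1.1 :: p.2]))).
    apply: measurableT_comp => //; apply: measurable_fun_pair => /=.
      exact: measurableT_comp.
    by apply: measurable_cons => //; exact: measurableT_comp.
  by apply/funext.
have mphi1 : measurable_fun [set: R * R] (fun p : R * R => (phi p.1)%:E).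
  by apply/measurable_EFinP; apply: (measurableT_comp measurable_phi).
have mphi2 : measurable_fun [set: R * R] (fun p : R * R => (phi p.2)%:E).
  by apply/measurable_EFinP; apply: (measurableT_comp measurable_phi).
pose K (p : R * R) := (phi p.1)%:E * ((phi p.2)%:E * H p).
have mK : measurable_fun setT K by do 2?apply: emeasurable_funM.
have H0 p : 0 <= H p by exact: gE_ge0.
have K0 p : 0 <= K p by do 2?apply: mule_ge0.
have mphiE : measurable_fun [set: R] (fun x => (phi x)%:E).
  by apply/measurable_EFinP; exact: measurable_phi.
transitivity (\int[mu]_x \int[mu]_y K (x, y)).
  apply: eq_integral => x _.
  rewrite IH//; last first.
    rewrite (_ : (fun p => _) = (fun p : R * k.+1.-tuple R => G p.1 p.2) \o
      (fun p : R * k.-tuple R => (p.1, [the k.+1.-tuple R of x :: p.2])))//.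
    apply: measurableT_comp => //; apply: measurable_fun_pair => //=.
    exact: measurable_cons.
  rewrite /K/= ge0_integralZl_EFin ?normal_pdf_ge0//.
    by move=> y _; exact: mule_ge0.
  apply: emeasurable_funM => //.
  apply: (measurableT_comp mH); exact: pair1_measurable.
rewrite (@fubini_tonelli _ _ (measurableTypeR R) (measurableTypeR R) R mu mu K mK K0); apply: eq_integral => y _.
transitivity (\int[mu]_x ((phi y)%:E * ((phi x)%:E * gE k (fun s => G y (x :: s))))).
  by apply: eq_integral => x _; rewrite /K muleCA.
rewrite ge0_integralZl_EFin ?normal_pdf_ge0//.
- by move=> x _; apply: mule_ge0 => //; exact: gE_ge0.
- exact: measurable_phi_gE_cons.
Qed.

(** Resampling: coordinates in [S] are redrawn from [y], the others are kept from [x]. *)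
Fixpoint merge (S : nat -> bool) (x y : seq R) : seq R :=
  match x, y with
  | a :: x', b :: y' => (if S 0%N then b else a) :: merge (fun i => S i.+1) x' y'
  | _, _ => [::]
  end.

Lemma size_merge S x y : size x = size y -> size (merge S x y) = size x.
Proof.
by elim: x S y => [|a x IH] S [|b y] //= [e]; rewrite IH.
Qed.

Lemma nth_merge S x y i : size x = size y ->
  nth 0%R (merge S x y) i = if S i then nth 0%R y i else nth 0%R x i.
Proof.
elim: x S y i => [|a x IH] S [|b y] // i; first by rewrite /= !nth_nil if_same.
by move=> [e]; case: i => [|i] //=; rewrite IH.
Qed.

Lemma measurable_merge d (T : measurableType d) k F S (f g : T -> k.-tuple R) :
  mseq k F -> measurable_fun setT f -> measurable_fun setT g ->
  measurable_fun [set: T] (fun p => F (merge S (f p) (g p))).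
Proof.
move=> mF mf mg.
have sz p : size (merge S (f p) (g p)) == k by rewrite size_merge ?size_tuple.
rewrite (_ : (fun p => _) = (fun t : k.-tuple R => F t) \o (fun p => Tuple (sz p)))//.
apply: measurableT_comp => //; apply/measurable_fun_tnthP => i.
rewrite (_ : _ \o _ = fun p => if S i then tnth (g p) i else tnth (f p) i).
  case: (S i).
    by apply: (measurableT_comp (@measurable_tnth _ _ _ i)).
  by apply: (measurableT_comp (@measurable_tnth _ _ _ i)).
by apply/funext => p /=; rewrite !(tnth_nth 0%R)/= nth_merge ?size_tuple.
Qed.

(** The coordinates are IID, so redrawing any subset of them preserves the expectation. Freezing [x]
    and integrating over [y] then amounts to conditioning on the coordinates outside [S]. *)
Lemma gE_resample k S F : (forall s, 0 <= F s) -> mseq k F ->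
  gE k (fun x => gE k (fun y => F (merge S x y))) = gE k F.
Proof.
elim: k S F => [|k IH] S F F0 mF //; rewrite gES.
under eq_integral => x0 _.
  rewrite (_ : gE k _ = \int[mu]_y0 ((phi y0)%:E *
     gE k (fun s => F ((if S 0%N then y0 else x0) :: s)))); last first.
    (* The fresh first coordinate is integrated inside the integrals over the tail of [x]; moving it
       outside brings the two tails together for the induction hypothesis. *)
    pose G y0 x' := gE k (fun y' => F ((if S 0%N then y0 else x0) ::
        merge (fun i => S i.+1) x' y')).
    transitivity (gE k (fun s => \int[mu]_y ((phi y)%:E * G y s))) => //.
    rewrite gE_integral_swap.
    - apply: eq_integral => y0 _; congr (_ * _).
      rewrite /G; apply: (IH (fun i => S i.+1) (fun s => F (_ :: s))) => //.
      exact: mseq_cons.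
    - by move=> y s; exact: gE_ge0.
    rewrite /G; apply: (@measurable_gE_param _ (R * k.-tuple R)%type k
      (fun p y' => F ((if S 0%N then p.1 else x0) :: merge (fun i => S i.+1) p.2 y'))) => //.
    pose S' i := if i is j.+1 then S j.+1 else true.
    rewrite (_ : (fun p => _) = fun p : R * k.-tuple R * k.-tuple R => F (merge S' (x0 :: p.1.2)
        ((if S 0%N then p.1.1 else x0) :: p.2)))//.
    apply: (@measurable_merge _ (R * k.-tuple R * k.-tuple R)%type k.+1 F S'
      (fun p => [the k.+1.-tuple R of x0 :: p.1.2])
      (fun p => [the k.+1.-tuple R of (if S 0%N then p.1.1 else x0) :: p.2])) => //.
      by apply: measurable_cons => //; exact: measurableT_comp.
    apply: measurable_cons => //.
    by case: (S 0%N) => //; exact: measurableT_comp.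
  over.
have gF y : 0 <= gE k (fun s => F (y :: s)) by exact: gE_ge0.
case: (S 0%N).
  rewrite integral_phi_cst//.
  by apply: integral_ge0 => y _; exact: mule_ge0.
by under eq_integral do rewrite integral_phi_cst//.
Qed.

(** Given its prefix, each exponential has mean one. The constant [c] carries the exponents of the
    coordinates already fixed by the induction. *)
Lemma gE_expR_martingale k (c : R) (h : nat -> seq R -> R -> R) :
  (forall i p, measurable_fun setT (h i p)) ->
  (forall i p, \int[mu]_x (phi x * expR (h i p x))%:E = 1) ->
  gE k (fun y => (expR (c + \sum_(i < k) h i (take i y) (nth 0 y i)))%:E) = (expR c)%:E.
Proof.
move=> mh ih; elim: k c h mh ih => [|k IH] c h mh ih.
  by rewrite gE0 big_ord0 addr0.
rewrite gES.
under eq_integral => x _.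
  rewrite (_ : gE k _ = (expR (c + h 0%N [::] x))%:E); last first.
    rewrite -(IH (c + h 0%N [::] x)%R (fun i p => h i.+1 (x :: p)))//.
    by apply: eq_gE => s _; rewrite big_ord_recl/= addrA.
  rewrite expRD -EFinM mulrCA EFinM; over.
rewrite ge0_integralZl_EFin ?expR_ge0// ?ih ?mule1//.
- by move=> x _; rewrite lee_fin mulr_ge0 ?normal_pdf_ge0 ?expR_ge0.
- apply/measurable_EFinP; apply: measurable_funM; first exact: measurable_phi.
  exact: (measurableT_comp (@measurable_expR R) (mh 0%N [::])).
Qed.

Local Open Scope ring_scope.

Lemma sum2_recl k (f : nat -> nat -> R) :
  \sum_(i < k.+1) \sum_(j < k.+1) f i j =
  f 0%N 0%N + \sum_(i < k) (f 0%N i.+1 + f i.+1 0%N) +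
  \sum_(i < k) \sum_(j < k) f i.+1 j.+1.
Proof.
rewrite big_ord_recl/= big_ord_recl/= -!addrA; congr (_ + _).
rewrite big_split/= -addrA; congr (_ + _).
by rewrite -big_split/=; apply: eq_bigr => i _; rewrite big_ord_recl.
Qed.

(** For symmetric [A] the two sides agree; otherwise symmetrising costs
    [(a + b)^2 <= 2 (a^2 + b^2)]. Fixing the first coordinate turns its cross terms into linear
    coefficients of the remaining ones, which is why the linear part is carried along. *)
Lemma gE_quadratic k (c : R) (l : nat -> R) (A : nat -> nat -> R) :
  (gE k (fun x => ((c + \sum_(i < k) l i * nth 0 x i +
     \sum_(i < k) \sum_(j < k) A i j * (nth 0 x i * nth 0 x j - (i == j :> nat)%:R)) ^+ 2)%:E)
   <= (c ^+ 2 + \sum_(i < k) l i ^+ 2 + 2 * \sum_(i < k) \sum_(j < k) A i j ^+ 2)%:E)%E.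
Proof.
elim: k c l A => [|k IH] c l A; first by rewrite gE0 !big_ord0 mulr0 !addr0.
rewrite gES.
pose al := A 0%N 0%N.
pose m j := A 0%N j.+1 + A j.+1 0%N.
pose A' i j := A i.+1 j.+1.
pose V := 2 * \sum_(i < k) \sum_(j < k) A' i j ^+ 2.
apply: (@le_trans _ _ (\int[mu]_x ((phi x)%:E *
   (((c + l 0%N * x + al * (x ^+ 2 - 1)) ^+ 2 + \sum_(j < k) (l j.+1 + x * m j) ^+ 2 + V)%:E)))%E).
  apply: ge0_le_integralT => x.
    by apply: mule_ge0 => //; apply: gE_ge0 => s; rewrite lee_fin sqr_ge0.
  apply: lee_wpmul2l => //; apply: le_trans (IH _ (fun j => l j.+1 + x * m j) A').
  rewrite le_eqVlt; apply/orP; left; apply/eqP/eq_gE => s _; congr (_ ^+ 2)%:E.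
  rewrite (sum2_recl k (fun i j => A i j * (nth 0 (x :: s) i * nth 0 (x :: s) j - (i == j)%:R)))/=.
  rewrite big_ord_recl/= (eq_bigr (fun i : 'I_k => l i.+1 * nth 0 s i))//.
  under [X in _ = _ + X + _]eq_bigr do rewrite mulrDl.
  rewrite [in RHS]big_split/=.
  have -> : \sum_(i < k) x * m i * nth 0 s i = \sum_(i < k) (A 0%N i.+1 * (x * nth 0 s i - 0)
     + A i.+1 0%N * (nth 0 s i * x - 0)).
    by apply: eq_bigr => i _; rewrite /m; ring.
  rewrite /al /A' -[X in _ = _ + X]/(\sum_(i < k) \sum_(j < k)
    A i.+1 j.+1 * (nth 0 s i * nth 0 s j - (i.+1 == j.+1)%:R)); ring.
pose L := \sum_(j < k) l j.+1 ^+ 2; pose M := \sum_(j < k) m j ^+ 2.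
pose LM := \sum_(j < k) l j.+1 * m j.
have e x : \sum_(j < k) (l j.+1 + x * m j) ^+ 2 = L + 2 * x * LM + x ^+ 2 * M.
  rewrite /L /LM /M !mulr_sumr -!big_split/=; apply: eq_bigr => j _; ring.
under eq_integral => x _.
  rewrite e -EFinM (_ : _ + V = ((c - al) ^+ 2 + L + V) + (2 * (c - al) * l 0%N + 2 * LM) * x
    + (l 0%N ^+ 2 + 2 * (c - al) * al + M) * x ^+ 2 + (2 * l 0%N * al) * x ^+ 3 + al ^+ 2 * x ^+ 4).
    over.
  ring.
rewrite normal_quartic lee_fin (sum2_recl k (fun i j => A i j ^+ 2)) big_ord_recl/=.
rewrite -/al.
have hM : M <= 2 * \sum_(i < k) (A 0%N i.+1 ^+ 2 + A i.+1 0%N ^+ 2).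
  rewrite mulr_sumr; apply: ler_sum => i _; rewrite /m.
  have := sqr_ge0 (A 0%N i.+1 - A i.+1 0%N); nra.
rewrite (_ : \sum_(i < k) l (bump 0 i) ^+ 2 = L)// /V.
set X1 := \sum_(i < k) (A 0%N _ ^+ 2 + _) in hM *.
rewrite /A'; set X3 := \sum_(i < k) \sum_(j < k) _.
by lra.
Qed.

Lemma sum_if_range (k lo m : nat) (f : nat -> R) : (lo + m <= k)%N ->
  \sum_(i < k) (if (lo <= i < lo + m)%N then f i else 0) = \sum_(b < m) f (lo + b)%N.
Proof.
move=> h; rewrite -(big_mkord xpredT (fun i => if (lo <= i < lo + m)%N then f i else 0)).
rewrite (big_cat_nat _ (n := lo))//=; last by lia.
rewrite [X in X + _]big_nat_cond big1 ?add0r; last first.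
  by move=> i /andP[/andP[_ il] _]; rewrite leqNgt il.
rewrite (big_cat_nat _ (n := lo + m))//= ?leq_addr//.
rewrite [X in _ + X]big_nat_cond [X in _ + X]big1 ?addr0; last first.
  by move=> i /andP[/andP[il _] _]; rewrite (ltnNge i) il andbF.
rewrite -{1}[lo]add0n big_addn addKn -(big_mkord xpredT (fun b => f (lo + b)%N)).
by apply: eq_big_nat => b /andP[_ bm]; rewrite addnC leq_addr ltn_add2l bm.
Qed.

Lemma sum_delta (k i0 : nat) (f : nat -> R) : (i0 < k)%N ->
  \sum_(i < k) (i0 == i)%:R * f i = f i0.
Proof.
move=> h; rewrite (bigD1 (Ordinal h))//= eqxx mul1r big1 ?addr0// => i /negP ni.
by case: eqP => [e|]; rewrite ?mul0r//; exfalso; apply: ni; apply/eqP/val_inj.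
Qed.

(** Coefficients are pushed forward along [io], so that a form can be indexed by the variables it
    uses instead of by all [k] coordinates. *)
Lemma gE_quadratic_inj k (U : finType) (io : U -> nat) (c : R) (l : U -> R) (A : U -> U -> R) :
  injective io -> (forall u, (io u < k)%N) ->
  (gE k (fun x => ((c + \sum_u l u * nth 0 x (io u) +
     \sum_u \sum_v A u v * (nth 0 x (io u) * nth 0 x (io v) - (u == v)%:R)) ^+ 2)%:E)
   <= (c ^+ 2 + \sum_u l u ^+ 2 + 2 * \sum_u \sum_v A u v ^+ 2)%:E)%E.
Proof.
move=> inj lt.
pose l' i := \sum_u l u * (io u == i)%:R.
pose A' i j := \sum_u \sum_v A u v * ((io u == i)%:R * (io v == j)%:R).
have E1 (f : nat -> R) : \sum_(i < k) l' i * f i = \sum_u l u * f (io u).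
  under eq_bigr do rewrite mulr_suml.
  rewrite exchange_big/=; apply: eq_bigr => u _.
  by under eq_bigr do rewrite -mulrA; rewrite -mulr_sumr sum_delta.
have E2 (f : nat -> nat -> R) :
    \sum_(i < k) \sum_(j < k) A' i j * f i j = \sum_u \sum_v A u v * f (io u) (io v).
  transitivity (\sum_u \sum_v \sum_(i < k) \sum_(j < k)
     A u v * ((io u == i)%:R * (io v == j)%:R) * f i j).
    under eq_bigr do under eq_bigr do rewrite mulr_suml.
    under eq_bigr do under eq_bigr do under eq_bigr do rewrite mulr_suml.
    under eq_bigr do rewrite exchange_big/=.
    rewrite exchange_big/=; apply: eq_bigr => u _.
    under eq_bigr do rewrite exchange_big/=.
    by rewrite exchange_big.
  apply: eq_bigr => u _; apply: eq_bigr => v _.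
  rewrite -(sum_delta (fun i => A u v * f i (io v)) (lt u)); apply: eq_bigr => i _.
  rewrite -(sum_delta (fun j => f i j) (lt v)) !mulr_sumr; apply: eq_bigr => j _; ring.
have L1 u : l' (io u) = l u.
  rewrite /l' (bigD1 u)//= eqxx mulr1 big1 ?addr0// => v vu.
  by rewrite (inj_eq inj) (negbTE vu) mulr0.
have L2 u v : A' (io u) (io v) = A u v.
  rewrite /A' (bigD1 u)//= (bigD1 v)//= !eqxx !mulr1 !big1 ?addr0// => w wu.
    by rewrite big1// => z _; rewrite (inj_eq inj) (negbTE wu) mul0r mulr0.
  by rewrite (inj_eq inj (w) v) (negbTE wu) !mulr0.
have := gE_quadratic k c l' A'.
rewrite (E2 (fun i j => A' i j)) (E1 (fun i => l' i)).
under [X in 2 * X]eq_bigr do under eq_bigr do rewrite L2.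
under [X in _ + X + _]eq_bigr do rewrite L1.
move=> H; apply: le_trans H; rewrite le_eqVlt; apply/orP; left; apply/eqP/eq_gE => x _.
congr (_ ^+ 2)%:E; rewrite (E1 (fun i => nth 0 x i)); congr (_ + _).
rewrite (E2 (fun i j => nth 0 x i * nth 0 x j - (i == j)%:R)).
by apply: eq_bigr => u _; apply: eq_bigr => v _; rewrite (inj_eq inj).
Qed.

(** Distinct blocks read disjoint coordinates, so the whole sum is one block-diagonal form and the
    bound is linear, not quadratic, in the number of blocks. *)
Lemma gE_block_quadratic k (m : nat) (V : finType) (io : 'I_m -> V -> nat) (a : V -> V -> R) :
  injective (fun p : 'I_m * V => io p.1 p.2) -> (forall b v, (io b v < k)%N) ->
  (gE k (fun x => ((\sum_b (\sum_u \sum_v a u v * (nth 0 x (io b u) * nth 0 x (io b v))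
     - \sum_v a v v)) ^+ 2)%:E)
   <= (m%:R * (2 * \sum_u \sum_v a u v ^+ 2))%:E)%E.
Proof.
move=> inj lt.
pose A (p q : 'I_m * V) := (p.1 == q.1)%:R * a p.2 q.2.
have E (f : 'I_m -> V -> V -> R) :
    \sum_p \sum_q A p q * f p.1 p.2 q.2 = \sum_b \sum_u \sum_v a u v * f b u v.
  rewrite -(pair_big xpredT xpredT (fun b u => \sum_q A (b, u) q * f b u q.2))/=.
  apply: eq_bigr => b _; apply: eq_bigr => u _.
  rewrite -(pair_big xpredT xpredT (fun b' v => A (b, u) (b', v) * f b u v))/=.
  rewrite (bigD1 b)//= [X in _ + X]big1 ?addr0.
    by apply: eq_bigr => v _; rewrite /A/= eqxx mul1r.
  by move=> b' bb'; rewrite big1// => v _; rewrite /A/= eq_sym (negbTE bb') !mul0r.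
have := gE_quadratic_inj 0 (fun=> 0) A inj (fun p => lt p.1 p.2).
have z : \sum_(p : 'I_m * V) (0 : R) ^+ 2 = 0 by rewrite big1// => p _; rewrite expr0n.
rewrite z expr0n/= addr0 add0r.
rewrite (_ : \sum_u \sum_v A u v ^+ 2 = m%:R * \sum_u \sum_v a u v ^+ 2); last first.
  transitivity (\sum_(p : 'I_m * V) \sum_q A p q * a p.2 q.2).
    apply: eq_bigr => p _; apply: eq_bigr => q _; rewrite /A.
    by case: (_ == _); rewrite ?mul1r ?mul0r ?expr0n// expr2.
  rewrite (E (fun _ u v => a u v)) sumr_const card_ord mulr_natl.
  congr (_ *+ _).
rewrite mulrCA => H; apply: le_trans H; rewrite le_eqVlt; apply/orP; left; apply/eqP/eq_gE => x _.
congr (_ ^+ 2)%:E; rewrite [X in _ = 0 + X + _]big1 ?addr0 ?add0r; last by move=> p _; rewrite mul0r.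
rewrite (eq_bigr (fun p : 'I_m * V => \sum_q A p q *
   (nth 0 x (io p.1 p.2) * nth 0 x (io p.1 q.2) - (p.2 == q.2)%:R))); last first.
  move=> [b u] _; apply: eq_bigr => [[b' v] _]; rewrite /A/= xpair_eqE.
  by case: eqP => [->|_]; rewrite ?mul0r.
rewrite (E (fun b u v => nth 0 x (io b u) * nth 0 x (io b v) - (u == v)%:R)).
apply: eq_bigr => b _; under [RHS]eq_bigr do under eq_bigr do rewrite mulrBr.
under [RHS]eq_bigr do rewrite sumrB.
rewrite sumrB; congr (_ - _); apply: eq_bigr => u _.
rewrite (bigD1 u)//= eqxx mulr1 big1 ?addr0// => v vu.
by rewrite eq_sym (negbTE vu) mulr0.
Qed.

(** Once [x] is frozen and [S] is redrawn, each increment sees [y] only through its own coordinate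
    and the earlier ones, which is what the third hypothesis demands; [gE_expR_martingale] then
    applies for every [x]. *)
Lemma gE_change_measure k (S : nat -> bool) (h : seq R -> nat -> seq R -> R -> R) :
  (forall x i p, measurable_fun setT (h x i p)) ->
  (forall x i p, \int[mu]_t (phi t * expR (h x i p t))%:E = 1)%E ->
  (forall x y i, size x = k -> size y = k -> (i < k)%N ->
    h (merge S x y) i (take i (merge S x y)) (nth 0 (merge S x y) i) =
    h x i (take i y) (nth 0 y i)) ->
  mseq k (fun x => (expR (\sum_(i < k) h x i (take i x) (nth 0 x i)))%:E) ->
  gE k (fun x => (expR (\sum_(i < k) h x i (take i x) (nth 0 x i)))%:E) = 1%E.
Proof.
move=> mh ih hS mF; rewrite -(gE_resample S)//.
rewrite -(gE_cst k (@lee01 R)); apply: eq_gE => x sx.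
transitivity (gE k (fun y => (expR (0 + \sum_(i < k) h x i (take i y) (nth 0 y i)))%:E)).
  by apply: eq_gE => y sy; rewrite add0r; congr (expR _)%:E; apply: eq_bigr => i _; exact: hS.
by rewrite (gE_expR_martingale _ _ (mh x) (ih x)) expR0.
Qed.

End IteratedExpectation.

(** * Measurability of real functions of the Gaussian coordinates *)

Section SeqMeasurability.
Variable R : realType.

Definition mseqR k (f : seq R -> R) : Prop :=
  measurable_fun [set: k.-tuple R] (fun t => f t).

Lemma mseqR_EFin k f : mseqR k f -> mseq k (fun x => (f x)%:E).
Proof. by move=> mf; apply/measurable_EFinP. Qed.

Lemma mseqR_cst k c : mseqR k (fun=> c).
Proof. exact: measurable_cst. Qed.

Lemma mseqR_nth k i : mseqR k (fun x => nth 0 x i).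
Proof.
rewrite /mseqR; case: (ltnP i k) => ik.
  rewrite (_ : (fun t => _) = fun t : k.-tuple R => tnth t (Ordinal ik)).
    exact: measurable_tnth.
  by apply/funext => t; rewrite (tnth_nth 0).
rewrite (_ : (fun t => _) = fun=> 0); first exact: measurable_cst.
by apply/funext => t; rewrite nth_default// size_tuple.
Qed.

Lemma mseqRD k f g : mseqR k f -> mseqR k g -> mseqR k (fun x => f x + g x).
Proof. by move=> mf mg; exact: measurable_funD. Qed.

Lemma mseqRB k f g : mseqR k f -> mseqR k g -> mseqR k (fun x => f x - g x).
Proof. by move=> mf mg; exact: measurable_funB. Qed.

Lemma mseqRM k f g : mseqR k f -> mseqR k g -> mseqR k (fun x => f x * g x).
Proof. by move=> mf mg; exact: measurable_funM. Qed.

Lemma mseqRX k f m : mseqR k f -> mseqR k (fun x => f x ^+ m).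
Proof. by move=> mf; exact: measurable_funX. Qed.

Lemma mseqR_expR k f : mseqR k f -> mseqR k (fun x => expR (f x)).
Proof. by move=> mf; exact: measurableT_comp. Qed.

Lemma mseqR_sum k (I : Type) (r : seq I) (f : I -> seq R -> R) :
  (forall i, mseqR k (f i)) -> mseqR k (fun x => \sum_(i <- r) f i x).
Proof. by move=> mf; exact: measurable_sum. Qed.

Lemma mseqR_infod k g f h : mseqR k f -> mseqR k h -> mseqR k (fun x => infod g (f x) (h x)).
Proof.
move=> mf mh; rewrite /infod; apply: mseqRD; last exact: mseqR_cst.
apply: mseqRB; first apply: mseqRB.
- exact: mseqRM.
- by apply: mseqRM; [apply: mseqRM; [exact: mseqR_cst|exact: mseqRX]|exact: mseqR_cst].
- by apply: mseqRM; [exact: mseqRX|exact: mseqR_cst].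
Qed.

End SeqMeasurability.

Ltac msolve := repeat first
  [ exact: mseqR_nth | exact: mseqR_cst | apply: mseqR_infod | apply: mseqR_expR
  | apply: mseqRX | apply: mseqRB | apply: mseqRD | apply: mseqRM
  | (apply: mseqR_sum => ?) ].

(** * Exponential moments of densities at independent codewords *)

Section ChangeOfMeasure.
Variable R : realType.
Local Notation mu := (@lebesgue_measure R).
Local Notation phi := (@normal_pdf R 0 1).

Lemma measurable_infod (g s : R) : measurable_fun setT (infod g ^~ s).
Proof.
rewrite /infod; apply: measurable_funD => //.
apply: measurable_funB => //; apply: measurable_funB.
  exact: measurable_funM.
by apply: measurable_funM => //; apply: measurable_funM => //; exact: measurable_funX.
Qed.

(** When [S] holds the coordinates of a wrong codeword, the channel statistic is such an [f]. *)
Definition invariant_on k (S : nat -> bool) m (f : seq R -> nat -> R) : Prop :=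
  forall x y b, size x = k -> size y = k -> (b < m)%N -> f (merge S x y) b = f x b.

Lemma gE_infod1 k lo m (g : R) (f : seq R -> nat -> R) :
  (lo + m <= k)%N -> 0 <= g ->
  invariant_on k (fun i => lo <= i < lo + m)%N m f ->
  (forall b, mseqR k (f ^~ b)) ->
  gE k (fun x => (expR (\sum_(b < m) infod g (nth 0 x (lo + b)) (f x b)))%:E) = 1%E.
Proof.
move=> lk g0 inv mf.
pose h (x : seq R) (i : nat) (p : seq R) t :=
  if (lo <= i < lo + m)%N then infod g t (f x (i - lo)%N) else 0.
have E (x : seq R) : \sum_(b < m) infod g (nth 0 x (lo + b)) (f x b) =
    \sum_(i < k) h x i (take i x) (nth 0 x i).
  rewrite /h (sum_if_range (fun i => infod g (nth 0 x i) (f x (i - lo)%N)))//.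
  by apply: eq_bigr => b _; rewrite addKn.
rewrite (eq_gE (G := fun x => (expR (\sum_(i < k) h x i (take i x) (nth 0 x i)))%:E)); last first.
  by move=> x _; rewrite E.
apply: (gE_change_measure (S := fun i => lo <= i < lo + m)%N).
- move=> x i p; rewrite /h; case: (lo <= i < lo + m)%N; last exact: measurable_cst.
  exact: measurable_infod.
- move=> x i p; rewrite /h; case: (lo <= i < lo + m)%N; first exact: integral_infod.
  by under eq_integral do rewrite expR0 mulr1; exact: integral_normal_pdf.
- move=> x y i sx sy ik; rewrite /h; case: ifP => // iS.
  rewrite nth_merge ?sx// iS inv//; lia.
- apply: mseqR_EFin; rewrite /mseqR.
  under eq_fun do rewrite -E.
  have : mseqR k (fun x => expR (\sum_(b < m) infod g (nth 0 x (lo + b)) (f x b))).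
    by msolve.
  by [].
Qed.

(** The increment at [lo2 + b] refers to the fresh letter at [lo1 + b]. The block at [lo1] must
    therefore come first, so that this letter belongs to the prefix. *)
Lemma gE_infod2 k lo1 lo2 m (g g' c : R) (f f' : seq R -> nat -> R) :
  (lo1 + m <= lo2)%N -> (lo2 + m <= k)%N -> 0 <= g -> 0 <= g' ->
  let S i := (lo1 <= i < lo1 + m)%N || (lo2 <= i < lo2 + m)%N in
  invariant_on k S m f -> invariant_on k S m f' ->
  (forall b, mseqR k (f ^~ b)) -> (forall b, mseqR k (f' ^~ b)) ->
  gE k (fun x => (expR (\sum_(b < m)
     (infod g (nth 0 x (lo2 + b)) (f x b - c * nth 0 x (lo1 + b)) +
      infod g' (nth 0 x (lo1 + b)) (f' x b))))%:E) = 1%E.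
Proof.
move=> l12 lk g0 g'0 S inv inv' mf mf'.
pose h (x : seq R) (i : nat) (p : seq R) t :=
  (if (lo2 <= i < lo2 + m)%N then infod g t (f x (i - lo2)%N - c * nth 0 p (lo1 + (i - lo2))) else 0)
  + (if (lo1 <= i < lo1 + m)%N then infod g' t (f' x (i - lo1)%N) else 0).
have E (x : seq R) : \sum_(b < m)
     (infod g (nth 0 x (lo2 + b)) (f x b - c * nth 0 x (lo1 + b)) +
      infod g' (nth 0 x (lo1 + b)) (f' x b)) =
    \sum_(i < k) h x i (take i x) (nth 0 x i).
  rewrite /h big_split [RHS]big_split/=.
  rewrite (sum_if_range (fun i => infod g' (nth 0 x i) (f' x (i - lo1)%N))); last by lia.
  rewrite (sum_if_range (fun i => infod g (nth 0 x i)
    (f x (i - lo2)%N - c * nth 0 (take i x) (lo1 + (i - lo2)))))//.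
  congr (_ + _); apply: eq_bigr => b _; rewrite addKn// nth_take//.
  by have := ltn_ord b; lia.
rewrite (eq_gE (G := fun x => (expR (\sum_(i < k) h x i (take i x) (nth 0 x i)))%:E)); last first.
  by move=> x _; rewrite E.
apply: (gE_change_measure (S := S)).
- move=> x i p; rewrite /h; apply: measurable_funD.
    by case: (lo2 <= i < lo2 + m)%N; [exact: measurable_infod|exact: measurable_cst].
  by case: (lo1 <= i < lo1 + m)%N; [exact: measurable_infod|exact: measurable_cst].
- move=> x i p; rewrite /h.
  case i2: (lo2 <= i < lo2 + m)%N; case i1: (lo1 <= i < lo1 + m)%N.
  + by exfalso; lia.
  + by under eq_integral do rewrite addr0; exact: integral_infod.
  + by under eq_integral do rewrite add0r; exact: integral_infod.
  + by under eq_integral do rewrite addr0 expR0 mulr1; exact: integral_normal_pdf.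
- move=> x y i sx sy ik; rewrite /h.
  have sm : size (merge S x y) = k by rewrite size_merge sx.
  case: ifP => i2; case: ifP => i1 //.
  + by exfalso; lia.
  + rewrite !nth_take ?nth_merge ?sx//; try lia.
    have -> : S i by rewrite /S i2 orbT.
    have -> : S (lo1 + (i - lo2))%N by rewrite /S; lia.
    by rewrite inv//; lia.
  + rewrite nth_merge ?sx// inv'//; last by lia.
    by have -> : S i by rewrite /S i1.
- apply: mseqR_EFin; rewrite /mseqR.
  under eq_fun do rewrite -E.
  have : mseqR k (fun x => expR (\sum_(b < m)
     (infod g (nth 0 x (lo2 + b)) (f x b - c * nth 0 x (lo1 + b)) +
      infod g' (nth 0 x (lo1 + b)) (f' x b)))).
    by msolve.
  by [].
Qed.

End ChangeOfMeasure.

(** * Coordinates of the ensemble and moments of the block densities *)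

Section BlockStatistics.
Variables (R : realType) (eta n nb M1 M2 : nat).
Hypothesis nbn : (nb * eta <= n)%N.
Local Notation mu := (@lebesgue_measure R).

Definition cbsize := ((M1 + M2) * nb)%N.
Definition nvars := (cbsize + (n + (n + n)))%N.
(* All random variables sit in one sequence of standard normals: the [M1 + M2]
   codewords of length [nb], then the [n]-tuples behind [Z], [W_1] and [W_2]. *)
Definition th1 (x : seq R) (w b : nat) : R := nth 0 x (w * nb + b).
Definition th2 (x : seq R) (w b : nat) : R := nth 0 x (M1 * nb + w * nb + b).
Definition nzidx (b : nat) (p : 'I_3 * 'I_eta) : nat :=
  (cbsize + (p.1 * n + (b * eta + p.2)))%N.
Definition nz (c : 'I_3 * 'I_eta -> R) (x : seq R) (b : nat) : R :=
  \sum_p c p * nth 0 x (nzidx b p).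

(** The standard normals entering one block for a fixed message pair: [inl false] and [inl true] are
    the letters of users 1 and 2, [inr] the normals behind the noise. *)
Definition bvar := (bool + 'I_3 * 'I_eta)%type.

Definition bidx (w1 w2 : nat) (b : 'I_nb) (v : bvar) : nat :=
  match v with
  | inl false => (w1 * nb + b)%N
  | inl true => (M1 * nb + w2 * nb + b)%N
  | inr p => nzidx b p
  end.

Lemma radix_inj (m a r a' r' : nat) : (r < m)%N -> (r' < m)%N ->
  (a * m + r = a' * m + r')%N -> a = a' /\ r = r'.
Proof.
clear nbn.
move=> rm rm' e; have m0 : (0 < m)%N by lia.
have ea : a = a'.
  by have := congr1 (divn^~ m) e; rewrite /= !divnMDl// !divn_small// !addn0.
by split => //; move: e; rewrite ea => /addnI.
Qed.

Lemma block_lt (b : 'I_nb) (j : 'I_eta) : (b * eta + j < n)%N.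
Proof.
apply: leq_trans nbn; apply: (@leq_trans (b.+1 * eta)); last first.
  by rewrite leq_mul2r ltn_ord orbT.
by rewrite mulSn addnC ltn_add2r.
Qed.

Lemma nzidx_lt (b : 'I_nb) p : (nzidx b p < nvars)%N.
Proof.
rewrite /nzidx /nvars ltn_add2l; have := block_lt b p.2; have := ltn_ord p.1.
move: (nat_of_ord p.1) => a; case: a => [|[|[|a]]]//; lia.
Qed.

Lemma code1_lt (w b : nat) : (w < M1)%N -> (b < nb)%N -> (w * nb + b < M1 * nb)%N.
Proof.
clear nbn; by move=> h hb; nia.
Qed.

Lemma code2_lt (w b : nat) : (w < M2)%N -> (b < nb)%N ->
  (M1 * nb + w * nb + b < cbsize)%N.
Proof.
clear nbn; by move=> h hb; rewrite /cbsize; nia.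
Qed.

Lemma bidx_lt (w1 : 'I_M1) (w2 : 'I_M2) b v : (bidx w1 w2 b v < nvars)%N.
Proof.
case: v => [[]|p] /=; last exact: nzidx_lt.
  by apply: leq_trans (code2_lt (ltn_ord w2) (ltn_ord b)) _; rewrite leq_addr.
apply: leq_trans (code1_lt (ltn_ord w1) (ltn_ord b)) _.
by rewrite /nvars /cbsize mulnDl -!addnA leq_addr.
Qed.

Lemma bidx_inj (w1 : 'I_M1) (w2 : 'I_M2) :
  injective (fun q : 'I_nb * bvar => bidx w1 w2 q.1 q.2).
Proof.
have c1 (b : 'I_nb) := code1_lt (ltn_ord w1) (ltn_ord b).
have c2 (b : 'I_nb) := code2_lt (ltn_ord w2) (ltn_ord b).
have cb : (M1 * nb <= cbsize)%N by rewrite /cbsize mulnDl leq_addr.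
move=> [b v] [b' v'] /=.
case: v => [[]|p]; case: v' => [[]|p'] /=; rewrite /nzidx.
- by move=> /addnI e; congr (_, _); apply: val_inj.
- by have := c1 b'; lia.
- by have := c2 b; lia.
- by have := c1 b; lia.
- by move=> /addnI e; congr (_, _); apply: val_inj.
- by have := c1 b; lia.
- by have := c2 b'; lia.
- by have := c1 b'; lia.
- move=> /addnI /(radix_inj (block_lt _ _) (block_lt _ _))[e1].
  move=> /(radix_inj (ltn_ord _) (ltn_ord _))[e2 e3].
  congr (_, inr _); first exact: val_inj.
  by case: p p' e1 e3 => [p q] [p' q'] /= e1 e3; congr (_, _); exact: val_inj.
Qed.

Definition blin (w1 w2 : nat) (e : bvar -> R) (x : seq R) (b : 'I_nb) : R :=
  \sum_v e v * nth 0 x (bidx w1 w2 b v).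

Definition bdot (e f : bvar -> R) : R := \sum_v e v * f v.

Lemma blinM w1 w2 e f x b : blin w1 w2 e x b * blin w1 w2 f x b =
  \sum_u \sum_v e u * f v * (nth 0 x (bidx w1 w2 b u) * nth 0 x (bidx w1 w2 b v)).
Proof.
rewrite /blin mulr_suml; apply: eq_bigr => u _; rewrite mulr_sumr.
by apply: eq_bigr => v _; ring.
Qed.

(** Substituting [s = g * th + n] into [infod] leaves, up to its constant, [(g / 2 * th ^+ 2 + th *
    n - n ^+ 2 / 2) / (1 + g)]; [e] and [c] are the coefficient vectors of [th] and [n]. *)
Definition infod_form (g : R) (e c : bvar -> R) (u v : bvar) : R :=
  (g / 2 * (e u * e v) + e u * c v - (c u * c v) / 2) / (1 + g).

Definition form_norm (a : bvar -> bvar -> R) : R := 2 * \sum_u \sum_v a u v ^+ 2.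

(* The centred log-likelihood of the transmitted codeword is a sum of [nb]
   uncorrelated quadratic forms, so its variance grows only linearly in [nb]. *)
Lemma gE_infod_variance (w1 : 'I_M1) (w2 : 'I_M2) g e c : 0 <= g ->
  bdot e e = 1 -> bdot e c = 0 -> bdot c c = g ->
  (gE nvars (fun x => ((\sum_(b < nb)
     (infod g (blin w1 w2 e x b) (g * blin w1 w2 e x b + blin w1 w2 c x b) - ln (1 + g) / 2)) ^+ 2)%:E)
   <= (nb%:R * form_norm (infod_form g e c))%:E)%E.
Proof.
move=> g0 ee ec cc; have g1 : 1 + g != 0 by rewrite lt0r_neq0// ltr_pwDl.
(* The trace vanishes because [n] has variance [g]: the mean of [infod] is exactly
   [ln (1 + g) / 2]. *)
have tr : \sum_v infod_form g e c v v = 0.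
  rewrite /infod_form -mulr_suml sumrB big_split/= -mulr_sumr -mulr_suml.
  rewrite -/(bdot e e) -/(bdot e c) -/(bdot c c) ee ec cc; field.
  by rewrite g1.
have := gE_block_quadratic (infod_form g e c) (@bidx_inj w1 w2) (bidx_lt w1 w2).
apply: le_trans; rewrite le_eqVlt; apply/orP; left; apply/eqP/eq_gE => x _.
congr (_ ^+ 2)%:E; apply: eq_bigr => b _; rewrite tr subr0.
transitivity ((g / 2 * (blin w1 w2 e x b * blin w1 w2 e x b) + blin w1 w2 e x b * blin w1 w2 c x b
   - blin w1 w2 c x b * blin w1 w2 c x b / 2) / (1 + g)).
  by rewrite /infod; field.
rewrite !blinM !mulr_sumr mulr_suml -!big_split/= -sumrB mulr_suml; apply: eq_bigr => u _.
rewrite !mulr_sumr mulr_suml -!big_split/= -sumrB mulr_suml; apply: eq_bigr => v _.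
by rewrite /infod_form; ring.
Qed.

Definition ev1 (v : bvar) : R := if v is inl false then 1 else 0.
Definition ev2 (v : bvar) : R := if v is inl true then 1 else 0.
Definition evn (c : 'I_3 * 'I_eta -> R) (v : bvar) : R := if v is inr p then c p else 0.

Lemma sum_bvar (f : bvar -> R) : \sum_v f v = f (inl false) + f (inl true) + \sum_p f (inr p).
Proof. by rewrite big_sumType/= big_bool/= [f (inl true) + _]addrC. Qed.

Lemma blin_ev1 w1 w2 x b : blin w1 w2 ev1 x b = th1 x w1 b.
Proof. by rewrite /blin sum_bvar/= big1 => [|p _]; rewrite ?mul0r ?addr0 ?mul1r. Qed.

Lemma blin_ev2 w1 w2 x b : blin w1 w2 ev2 x b = th2 x w2 b.
Proof. by rewrite /blin sum_bvar/= big1 => [|p _]; rewrite ?mul0r ?addr0 ?add0r ?mul1r. Qed.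

Lemma blin_evn w1 w2 c x b : blin w1 w2 (evn c) x b = nz c x b.
Proof. by rewrite /blin sum_bvar/= !mul0r !add0r. Qed.

Definition power_form (p11 p12 p22 : R) (u v : bvar) : R :=
  p11 * (ev1 u * ev1 v) + 2 * p12 * (ev1 u * ev2 v) + p22 * (ev2 u * ev2 v).

Lemma gE_power_variance (w1 : 'I_M1) (w2 : 'I_M2) (p11 p12 p22 : R) :
  (gE nvars (fun x => ((\sum_(b < nb)
     (p11 * (th1 x w1 b ^+ 2 - 1) + 2 * p12 * (th1 x w1 b * th2 x w2 b) +
      p22 * (th2 x w2 b ^+ 2 - 1))) ^+ 2)%:E)
   <= (nb%:R * form_norm (power_form p11 p12 p22))%:E)%E.
Proof.
set a := power_form p11 p12 p22.
have tr : \sum_v a v v = p11 + p22.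
  rewrite sum_bvar /a/power_form/= big1; last by move=> p _; rewrite !mulr0 !addr0.
  by rewrite !(mulr0, mul0r, mulr1, addr0, add0r).
have := gE_block_quadratic a (@bidx_inj w1 w2) (bidx_lt w1 w2).
apply: le_trans; rewrite le_eqVlt; apply/orP; left; apply/eqP/eq_gE => x _.
congr (_ ^+ 2)%:E; apply: eq_bigr => b _; rewrite tr.
transitivity (p11 * (blin w1 w2 ev1 x b * blin w1 w2 ev1 x b) +
  2 * p12 * (blin w1 w2 ev1 x b * blin w1 w2 ev2 x b) +
  p22 * (blin w1 w2 ev2 x b * blin w1 w2 ev2 x b) - (p11 + p22)).
  by rewrite blin_ev1 blin_ev2; ring.
congr (_ - _); rewrite !blinM !mulr_sumr -!big_split/=; apply: eq_bigr => u _.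
rewrite !mulr_sumr -!big_split/=; apply: eq_bigr => v _.
by rewrite /a/power_form; ring.
Qed.

Lemma nth_merge_out (S : nat -> bool) (x y : seq R) i : size x = size y -> ~~ S i ->
  nth 0 (merge S x y) i = nth 0 x i.
Proof.
clear nbn; by move=> e /negbTE Si; rewrite nth_merge// Si.
Qed.

Lemma nz_merge S c x y b : size x = size y ->
  (forall i, (cbsize <= i)%N -> ~~ S i) -> nz c (merge S x y) b = nz c x b.
Proof.
clear nbn.
move=> e h; apply: eq_bigr => p _; rewrite nth_merge_out//; apply: h.
by rewrite /nzidx leq_addr.
Qed.

Lemma code_disjoint (w v b : nat) : w != v -> (b < nb)%N ->
  ~~ (v * nb <= w * nb + b < v * nb + nb)%N.
Proof.
clear nbn.
move=> wv bn; apply/negP => /andP[h1 h2]; move/eqP: wv; apply.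
case: (ltngtP w v) => // h.
  have : (w.+1 * nb <= v * nb)%N by rewrite leq_mul2r h orbT.
  by rewrite mulSn; lia.
have : (v.+1 * nb <= w * nb)%N by rewrite leq_mul2r h orbT.
by rewrite mulSn; lia.
Qed.

(** The statistic contains the codeword of [w1] only, so that of [v1] is independent of it. The
    contribution of user 2, whose message is right, is already cancelled. *)
Lemma gE_infod_wrong1 (w1 v1 : 'I_M1) (g : R) c : 0 <= g -> v1 != w1 ->
  gE nvars (fun x => (expR (\sum_(b < nb)
     infod g (th1 x v1 b) (g * th1 x w1 b + nz c x b)))%:E) = 1%E.
Proof.
clear nbn.
move=> g0 vw; rewrite /th1.
apply: (@gE_infod1 R nvars (v1 * nb)%N nb g (fun x b => g * nth 0 x (w1 * nb + b) + nz c x b)) => //.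
- rewrite /nvars /cbsize; have := ltn_ord v1.
  have : (v1.+1 * nb <= M1 * nb)%N by rewrite leq_mul2r ltn_ord orbT.
  by rewrite mulSn mulnDl; lia.
- move=> x y b sx sy bn; rewrite nth_merge_out ?sx// ?nz_merge ?sx//.
    move=> i; have : (v1.+1 * nb <= M1 * nb)%N by rewrite leq_mul2r ltn_ord orbT.
    by rewrite /cbsize mulSn mulnDl; lia.
  by apply: code_disjoint => //; rewrite eq_sym.
- by move=> b; rewrite /nz; msolve.
Qed.

Lemma gE_infod_wrong2 (w2 v2 : 'I_M2) (g : R) c : 0 <= g -> v2 != w2 ->
  gE nvars (fun x => (expR (\sum_(b < nb)
     infod g (th2 x v2 b) (g * th2 x w2 b + nz c x b)))%:E) = 1%E.
Proof.
clear nbn.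
move=> g0 vw; rewrite /th2.
have hv : (v2.+1 * nb <= M2 * nb)%N by rewrite leq_mul2r ltn_ord orbT.
apply: (@gE_infod1 R nvars (M1 * nb + v2 * nb)%N nb g
  (fun x b => g * nth 0 x (M1 * nb + w2 * nb + b) + nz c x b)) => //.
- by move: hv; rewrite /nvars /cbsize mulSn mulnDl; lia.
- move=> x y b sx sy bn; rewrite nth_merge_out ?sx// ?nz_merge ?sx//.
    by move=> i; move: hv; rewrite /cbsize mulSn mulnDl; lia.
  have := @code_disjoint w2 v2 b _ bn; rewrite -!addnA !leq_add2l !ltn_add2l.
  by apply; rewrite eq_sym.
- by move=> b; rewrite /nz; msolve.
Qed.

(** With both messages wrong the densities form a chain: user 2 given the candidate of user 1, then
    user 1 from [s1 - c * s2], which contains neither candidate. *)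
Lemma gE_infod_wrong12 (w1 v1 : 'I_M1) (w2 v2 : 'I_M2) (g11 g12 g22 g' c : R) c1 c2 :
  0 <= g22 -> 0 <= g' -> v1 != w1 -> v2 != w2 ->
  let s1 x b := g11 * th1 x w1 b + g12 * th2 x w2 b + nz c1 x b in
  let s2 x b := g12 * th1 x w1 b + g22 * th2 x w2 b + nz c2 x b in
  gE nvars (fun x => (expR (\sum_(b < nb)
     (infod g22 (th2 x v2 b) (s2 x b - g12 * th1 x v1 b) +
      infod g' (th1 x v1 b) (s1 x b - c * s2 x b))))%:E) = 1%E.
Proof.
clear nbn.
move=> g0 g'0 vw1 vw2 s1 s2; rewrite /th1 /th2.
have hv2 : (v2.+1 * nb <= M2 * nb)%N by rewrite leq_mul2r ltn_ord orbT.
have hv1 : (v1.+1 * nb <= M1 * nb)%N by rewrite leq_mul2r ltn_ord orbT.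
have hw1 : (w1.+1 * nb <= M1 * nb)%N by rewrite leq_mul2r ltn_ord orbT.
pose S i := (v1 * nb <= i < v1 * nb + nb)%N || (M1 * nb + v2 * nb <= i < M1 * nb + v2 * nb + nb)%N.
have oN i : (cbsize <= i)%N -> ~~ S i.
  by move: hv1 hv2; rewrite /S /cbsize !mulSn mulnDl; lia.
have o1 b : (b < nb)%N -> ~~ S (w1 * nb + b)%N.
  move=> bn; rewrite /S negb_or code_disjoint//= 1?eq_sym//.
  by move: hw1; rewrite mulSn; lia.
have o2 b : (b < nb)%N -> ~~ S (M1 * nb + w2 * nb + b)%N.
  move=> bn; rewrite /S negb_or; apply/andP; split.
    by move: hv1; rewrite mulSn; lia.
  have := @code_disjoint w2 v2 b _ bn; rewrite -!addnA !leq_add2l !ltn_add2l.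
  by apply; rewrite eq_sym.
have inv (A B : R) cc : invariant_on nvars S nb (fun x b =>
    A * nth 0 x (w1 * nb + b) + B * nth 0 x (M1 * nb + w2 * nb + b) + nz cc x b).
  by move=> x y b sx sy bn; rewrite !nth_merge_out ?sx ?o1 ?o2// nz_merge ?sx.
apply: (@gE_infod2 R nvars (v1 * nb)%N (M1 * nb + v2 * nb)%N nb g22 g' g12 s2
  (fun x b => s1 x b - c * s2 x b)) => //.
- by move: hv1; rewrite mulSn; lia.
- by move: hv2; rewrite /nvars /cbsize mulSn mulnDl; lia.
- exact: inv.
- by move=> x y b sx sy bn; rewrite /s1 /s2 /th1 /th2 !inv.
- by move=> b; rewrite /s2 /th1 /th2 /nz; msolve.
- by move=> b; rewrite /s1 /s2 /th1 /th2 /nz; msolve.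
Qed.

End BlockStatistics.

(** * Linear feedback codes *)

Section History.
Variables (R : realType) (e1 e2 : nat -> seq R -> R) (z w1 w2 : nat -> R).
Local Notation H := (hist e1 e2 z w1 w2).

Lemma size_hist k : size (H k) = k.
Proof. by elim: k => //= k IH; rewrite size_rcons IH. Qed.

Lemma nth_hist_prefix t k s : (t <= k)%N -> (s < t)%N ->
  nth (0, 0) (H k) s = nth (0, 0) (H t) s.
Proof.
elim: k => [|k IH]; first by case: t.
rewrite leq_eqVlt => /predU1P[->//|tk] st /=.
by rewrite nth_rcons size_hist (leq_trans st tk) IH.
Qed.

Lemma nth_hist k t : (t < k)%N -> nth (0, 0) (H k) t =
  (e1 t [seq chan_out (H k) z s + w1 s | s <- iota 0 t],
   e2 t [seq chan_out (H k) z s + w2 s | s <- iota 0 t]).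
Proof.
move=> tk; rewrite (nth_hist_prefix tk (ltnSn t)) /= nth_rcons size_hist ltnn eqxx.
by congr (e1 _ _, e2 _ _); apply/eq_in_map => s; rewrite mem_iota add0n => /andP[_ st];
  rewrite /chan_out !(nth_hist_prefix (ltnW tk) st).
Qed.

End History.

Section LinearEncoder.
Variables (R : realType) (m : nat).
Local Notation eta := m.+1.

(* Within block [b] the encoder sends [a * th b] plus a strictly causal linear
   function [B] of the feedback of the same block; times past the last full
   block are left silent. *)
Definition lin_enc (nb : nat) (a : 'cV[R]_eta) (B : 'M[R]_eta) (th : nat -> R)
    (t : nat) (v : seq R) : R :=
  if (t < nb * eta)%N then
    a (inord (t %% eta)) 0 * th (t %/ eta)%N +
    \sum_(j < eta) B (inord (t %% eta)) j * nth 0 v ((t %/ eta) * eta + j)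
  else 0.

Lemma measurable_lin_enc nb a B th t :
  measurable_fun [set: t.-tuple R] (fun v => lin_enc nb a B th t v).
Proof.
rewrite /lin_enc; case: (t < _)%N; last exact: measurable_cst.
have : mseqR t (fun v : seq R => a (inord (t %% eta)) 0 * th (t %/ eta)%N +
    \sum_(j < eta) B (inord (t %% eta)) j * nth 0 v ((t %/ eta) * eta + j)).
  by msolve.
by [].
Qed.

Lemma lin_enc_block nb a B th (b : nat) (i : 'I_eta) (f : nat -> R) :
  strictly_lower B -> (b < nb)%N ->
  lin_enc nb a B th (b * eta + i) [seq f s | s <- iota 0 (b * eta + i)] =
  a i 0 * th b + \sum_(j < eta) B i j * f (b * eta + j)%N.
Proof.
move=> sl bn; rewrite /lin_enc.
have -> : (b * eta + i < nb * eta)%N.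
  apply: (@leq_trans (b.+1 * eta)); last by rewrite leq_mul2r bn orbT.
  by rewrite mulSn addnC ltn_add2r.
rewrite modnMDl modn_small// divnMDl// divn_small// addn0 inord_val.
congr (_ + _); apply: eq_bigr => j _.
(* For [j >= i] the feedback has not arrived yet; strict triangularity makes the coefficient zero,
   so the value read there is harmless. *)
case: (ltnP j i) => ij; last by rewrite sl// !mul0r.
by rewrite (nth_map 0%N) ?size_iota ?ltn_add2l// nth_iota ?ltn_add2l// add0n.
Qed.

Lemma lin_enc_silent nb a B th t v : (nb * eta <= t)%N -> lin_enc nb a B th t v = 0.
Proof. by rewrite /lin_enc ltnNge => ->. Qed.

End LinearEncoder.

Section LinearRun.
Variables (R : realType) (m n nb : nat).
Local Notation eta := m.+1.
Hypothesis nbn : (nb * eta <= n)%N.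
Variables (a1 a2 : 'cV[R]_eta) (B1 B2 : 'M[R]_eta) (u1 u2 : nat -> R) (z w1 w2 : nat -> R).
Hypotheses (sl1 : strictly_lower B1) (sl2 : strictly_lower B2).

Let h := hist (lin_enc nb a1 B1 u1) (lin_enc nb a2 B2 u2) z w1 w2 n.
Let X1 t := (nth (0, 0) h t).1.
Let X2 t := (nth (0, 0) h t).2.
Let Y t := chan_out h z t.

Lemma run_X1 b (i : 'I_eta) : (b < nb)%N ->
  X1 (b * eta + i) = a1 i 0 * u1 b + \sum_(j < eta) B1 i j * (Y (b * eta + j) + w1 (b * eta + j)%N).
Proof.
move=> bn; have tn : (b * eta + i < n)%N by exact: (block_lt nbn (Ordinal bn) i).
rewrite /X1 /h nth_hist//= (lin_enc_block a1 u1 i (fun s => chan_out _ z s + w1 s))//.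
Qed.

Lemma run_X2 b (i : 'I_eta) : (b < nb)%N ->
  X2 (b * eta + i) = a2 i 0 * u2 b + \sum_(j < eta) B2 i j * (Y (b * eta + j) + w2 (b * eta + j)%N).
Proof.
move=> bn; have tn : (b * eta + i < n)%N by exact: (block_lt nbn (Ordinal bn) i).
rewrite /X2 /h nth_hist//= (lin_enc_block a2 u2 i (fun s => chan_out _ z s + w2 s))//.
Qed.

(* Inverting the feedback loop at the receiver leaves a memoryless channel. *)
Lemma run_statistic (l : 'rV[R]_eta) b : (b < nb)%N ->
  \sum_(i < eta) l 0 i * (Y (b * eta + i) - \sum_(j < eta) (B1 i j + B2 i j) * Y (b * eta + j)) =
  (l *m a1) 0 0 * u1 b + (l *m a2) 0 0 * u2 b +
  (\sum_(j < eta) l 0 j * z (b * eta + j)%N + \sum_(j < eta) (l *m B1) 0 j * w1 (b * eta + j)%N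
   + \sum_(j < eta) (l *m B2) 0 j * w2 (b * eta + j)%N).
Proof.
move=> bn.
have mulE (B : 'M[R]_eta) (f : nat -> R) : \sum_(j < eta) (l *m B) 0 j * f j =
    \sum_(i < eta) l 0 i * \sum_(j < eta) B i j * f j.
  under eq_bigr do rewrite mxE mulr_suml.
  rewrite exchange_big/=; apply: eq_bigr => i _; rewrite mulr_sumr.
  by apply: eq_bigr => j _; rewrite mulrA.
rewrite (mulE B1 (fun j => w1 (b * eta + j)%N)) (mulE B2 (fun j => w2 (b * eta + j)%N)) !mxE !mulr_suml -!big_split/=.
apply: eq_bigr => i _.
have -> : Y (b * eta + i) = X1 (b * eta + i) + X2 (b * eta + i) + z (b * eta + i)%N by [].
rewrite run_X1// run_X2//.
have -> : \sum_(j < eta) (B1 i j + B2 i j) * Y (b * eta + j) =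
   \sum_(j < eta) B1 i j * (Y (b * eta + j) + w1 (b * eta + j)%N) +
   \sum_(j < eta) B2 i j * (Y (b * eta + j) + w2 (b * eta + j)%N) -
   \sum_(j < eta) B1 i j * w1 (b * eta + j)%N - \sum_(j < eta) B2 i j * w2 (b * eta + j)%N.
  by rewrite -big_split/= -!sumrB; apply: eq_bigr => j _; ring.
ring.
Qed.

(** The entries of a fixed vector vanish one after the other from the top, since each depends on
    earlier ones only. *)
Lemma strictly_lower_fixpoint k (B : 'M[R]_k) (v : 'cV[R]_k) :
  strictly_lower B -> v = B *m v -> v = 0.
Proof.
move=> sl e; suff H i : (i <= k)%N -> forall j : 'I_k, (j < i)%N -> v j 0 = 0.
  by apply/matrixP => j j'; rewrite ord1 mxE (H k).
elim: i => // i IH ik j; rewrite ltnS leq_eqVlt => /predU1P[ji|]; last by apply: IH; lia.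
rewrite e mxE big1// => j' _; case: (leqP j j') => jj; first by rewrite sl ?mul0r.
by rewrite IH ?mulr0//; lia.
Qed.

Definition loop_mx : 'M[R]_(eta + eta) := 1%:M - block_mx B1 B1 B2 B2.

(** A kernel vector satisfies [x_nu = B_nu (x_1 + x_2)]; its sum is then fixed by the strictly lower
    triangular [B1 + B2], hence zero, and so are both halves. *)
Lemma loop_mx_unit : loop_mx \in unitmx.
Proof.
rewrite -unitmx_tr unitmxE unitfE; apply/negP => /det0P[v v0 vB].
move/eqP: v0; apply; apply: trmx_inj; rewrite trmx0.
have : loop_mx *m v^T = 0 by rewrite -[LHS]trmxK trmx_mul trmxK vB trmx0.
move: (v^T) => x; rewrite -[x]vsubmxK; set x1 := usubmx x; set x2 := dsubmx x.
rewrite /loop_mx mulmxBl mul1mx mul_block_col => /eqP; rewrite subr_eq0 => /eqP e.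
have [e1 e2] := eq_col_mx e.
have s0 : x1 + x2 = 0.
  apply: (@strictly_lower_fixpoint _ (B1 + B2)).
    by move=> i j ij; rewrite mxE sl1// sl2// addr0.
  by rewrite mulmxDl !mulmxDr -e1 -e2.
by rewrite e -!mulmxDr s0 !mulmx0 col_mx0.
Qed.

(** This and the next three matrices are the responses of the stacked inputs of one block to the
    letters and to [Z], [W_1], [W_2] once the feedback loop is solved. *)
Definition msg_gain : 'M[R]_(eta + eta, 1 + 1) := invmx loop_mx *m block_mx a1 0 0 a2.
Definition Z_gain : 'M[R]_(eta + eta, eta) := invmx loop_mx *m col_mx B1 B2.
Definition W1_gain : 'M[R]_(eta + eta, eta) := invmx loop_mx *m col_mx B1 0.
Definition W2_gain : 'M[R]_(eta + eta, eta) := invmx loop_mx *m col_mx 0 B2.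

Lemma run_inputs b : (b < nb)%N ->
  col_mx (\col_(i < eta) X1 (b * eta + i)) (\col_(i < eta) X2 (b * eta + i)) =
  msg_gain *m col_mx (const_mx (u1 b)) (const_mx (u2 b)) +
  Z_gain *m (\col_(j < eta) z (b * eta + j)%N) +
  W1_gain *m (\col_(j < eta) w1 (b * eta + j)%N) +
  W2_gain *m (\col_(j < eta) w2 (b * eta + j)%N).
Proof.
move=> bn; set x1 := \col_i X1 _; set x2 := \col_i X2 _.
set zz := \col_j z _; set ww1 := \col_j w1 _; set ww2 := \col_j w2 _.
rewrite /msg_gain /Z_gain /W1_gain /W2_gain -!mulmxA -!mulmxDr.
apply: (canRL (mulKmx loop_mx_unit)).
rewrite /loop_mx mulmxBl mul1mx; apply/eqP; rewrite subr_eq; apply/eqP.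
rewrite !mul_block_col !mul_col_mx !add_col_mx !mul0mx !addr0 !add0r.
have mulc (A : 'M[R]_eta) (f : nat -> R) i :
  (A *m \col_(j < eta) f (b * eta + j)%N) i 0 = \sum_(j < eta) A i j * f (b * eta + j)%N.
  by rewrite mxE; apply: eq_bigr => j _; rewrite mxE.
have addE (A B : 'cV[R]_eta) i : (A + B) i 0 = A i 0 + B i 0 by rewrite mxE.
have cE (a : 'cV[R]_eta) u i : (a *m const_mx u : 'cV[R]_eta) i 0 = a i 0 * u.
  by rewrite mxE big_ord1 mxE.
congr col_mx; apply/matrixP => i j; rewrite ord1.
  have := run_X1 i bn; rewrite [x1 i 0]mxE => ->.
  rewrite !addE cE (mulc B1 z) (mulc B1 w1) (mulc B1 X1) (mulc B1 X2) -!addrA; congr (_ + _).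
  by rewrite -!big_split/=; apply: eq_bigr => k _; rewrite /Y /chan_out -/(X1 _) -/(X2 _); ring.
have := run_X2 i bn; rewrite [x2 i 0]mxE => ->.
rewrite !addE cE (mulc B2 z) (mulc B2 w2) (mulc B2 X1) (mulc B2 X2) -!addrA; congr (_ + _).
by rewrite -!big_split/=; apply: eq_bigr => k _; rewrite /Y /chan_out -/(X1 _) -/(X2 _); ring.
Qed.

End LinearRun.

(** * Linear forms of the channel noise in standard normals *)

Section NoiseCoefficients.
Variables (R : realType) (m n nb M1 M2 : nat) (N s1 s2 rho : R).
Local Notation eta := m.+1.
Hypothesis nbn : (nb * eta <= n)%N.
Hypotheses (N0 : 0 <= N) (rho1 : rho ^+ 2 <= 1).
Implicit Types zc pc qc : 'I_eta -> R.

(* Coefficients, on the standard normals behind one block of noise, of the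
   linear form with weights [zc] on [Z], [pc] on [W_1] and [qc] on [W_2]. *)
Definition noise_coef zc pc qc (p : 'I_3 * 'I_eta) : R :=
  match nat_of_ord p.1 with
  | 0 => Num.sqrt N * zc p.2
  | 1 => s1 * pc p.2 + s2 * rho * qc p.2
  | _ => s2 * Num.sqrt (1 - rho ^+ 2) * qc p.2
  end.

Lemma sum_I3 (f : 'I_3 * 'I_eta -> R) (h : nat -> 'I_eta -> R) :
  (forall p, f p = h p.1 p.2) ->
  \sum_p f p = \sum_j h 0%N j + \sum_j h 1%N j + \sum_j h 2%N j.
Proof.
move=> e; under eq_bigr do rewrite e.
rewrite -(pair_big xpredT xpredT (fun (i : 'I_3) j => h i j))/=.
by rewrite !big_ord_recl big_ord0 addr0 addrA.
Qed.

(** The pair [(W_1, W_2)] is built from a triangular factor of [K_W], so dot products of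
    coefficients are covariances, for singular [K_W] as well. *)
Lemma noise_coef_dot zc pc qc zc' pc' qc' :
  \sum_p noise_coef zc pc qc p * noise_coef zc' pc' qc' p =
  N * (\sum_j zc j * zc' j) + s1 ^+ 2 * (\sum_j pc j * pc' j) +
  s2 ^+ 2 * (\sum_j qc j * qc' j) + rho * s1 * s2 * (\sum_j (pc j * qc' j + qc j * pc' j)).
Proof.
pose h (i : nat) (j : 'I_eta) := match i with
  | 0 => Num.sqrt N * zc j
  | 1 => s1 * pc j + s2 * rho * qc j
  | _ => s2 * Num.sqrt (1 - rho ^+ 2) * qc j end *
  match i with
  | 0 => Num.sqrt N * zc' j
  | 1 => s1 * pc' j + s2 * rho * qc' j
  | _ => s2 * Num.sqrt (1 - rho ^+ 2) * qc' j end.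
rewrite (@sum_I3 _ h)// /h !mulr_sumr -!big_split/=; apply: eq_bigr => j _.
have eN : Num.sqrt N ^+ 2 = N by rewrite sqr_sqrtr.
have er : Num.sqrt (1 - rho ^+ 2) ^+ 2 = 1 - rho ^+ 2 by rewrite sqr_sqrtr// subr_ge0.
transitivity (Num.sqrt N ^+ 2 * (zc j * zc' j) +
  (s1 * pc j + s2 * rho * qc j) * (s1 * pc' j + s2 * rho * qc' j) +
  s2 ^+ 2 * Num.sqrt (1 - rho ^+ 2) ^+ 2 * (qc j * qc' j)); first by ring.
by rewrite eN er; ring.
Qed.

Lemma nz_noise_coef zc pc qc (cb zs g1 g2 : seq R) (b : nat) : (b < nb)%N ->
  size cb = cbsize nb M1 M2 -> size zs = n -> size g1 = n -> size g2 = n ->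
  nz n nb M1 M2 (noise_coef zc pc qc) (cb ++ (zs ++ (g1 ++ g2))) b =
  \sum_j zc j * Znoise N zs (b * eta + j) + \sum_j pc j * W1noise s1 g1 (b * eta + j)
  + \sum_j qc j * W2noise s2 rho g1 g2 (b * eta + j).
Proof.
move=> bn szc szz sz1 sz2; rewrite /nz.
set x := cb ++ _.
have x0 t : (t < n)%N -> nth 0 x (cbsize nb M1 M2 + (0 * n + t))%N = nth 0 zs t.
  move=> tn; rewrite /x mul0n add0n !nth_cat szc ltnNge leq_addr/= addKn szz tn//.
have x1 t : (t < n)%N -> nth 0 x (cbsize nb M1 M2 + (1 * n + t))%N = nth 0 g1 t.
  move=> tn; rewrite /x mul1n !nth_cat szc ltnNge leq_addr/= addKn szz.
  by rewrite ltnNge leq_addr/= addKn sz1 tn.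
have x2 t : (t < n)%N -> nth 0 x (cbsize nb M1 M2 + (2 * n + t))%N = nth 0 g2 t.
  move=> tn; rewrite /x mul2n -addnn -addnA !nth_cat szc ltnNge leq_addr/= addKn szz.
  by rewrite ltnNge leq_addr/= addKn sz1 ltnNge leq_addr/= addKn.
pose h (i : nat) (j : 'I_eta) := match i with
  | 0 => Num.sqrt N * zc j
  | 1 => s1 * pc j + s2 * rho * qc j
  | _ => s2 * Num.sqrt (1 - rho ^+ 2) * qc j end *
   nth 0 x (cbsize nb M1 M2 + (i * n + (b * eta + j))).
rewrite (@sum_I3 _ h)// /h -!big_split/=; apply: eq_bigr => j _.
have tn := block_lt nbn (Ordinal bn) j; rewrite /= in tn.
by rewrite x0// x1// x2// /Znoise /W1noise /W2noise; ring.
Qed.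

End NoiseCoefficients.

(** * Random coding *)

Section RealExpectation.
Variable R : realType.

Lemma gE_leD k (f g : seq R -> R) (a b : R) :
  (forall x, 0 <= f x) -> (forall x, 0 <= g x) -> mseqR k f -> mseqR k g ->
  (gE k (fun x => (f x)%:E) <= a%:E)%E -> (gE k (fun x => (g x)%:E) <= b%:E)%E ->
  (gE k (fun x => (f x + g x)%:E) <= (a + b)%:E)%E.
Proof.
move=> f0 g0 mf mg fa gb; under eq_gE do rewrite EFinD.
rewrite gED//; try exact: mseqR_EFin.
by rewrite EFinD leeD.
Qed.

Lemma gE_leZ k (f : seq R -> R) (c a : R) : 0 <= c ->
  (forall x, 0 <= f x) -> mseqR k f ->
  (gE k (fun x => (f x)%:E) <= a%:E)%E ->
  (gE k (fun x => (f x * c)%:E) <= (a * c)%:E)%E.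
Proof.
move=> c0 f0 mf fa; under eq_gE do rewrite mulrC EFinM.
rewrite gEZl//; last exact: mseqR_EFin.
by rewrite mulrC EFinM lee_wpmul2l.
Qed.

Lemma gE_le_sum k (I : eqType) (r : seq I) (f : I -> seq R -> R) (a : R) :
  (forall i x, 0 <= f i x) -> (forall i, mseqR k (f i)) ->
  (forall i, i \in r -> (gE k (fun x => (f i x)%:E) <= a%:E)%E) ->
  (gE k (fun x => (\sum_(i <- r) f i x)%:E) <= ((size r)%:R * a)%:E)%E.
Proof.
move=> f0 mf; elim: r => [|i r IH] h.
  by under eq_gE do rewrite big_nil; rewrite gE_cst// mul0r.
under eq_gE do rewrite big_cons.
rewrite /= -natr1 mulrDl mul1r addrC; apply: gE_leD => //.
- by move=> x; exact: sumr_ge0.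
- exact: mseqR_sum.
- by apply: h; rewrite mem_head.
- by apply: IH => j jr; apply: h; rewrite in_cons jr orbT.
Qed.

Lemma gE_le_sum_cond k (I : finType) (P : pred I) (f : I -> seq R -> R) (a : R) :
  (forall i x, 0 <= f i x) -> (forall i, mseqR k (f i)) ->
  (forall i, P i -> (gE k (fun x => (f i x)%:E) <= a%:E)%E) ->
  (gE k (fun x => (\sum_(i | P i) f i x)%:E) <= (#|P|%:R * a)%:E)%E.
Proof.
move=> f0 mf h; rewrite cardE /enum_mem.
have := @gE_le_sum k I (enum P) f a f0 mf.
under eq_gE do rewrite big_enum/=.
by apply => i; rewrite mem_enum => /h.
Qed.

Lemma mseqR_sum_cond k (I : Type) (r : seq I) (P : pred I) (f : I -> seq R -> R) :
  (forall i, mseqR k (f i)) -> mseqR k (fun x => \sum_(i <- r | P i) f i x).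
Proof.
move=> mf; have := @mseqR_sum R k I (seq.filter P r) f mf.
by rewrite /mseqR; under eq_fun do rewrite big_filter.
Qed.

(** The averaging argument of random coding; the factor two makes the contradiction strict, since
    [2 * e <= e] fails for positive [e]. *)
Lemma gE_exists k (f : seq R -> \bar R) (e : R) : 0 < e ->
  (gE k f <= e%:E)%E -> exists2 x, size x = k & (f x <= (2 * e)%:E)%E.
Proof.
move=> e0 h; apply: contrapT => hn.
have : (gE k (fun=> (2 * e)%:E) <= gE k f)%E.
  apply: le_gE => [s|s sk]; first by rewrite lee_fin; lra.
  by apply/ltW; rewrite ltNge; apply/negP => fs; apply: hn; exists s.
rewrite gE_cst ?lee_fin; last by lra.
by move=> /le_trans /(_ h); rewrite lee_fin; lra.
Qed.

Lemma mseqR_cat k j (f : seq R -> R) (u : seq R) : size u = k ->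
  mseqR (k + j) f -> mseqR j (fun v => f (u ++ v)).
Proof.
move=> su mf; have sz (v : j.-tuple R) : size (u ++ v) == (k + j)%N.
  by rewrite size_cat su size_tuple.
rewrite /mseqR (_ : (fun v => _) = (fun t : (k + j).-tuple R => f t) \o (fun v => Tuple (sz v)))//.
apply: measurableT_comp => //; apply/measurable_fun_tnthP => i.
have : mseqR j (fun v => if (i < k)%N then nth 0 u i else nth 0 v (i - k)).
  by case: (i < k)%N; [exact: mseqR_cst|exact: mseqR_nth].
rewrite /mseqR; congr (measurable_fun _ _); apply/funext => v /=.
by rewrite (tnth_nth 0)/= nth_cat su.
Qed.

End RealExpectation.

(** * Densities of the Gaussian ensemble and the mean of [bad] *)

Section RandomCoding.
Variables (R : realType) (m n nb M1 M2 : nat).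
Local Notation eta := m.+1.
Hypothesis nbn : (nb * eta <= n)%N.
Hypothesis nb0 : (0 < nb)%N.
Variables (g11 g12 g22 : R) (c1 c2 : 'I_3 * 'I_eta -> R).
Hypothesis c11 : \sum_p c1 p * c1 p = g11.
Hypothesis c12 : \sum_p c1 p * c2 p = g12.
Hypothesis c22 : \sum_p c2 p * c2 p = g22.
Variables (p11 p12 p22 q11 q12 q22 : R) (sl1 sl2 gam : R).
Hypothesis gam0 : 0 < gam.

(** With user 1 absent, [S2 / (1 + g22)] is the linear MMSE estimate of the letter of user 2, so
    [S1 - k3 * S2] removes the estimated interference from [S1]. On user 1 this leaves gain [g3],
    and [1 + g3] is the Schur complement of [1 + g22] in [1 + g]. *)
Definition mmse_coef : R := g12 / (1 + g22).
Definition g3 : R := g11 - g12 * mmse_coef.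
Local Notation k3 := mmse_coef.
Local Notation E1 := (@ev1 R m.+1).
Local Notation E2 := (@ev2 R m.+1).
Local Notation D := (nvars n nb M1 M2).
Local Notation cw1 := (th1 nb).
Local Notation cw2 := (th2 nb M1).
Local Notation nzb := (nz n nb M1 M2).

Lemma g11_ge0 : 0 <= g11.
Proof. by rewrite -c11; apply: sumr_ge0 => p _; rewrite -expr2 sqr_ge0. Qed.

Lemma g22_ge0 : 0 <= g22.
Proof. by rewrite -c22; apply: sumr_ge0 => p _; rewrite -expr2 sqr_ge0. Qed.

Lemma one_plus_g22_gt0 : 0 < 1 + g22.
Proof. by rewrite ltr_pwDl// g22_ge0. Qed.

(** The noise in [S1 - k3 * S2] as seen by user 1. The residual weight on the letter of user 2 is
    [g12 - k3 * g22 = k3]. By [bdot_cvec3] its variance equals the gain [g3], as [infod]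
    requires. *)
Definition cvec3 (v : bvar eta) : R := k3 * E2 v + evn c1 v - k3 * evn c2 v.

Lemma bdot_ev1 : bdot E1 E1 = 1.
Proof. by rewrite /bdot sum_bvar big1 => [|p _] /=; rewrite !(mulr0, mulr1, addr0). Qed.

Lemma bdot_ev2 : bdot E2 E2 = 1.
Proof. by rewrite /bdot sum_bvar big1 => [|p _] /=; rewrite !(mulr0, mulr1, addr0, add0r). Qed.

Lemma bdot_ev1_evn c : bdot E1 (evn c : bvar eta -> R) = 0.
Proof. by rewrite /bdot sum_bvar big1 => [|p _] /=; rewrite !(mulr0, mul0r, addr0). Qed.

Lemma bdot_ev2_evn c : bdot E2 (evn c : bvar eta -> R) = 0.
Proof. by rewrite /bdot sum_bvar big1 => [|p _] /=; rewrite !(mulr0, mul0r, addr0). Qed.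

Lemma bdot_evn c c' : bdot (evn c) (evn c' : bvar eta -> R) = \sum_p c p * c' p.
Proof. by rewrite /bdot sum_bvar /= !(mulr0, mul0r, addr0, add0r). Qed.

Lemma bdot_ev1_cvec3 : bdot E1 cvec3 = 0.
Proof.
rewrite /bdot sum_bvar /cvec3 big1 => [|p _] /=; rewrite ?mul0r//.
by rewrite !(mulr0, mul0r, addr0, subr0).
Qed.

Lemma bdot_cvec3 : bdot cvec3 cvec3 = g3.
Proof.
rewrite /bdot sum_bvar /cvec3 /=.
rewrite !(mulr0, mulr1, mul0r, addr0, subr0, add0r).
rewrite (eq_bigr (fun p => c1 p * c1 p - 2 * k3 * (c1 p * c2 p) + k3 ^+ 2 * (c2 p * c2 p))); last first.
  by move=> p _; ring.
rewrite big_split sumrB/= -!mulr_sumr c11 c12 c22 /g3 /mmse_coef; field.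
by rewrite lt0r_neq0// one_plus_g22_gt0.
Qed.

Lemma g3_ge0 : 0 <= g3.
Proof.
by rewrite -bdot_cvec3; apply: sumr_ge0 => p _; rewrite -expr2 sqr_ge0.
Qed.

Definition rate1 : R := ln (1 + g11) / 2.
Definition rate2 : R := ln (1 + g22) / 2.
Definition rate3 : R := ln (1 + g3) / 2.
Definition thr (r : R) : R := nb%:R * (r - gam).

Section FixedMessages.
Variables (w1 : 'I_M1) (w2 : 'I_M2).

Definition S1 x b := g11 * cw1 x w1 b + g12 * cw2 x w2 b + nzb c1 x b.
Definition S2 x b := g12 * cw1 x w1 b + g22 * cw2 x w2 b + nzb c2 x b.
(** [A1] and [A2] cancel the candidate of the other user; [A3] treats user 2 as noise, so [A2 + A3]
    is the chain-rule form of the joint density. *)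
Definition A1 (v1 : 'I_M1) (v2 : 'I_M2) x :=
  \sum_(b < nb) infod g11 (cw1 x v1 b) (S1 x b - g12 * cw2 x v2 b).
Definition A2 (v1 : 'I_M1) (v2 : 'I_M2) x :=
  \sum_(b < nb) infod g22 (cw2 x v2 b) (S2 x b - g12 * cw1 x v1 b).
Definition A3 (v1 : 'I_M1) x :=
  \sum_(b < nb) infod g3 (cw1 x v1 b) (S1 x b - k3 * S2 x b).
Definition dev (a11 a12 a22 : R) (x : seq R) : R := \sum_(b < nb)
     (a11 * (cw1 x w1 b ^+ 2 - 1) + 2 * a12 * (cw1 x w1 b * cw2 x w2 b) +
      a22 * (cw2 x w2 b ^+ 2 - 1)).

(** Chebyshev majorant of the event [nb * s <= |u|] for positive [s]. Since [0^-1 = 0], it is [0] at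
    [s = 0], a value met only when no power deviation can occur. *)
Definition sq_ratio (u s : R) : R := u ^+ 2 * (nb%:R * s) ^- 2.

(* Chebyshev and Chernoff majorant of: one of the three tests rejects the sent
   pair, some wrong pair passes the test that involves it, or the power of the
   sent codewords deviates. *)
Definition bad x : R :=
  sq_ratio (A1 w1 w2 x - nb%:R * rate1) gam +
  sq_ratio (A2 w1 w2 x - nb%:R * rate2) gam +
  sq_ratio (A3 w1 x - nb%:R * rate3) gam +
  \sum_(v1 | v1 != w1) expR (A1 v1 w2 x) * expR (- thr rate1) +
  \sum_(v2 | v2 != w2) expR (A2 w1 v2 x) * expR (- thr rate2) +
  \sum_(v1 | v1 != w1) \sum_(v2 | v2 != w2)
     expR (A2 v1 v2 x + A3 v1 x) * expR (- (thr rate2 + thr rate3)) +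
  sq_ratio (dev p11 p12 p22 x) sl1 +
  sq_ratio (dev q11 q12 q22 x) sl2.

(** Variance over squared margin for the Chebyshev terms, number of wrong candidates times tail for
    the others; each factor [1] is the mean of an exponentiated density. *)
Definition bad_bound : R :=
  nb%:R * form_norm (infod_form g11 E1 (evn c1)) * (nb%:R * gam) ^- 2 +
  nb%:R * form_norm (infod_form g22 E2 (evn c2)) * (nb%:R * gam) ^- 2 +
  nb%:R * form_norm (infod_form g3 E1 cvec3) * (nb%:R * gam) ^- 2 +
  M1.-1%:R * (1 * expR (- thr rate1)) +
  M2.-1%:R * (1 * expR (- thr rate2)) +
  M1.-1%:R * (M2.-1%:R * (1 * expR (- (thr rate2 + thr rate3)))) +
  nb%:R * form_norm (power_form p11 p12 p22 : bvar eta -> bvar eta -> R) * (nb%:R * sl1) ^- 2 +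
  nb%:R * form_norm (power_form q11 q12 q22 : bvar eta -> bvar eta -> R) * (nb%:R * sl2) ^- 2.

Lemma sq_ratio_ge0 u s : 0 <= sq_ratio u s.
Proof. by rewrite /sq_ratio mulr_ge0 ?invr_ge0 ?sqr_ge0. Qed.

Lemma mseqR_S1 b : mseqR D (S1 ^~ b).
Proof. by rewrite /S1 /th1 /th2 /nz; msolve. Qed.

Lemma mseqR_S2 b : mseqR D (S2 ^~ b).
Proof. by rewrite /S2 /th1 /th2 /nz; msolve. Qed.

Lemma mseqR_A1 v1 v2 : mseqR D (A1 v1 v2).
Proof.
apply: mseqR_sum => b; apply: mseqR_infod; first exact: mseqR_nth.
by apply: mseqRB; [exact: mseqR_S1|msolve].
Qed.

Lemma mseqR_A2 v1 v2 : mseqR D (A2 v1 v2).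
Proof.
apply: mseqR_sum => b; apply: mseqR_infod; first exact: mseqR_nth.
by apply: mseqRB; [exact: mseqR_S2|msolve].
Qed.

Lemma mseqR_A3 v1 : mseqR D (A3 v1).
Proof.
apply: mseqR_sum => b; apply: mseqR_infod; first exact: mseqR_nth.
by apply: mseqRB; [exact: mseqR_S1|apply: mseqRM; [exact: mseqR_cst|exact: mseqR_S2]].
Qed.

Lemma mseqR_dev a11 a12 a22 : mseqR D (dev a11 a12 a22).
Proof. by rewrite /dev /th1 /th2; msolve. Qed.

Lemma sum_centered (f : 'I_nb -> R) r : \sum_b f b - nb%:R * r = \sum_b (f b - r).
Proof. by rewrite sumrB sumr_const card_ord mulr_natl. Qed.

Lemma truth_variance (f : seq R -> R) V s : mseqR D f ->
  (gE D (fun x => (f x ^+ 2)%:E) <= (nb%:R * V)%:E)%E ->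
  (gE D (fun x => (sq_ratio (f x) s)%:E) <= (nb%:R * V * (nb%:R * s) ^- 2)%:E)%E.
Proof.
move=> mf h; apply: gE_leZ => //; first by rewrite invr_ge0 sqr_ge0.
  by move=> x; exact: sqr_ge0.
exact: mseqRX.
Qed.

Lemma mseqR_sq_ratio f s : mseqR D f -> mseqR D (fun x => sq_ratio (f x) s).
Proof. by move=> mf; apply: mseqRM; [exact: mseqRX|exact: mseqR_cst]. Qed.

Lemma mseqR_bad : mseqR D bad.
Proof.
rewrite /bad; repeat apply: mseqRD.
- by apply: mseqR_sq_ratio; apply: mseqRB; [exact: mseqR_A1|exact: mseqR_cst].
- by apply: mseqR_sq_ratio; apply: mseqRB; [exact: mseqR_A2|exact: mseqR_cst].
- by apply: mseqR_sq_ratio; apply: mseqRB; [exact: mseqR_A3|exact: mseqR_cst].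
- apply: mseqR_sum_cond => v; apply: mseqRM; last exact: mseqR_cst.
  by apply: mseqR_expR; exact: mseqR_A1.
- apply: mseqR_sum_cond => v; apply: mseqRM; last exact: mseqR_cst.
  by apply: mseqR_expR; exact: mseqR_A2.
- do 2 (apply: mseqR_sum_cond => ?); apply: mseqRM; last exact: mseqR_cst.
  by apply: mseqR_expR; apply: mseqRD; [exact: mseqR_A2|exact: mseqR_A3].
- by apply: mseqR_sq_ratio; exact: mseqR_dev.
- by apply: mseqR_sq_ratio; exact: mseqR_dev.
Qed.

Lemma bad_terms_ge0 x :
  [/\ 0 <= \sum_(v1 | v1 != w1) expR (A1 v1 w2 x) * expR (- thr rate1),
     0 <= \sum_(v2 | v2 != w2) expR (A2 w1 v2 x) * expR (- thr rate2) &
     0 <= \sum_(v1 | v1 != w1) \sum_(v2 | v2 != w2)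
     expR (A2 v1 v2 x + A3 v1 x) * expR (- (thr rate2 + thr rate3))].
Proof.
by split; apply: sumr_ge0 => v _; rewrite ?mulr_ge0 ?expR_ge0//;
  apply: sumr_ge0 => v' _; rewrite mulr_ge0 ?expR_ge0.
Qed.

Lemma bad_ge0 x : 0 <= bad x.
Proof.
by have [? ? ?] := bad_terms_ge0 x; rewrite /bad !addr_ge0 ?sq_ratio_ge0.
Qed.

Lemma card_neq_ord k (i0 : 'I_k) : k.-1 = #|[pred i | i != i0]|.
Proof. by rewrite -[in LHS](card_ord k) -(cardC1 i0); apply: eq_card => i; rewrite !inE. Qed.

Lemma gE_bad : (gE D (fun x => (bad x)%:E) <= bad_bound%:E)%E.
Proof.
have g10 := g11_ge0; have g20 := g22_ge0; have g30 := g3_ge0.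
have meA v r : mseqR D (fun x => expR (A1 v w2 x) * r).
  by apply: mseqRM; [apply: mseqR_expR; exact: mseqR_A1|exact: mseqR_cst].
have meB v r : mseqR D (fun x => expR (A2 w1 v x) * r).
  by apply: mseqRM; [apply: mseqR_expR; exact: mseqR_A2|exact: mseqR_cst].
have meC v v' : mseqR D (fun x => expR (A2 v v' x + A3 v x)).
  by apply: mseqR_expR; apply: mseqRD; [exact: mseqR_A2|exact: mseqR_A3].
have meC' v v' r : mseqR D (fun x => expR (A2 v v' x + A3 v x) * r).
  by apply: mseqRM; [exact: meC|exact: mseqR_cst].
have mB1 : mseqR D (fun x => A1 w1 w2 x - nb%:R * rate1).
  by apply: mseqRB; [exact: mseqR_A1|exact: mseqR_cst].
have mB2 : mseqR D (fun x => A2 w1 w2 x - nb%:R * rate2).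
  by apply: mseqRB; [exact: mseqR_A2|exact: mseqR_cst].
have mB3 : mseqR D (fun x => A3 w1 x - nb%:R * rate3).
  by apply: mseqRB; [exact: mseqR_A3|exact: mseqR_cst].
have t1 x := bad_terms_ge0 x.
rewrite /bad /bad_bound.
(* The summands of [bad] are peeled off from the last to the first. *)
apply: gE_leD; [|by move=> x; exact: sq_ratio_ge0| |by apply: mseqR_sq_ratio; exact: mseqR_dev| |].
- by move=> x; have [? ? ?] := t1 x; rewrite !addr_ge0 ?sq_ratio_ge0.
- repeat apply: mseqRD; try (by apply: mseqR_sq_ratio; try exact: mseqR_dev);
   by do ?(apply: mseqR_sum_cond => ?).
- apply: gE_leD; [|by move=> x; exact: sq_ratio_ge0| |by apply: mseqR_sq_ratio; exact: mseqR_dev| |].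
  + by move=> x; have [? ? ?] := t1 x; rewrite !addr_ge0 ?sq_ratio_ge0.
  + repeat apply: mseqRD; try (by apply: mseqR_sq_ratio; try exact: mseqR_dev);
    by do ?(apply: mseqR_sum_cond => ?).
  + apply: gE_leD; [|by move=> x; have [] := t1 x| |by do 2?(apply: mseqR_sum_cond => ?)| |].
    * by move=> x; have [? ? ?] := t1 x; rewrite !addr_ge0 ?sq_ratio_ge0.
    * repeat apply: mseqRD; try (by apply: mseqR_sq_ratio; try exact: mseqR_dev);
      by do ?(apply: mseqR_sum_cond => ?).
    * apply: gE_leD; [|by move=> x; have [] := t1 x| |by do 2?(apply: mseqR_sum_cond => ?)| |].
      - by move=> x; have [? ? ?] := t1 x; rewrite !addr_ge0 ?sq_ratio_ge0.
      - repeat apply: mseqRD; try (by apply: mseqR_sq_ratio; try exact: mseqR_dev);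
        by do ?(apply: mseqR_sum_cond => ?).
      - apply: gE_leD; [|by move=> x; have [] := t1 x| |by do 2?(apply: mseqR_sum_cond => ?)| |].
        + by move=> x; rewrite !addr_ge0 ?sq_ratio_ge0.
        + by repeat apply: mseqRD; apply: mseqR_sq_ratio.
        + apply: gE_leD; [by move=> x; rewrite addr_ge0 ?sq_ratio_ge0|by move=> x; exact: sq_ratio_ge0
            |by apply: mseqRD; apply: mseqR_sq_ratio|exact: mseqR_sq_ratio| |].
          * apply: gE_leD; [by move=> x; exact: sq_ratio_ge0|by move=> x; exact: sq_ratio_ge0
              |exact: mseqR_sq_ratio|exact: mseqR_sq_ratio| |].
            - apply: truth_variance => //.
              have := gE_infod_variance nbn w1 w2 g10 bdot_ev1 (bdot_ev1_evn c1) (etrans (bdot_evn c1 c1) c11).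
              apply: le_trans; rewrite le_eqVlt; apply/orP; left; apply/eqP/eq_gE => x _.
              rewrite /A1 sum_centered; congr (_ ^+ 2)%:E; apply: eq_bigr => b _.
              rewrite blin_ev1 blin_evn /S1 /rate1; congr (infod _ _ _ - _); ring.
            - apply: truth_variance => //.
              have := gE_infod_variance nbn w1 w2 g20 bdot_ev2 (bdot_ev2_evn c2) (etrans (bdot_evn c2 c2) c22).
              apply: le_trans; rewrite le_eqVlt; apply/orP; left; apply/eqP/eq_gE => x _.
              rewrite /A2 sum_centered; congr (_ ^+ 2)%:E; apply: eq_bigr => b _.
              rewrite blin_ev2 blin_evn /S2 /rate2; congr (infod _ _ _ - _); ring.
          * apply: truth_variance => //.
            have := gE_infod_variance nbn w1 w2 g30 bdot_ev1 bdot_ev1_cvec3 bdot_cvec3.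
            apply: le_trans; rewrite le_eqVlt; apply/orP; left; apply/eqP/eq_gE => x _.
            rewrite /A3 sum_centered; congr (_ ^+ 2)%:E; apply: eq_bigr => b _.
            rewrite blin_ev1 /rate3; congr (infod _ _ _ - _).
            have -> : blin n M1 M2 w1 w2 cvec3 x b = k3 * cw2 x w2 b + nzb c1 x b - k3 * nzb c2 x b.
              rewrite -(@blin_ev2 R m.+1 n nb M1 M2 w1 w2 x b).
              rewrite -!(@blin_evn R m.+1 n nb M1 M2 w1 w2 _ x b) /blin !mulr_sumr -big_split/= -sumrB.
              by apply: eq_bigr => v _; rewrite /cvec3; ring.
            (* Rests on [g11 - k3 * g12 = g3] and [g12 - k3 * g22 = k3]. *)
            rewrite /S1 /S2 /g3 /mmse_coef; field.
            by rewrite lt0r_neq0// one_plus_g22_gt0.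
        + rewrite (card_neq_ord w1).
          apply: gE_le_sum_cond => [v x|v|v vw]; [by rewrite mulr_ge0 ?expR_ge0|exact: meA|].
          apply: gE_leZ => [|x||]; [exact: expR_ge0|exact: expR_ge0
            |by apply: mseqR_expR; exact: mseqR_A1|].
          rewrite le_eqVlt; apply/orP; left; apply/eqP.
          rewrite -(@gE_infod_wrong1 R m.+1 n nb M1 M2 w1 v g11 c1 g10 vw).
          apply: eq_gE => x _; congr (expR _)%:E.
          by apply: eq_bigr => b _; rewrite /S1; congr infod; ring.
      - rewrite (card_neq_ord w2).
        apply: gE_le_sum_cond => [v x|v|v vw]; [by rewrite mulr_ge0 ?expR_ge0|exact: meB|].
        apply: gE_leZ => [|x||]; [exact: expR_ge0|exact: expR_ge0
          |by apply: mseqR_expR; exact: mseqR_A2|].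
        rewrite le_eqVlt; apply/orP; left; apply/eqP.
        rewrite -(@gE_infod_wrong2 R m.+1 n nb M1 M2 w2 v g22 c2 g20 vw).
        apply: eq_gE => x _; congr (expR _)%:E.
        by apply: eq_bigr => b _; rewrite /S2; congr infod; ring.
    * rewrite (card_neq_ord w1).
      apply: gE_le_sum_cond => [v x|v|v vw].
      - by apply: sumr_ge0 => v' _; rewrite mulr_ge0 ?expR_ge0.
      - by apply: mseqR_sum_cond => v'.
      rewrite (card_neq_ord w2).
      apply: gE_le_sum_cond => [v' x|v'|v' vw']; [by rewrite mulr_ge0 ?expR_ge0|exact: meC'|].
      apply: gE_leZ => [|x||]; [exact: expR_ge0|exact: expR_ge0|exact: meC|].
      rewrite le_eqVlt; apply/orP; left; apply/eqP.
      rewrite -(@gE_infod_wrong12 R m.+1 n nb M1 M2 w1 v w2 v' g11 g12 g22 g3 k3 c1 c2 g20 g30 vw vw').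
      by apply: eq_gE => x _; congr (expR _)%:E; rewrite -big_split.
  + by apply: truth_variance; [exact: mseqR_dev|exact: gE_power_variance].
- by apply: truth_variance; [exact: mseqR_dev|exact: gE_power_variance].
Qed.

End FixedMessages.

End RandomCoding.

Section Averages.
Variable R : realType.

(** The variance of [u] under the uniform weight [c] is nonnegative. *)
Lemma sqr_avg_le (I : finType) (u : I -> R) (c : R) : 0 <= c -> #|I|%:R * c = 1 ->
  (\sum_i u i * c) ^+ 2 <= \sum_i u i ^+ 2 * c.
Proof.
move=> c0 cI; set S := \sum_i u i * c.
have : 0 <= \sum_i (u i - S) ^+ 2 * c by apply: sumr_ge0 => i _; rewrite mulr_ge0 ?sqr_ge0.
have -> : \sum_i (u i - S) ^+ 2 * c = \sum_i u i ^+ 2 * c - S ^+ 2; last by rewrite subr_ge0.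
rewrite (eq_bigr (fun i => u i ^+ 2 * c - 2 * S * (u i * c) + S ^+ 2 * c)); last by move=> i _; ring.
rewrite big_split sumrB/= -mulr_sumr -/S sumr_const -[_ *+ #|_|]mulr_natl mulrCA cI; ring.
Qed.

Lemma sum_blocks (k q : nat) (f : nat -> R) :
  \sum_(t < k * q) f t = \sum_(b < k) \sum_(i < q) f (b * q + i)%N.
Proof.
elim: k => [|k IH]; first by rewrite !big_ord0.
rewrite big_ord_recr/= -IH -(big_mkord xpredT f) -(big_mkord xpredT f) mulSnr.
rewrite (big_cat_nat _ (n := (k * q)%N))//= ?leq_addr//; congr (_ + _).
rewrite -{1}[(k * q)%N]add0n big_addn addKn -(big_mkord xpredT (fun i => f (k * q + i)%N)).
by apply: eq_bigr => i _; rewrite addnC.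
Qed.

Lemma gE_avg k (I : finType) (f : I -> seq R -> R) (c : R) : 0 <= c ->
  (forall i x, 0 <= f i x) -> (forall i, mseqR k (f i)) ->
  gE k (fun x => (\sum_i f i x * c)%:E) = (c%:E * \sum_i gE k (fun x => (f i x)%:E))%E.
Proof.
move=> c0 f0 mf.
rewrite (eq_gE (G := fun x => (c%:E * \sum_i (f i x)%:E)%E)); last first.
  by move=> x _; rewrite -mulr_suml mulrC EFinM sumEFin.
rewrite gEZl//; last 2 first.
- by move=> s; apply: sume_ge0 => i _; rewrite lee_fin.
- by apply: emeasurable_sum => i; exact: mseqR_EFin.
by rewrite gE_sum// => i; exact: mseqR_EFin.
Qed.

End Averages.

(** * Encoders and threshold decoder of a fixed codebook *)

Section Codebook.
Variables (R : realType) (m n nb M1 M2 : nat) (N s1 s2 rho : R).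
Local Notation eta := m.+1.
Hypothesis nbn : (nb * eta <= n)%N.
Hypotheses (N0 : 0 <= N) (rho1 : rho ^+ 2 <= 1).
Variables (a1 a2 : 'cV[R]_eta) (B1 B2 : 'M[R]_eta).
Hypotheses (sl1 : strictly_lower B1) (sl2 : strictly_lower B2).
Local Notation K := (cbsize nb M1 M2).
Variables (cb : seq R).
Hypothesis szcb : size cb = K.
Local Notation cw1 := (th1 nb).
Local Notation cw2 := (th2 nb M1).
Local Notation nzb := (nz n nb M1 M2).
Local Notation flat zs g1 g2 := (cb ++ (zs ++ (g1 ++ g2))).

Definition cenc1 (w : 'I_M1) := lin_enc nb a1 B1 (cw1 cb w).
Definition cenc2 (w : 'I_M2) := lin_enc nb a2 B2 (cw2 cb w).

Lemma th1_cat (w : 'I_M1) (b : nat) u : (b < nb)%N -> cw1 (cb ++ u) w b = cw1 cb w b.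
Proof.
move=> bn; rewrite /th1 nth_cat szcb.
have := code1_lt (ltn_ord w) bn; rewrite /cbsize mulnDl => h.
by rewrite (leq_trans h)// leq_addr.
Qed.

Lemma th2_cat (w : 'I_M2) (b : nat) u : (b < nb)%N -> cw2 (cb ++ u) w b = cw2 cb w b.
Proof.
by move=> bn; rewrite /th2 nth_cat szcb (code2_lt M1 (ltn_ord w) bn).
Qed.

Definition stat (l : 'rV[R]_eta) (y : seq R) (b : nat) : R :=
  \sum_(i < eta) l 0 i * (nth 0 y (b * eta + i) -
     \sum_(j < eta) (B1 i j + B2 i j) * nth 0 y (b * eta + j)).

Definition stat_coef (l : 'rV[R]_eta) : 'I_3 * 'I_eta -> R :=
  noise_coef N s1 s2 rho (l 0) ((l *m B1) 0) ((l *m B2) 0).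

Lemma stat_run l w1 w2 (zs g1 g2 : n.-tuple R) b : (b < nb)%N ->
  stat l (run_out N s1 s2 rho cenc1 cenc2 w1 w2 zs g1 g2) b =
  (l *m a1) 0 0 * cw1 cb w1 b + (l *m a2) 0 0 * cw2 cb w2 b + nzb (stat_coef l) (flat zs g1 g2) b.
Proof.
move=> bn; rewrite /stat_coef nz_noise_coef ?size_tuple//.
rewrite -(run_statistic nbn a1 a2 (cw1 cb w1) (cw2 cb w2) _ _ _ sl1 sl2)//.
have e t : (t < n)%N -> nth 0 (run_out N s1 s2 rho cenc1 cenc2 w1 w2 zs g1 g2) t =
    chan_out (run_hist N s1 s2 rho cenc1 cenc2 w1 w2 zs g1 g2) (Znoise N zs) t.
  by move=> tn; rewrite -[t]/(val (Ordinal tn)) -tnth_nth tnth_mktuple.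
have tn i := block_lt nbn (Ordinal bn) i; rewrite /= in tn.
apply: eq_bigr => i _; rewrite e//; congr (_ * (_ - _)).
by apply: eq_bigr => j _; rewrite e.
Qed.

Definition gain (u : 'I_(1 + 1)) (k : 'I_(eta + eta)) : R := msg_gain a1 a2 B1 B2 k u.
Definition gain1 := gain (lshift 1 ord0).
Definition gain2 := gain (rshift 1 ord0).
Definition input_coef (k : 'I_(eta + eta)) : 'I_3 * 'I_eta -> R :=
  noise_coef N s1 s2 rho (Z_gain B1 B2 k) (W1_gain B1 B2 k) (W2_gain B1 B2 k).

Definition inputs (h : seq (R * R)) (b : nat) (k : 'I_(eta + eta)) : R :=
  match fintype.split k with
  | inl i => (nth (0, 0) h (b * eta + i)).1
  | inr i => (nth (0, 0) h (b * eta + i)).2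
  end.

Lemma inputs_run w1 w2 (zs g1 g2 : n.-tuple R) b k : (b < nb)%N ->
  inputs (run_hist N s1 s2 rho cenc1 cenc2 w1 w2 zs g1 g2) b k =
  gain1 k * cw1 cb w1 b + gain2 k * cw2 cb w2 b + nzb (input_coef k) (flat zs g1 g2) b.
Proof.
move=> bn; rewrite /input_coef nz_noise_coef ?size_tuple//.
have := run_inputs nbn a1 a2 (cw1 cb w1) (cw2 cb w2) (Znoise N zs) (W1noise s1 g1)
  (W2noise s2 rho g1 g2) sl1 sl2 bn.
move/matrixP => /(_ k 0).
rewrite [LHS]mxE => h.
transitivity (inputs (run_hist N s1 s2 rho cenc1 cenc2 w1 w2 zs g1 g2) b k); first by [].
have {}h : inputs (run_hist N s1 s2 rho cenc1 cenc2 w1 w2 zs g1 g2) b k =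
   (msg_gain a1 a2 B1 B2 *m col_mx (const_mx (cw1 cb w1 b)) (const_mx (cw2 cb w2 b)) +
  Z_gain B1 B2 *m (\col_(j < eta) Znoise N zs (b * eta + j)%N) +
  W1_gain B1 B2 *m (\col_(j < eta) W1noise s1 g1 (b * eta + j)%N) +
  W2_gain B1 B2 *m (\col_(j < eta) W2noise s2 rho g1 g2 (b * eta + j)%N)) k 0.
  by rewrite -h /inputs; case: (fintype.split k) => i; rewrite mxE.
have addE (A B : 'cV[R]_(eta + eta)) : (A + B) k 0 = A k 0 + B k 0 by rewrite mxE.
have mulc (A : 'M[R]_(eta + eta, eta)) (f : nat -> R) :
  (A *m \col_(j < eta) f (b * eta + j)%N) k 0 = \sum_(j < eta) A k j * f (b * eta + j)%N.
  by rewrite mxE; apply: eq_bigr => j _; rewrite mxE.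
have mE : (msg_gain a1 a2 B1 B2 *m col_mx (const_mx (cw1 cb w1 b)) (const_mx (cw2 cb w2 b)) : 'cV[R]_(eta + eta)) k 0 =
    gain1 k * cw1 cb w1 b + gain2 k * cw2 cb w2 b.
  have ce (v : R) : (const_mx v : 'cV[R]_1) 0 0 = v by rewrite mxE.
  by rewrite mxE big_split_ord !big_ord1 col_mxEu col_mxEd !ce.
rewrite h !addE mE (mulc _ (Znoise N zs)) (mulc _ (W1noise s1 g1)) (mulc _ (W2noise s2 rho g1 g2)).
by rewrite !addrA.
Qed.

Lemma Enoise_gE (F : seq R -> \bar R) :
  Enoise (fun zs g1 g2 : n.-tuple R => F (zs ++ (g1 ++ g2))) = gE (n + (n + n)) F.
Proof.
transitivity (gE n (fun u => gE n (fun v => gE n (fun w => F (u ++ (v ++ w)))))) => //.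
by rewrite gE_cat; apply: eq_gE => u _; rewrite gE_cat.
Qed.

Lemma Enoise_le (F G : n.-tuple R -> n.-tuple R -> n.-tuple R -> \bar R) :
  (forall zs g1 g2, 0 <= F zs g1 g2)%E -> (forall zs g1 g2, F zs g1 g2 <= G zs g1 g2)%E ->
  (Enoise F <= Enoise G)%E.
Proof.
move=> F0 FG; apply: gexp_le => zs; first by do 2 (apply: gexp_ge0 => ?).
apply: gexp_le => g1; first by apply: gexp_ge0 => ?.
by apply: gexp_le.
Qed.

(** With the codebook fixed the letters are constants, collected in [c], and the mean square splits
    into signal and noise. *)
Lemma Enoise_affine_sq (c : R) (d : 'I_3 * 'I_eta -> R) b : (b < nb)%N ->
  (Enoise (fun zs g1 g2 : n.-tuple R => ((c + nzb d (flat zs g1 g2) b) ^+ 2)%:E)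
   <= (c ^+ 2 + \sum_p d p ^+ 2)%:E)%E.
Proof.
clear N0 rho1 sl1 sl2.
move=> bn; rewrite (Enoise_gE (fun u => ((c + nzb d (cb ++ u) b) ^+ 2)%:E)).
pose io (p : 'I_3 * 'I_eta) := (p.1 * n + (b * eta + p.2))%N.
have bl j := block_lt nbn (Ordinal bn) j; rewrite /= in bl.
have inj : injective io.
  move=> [i j] [i' j']; rewrite /io/= => /(radix_inj (bl _) (bl _))[e1 /addnI e2].
  by congr (_, _); exact: val_inj.
have lt p : (io p < n + (n + n))%N.
  rewrite /io; have := bl p.2; have := ltn_ord p.1.
  by move: (nat_of_ord p.1) => a; case: a => [|[|[|a]]]//; lia.
have := gE_quadratic_inj c d (fun _ _ => 0) inj lt.
have z : \sum_(u : 'I_3 * 'I_eta) \sum_(v : 'I_3 * 'I_eta) (0 : R) ^+ 2 = 0.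
  by rewrite big1// => u _; rewrite big1// => v _; rewrite expr0n.
rewrite z mulr0 addr0; apply: le_trans; rewrite le_eqVlt; apply/orP; left; apply/eqP/eq_gE => u su.
congr (_ ^+ 2)%:E; rewrite [X in _ = _ + _ + X]big1 ?addr0; last first.
  by move=> p _; rewrite big1// => p' _; rewrite mul0r.
congr (_ + _); apply: eq_bigr => p _; congr (_ * _).
by rewrite /nzidx nth_cat szcb ltnNge leq_addr/= addKn.
Qed.

Variables (l1 l2 : 'rV[R]_eta) (g11 g12 g22 gam : R).
Hypotheses (h11 : (l1 *m a1) 0 0 = g11) (h12 : (l1 *m a2) 0 0 = g12)
  (h21 : (l2 *m a1) 0 0 = g12) (h22 : (l2 *m a2) 0 0 = g22).
Local Notation c1 := (stat_coef l1).
Local Notation c2 := (stat_coef l2).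
Local Notation A1 := (A1 n nb g11 g12 c1).
Local Notation A2 := (A2 n nb g12 g22 c2).
Local Notation A3 := (A3 n nb g11 g12 g22 c1 c2).
Local Notation tau := (thr nb gam).
Local Notation g3 := (g3 g11 g12 g22).
Local Notation k3 := (mmse_coef g12 g22).

(** The three densities as the decoder computes them, from the output and the codebook alone; on an
    actual run they coincide with [A1], [A2] and [A3]. *)
Definition dA1 (y : seq R) (v1 : 'I_M1) (v2 : 'I_M2) : R :=
  \sum_(b < nb) infod g11 (cw1 cb v1 b) (stat l1 y b - g12 * cw2 cb v2 b).
Definition dA2 (y : seq R) (v1 : 'I_M1) (v2 : 'I_M2) : R :=
  \sum_(b < nb) infod g22 (cw2 cb v2 b) (stat l2 y b - g12 * cw1 cb v1 b).
Definition dA3 (y : seq R) (v1 : 'I_M1) : R :=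
  \sum_(b < nb) infod g3 (cw1 cb v1 b) (stat l1 y b - k3 * stat l2 y b).

Definition dtest (y : seq R) (v : 'I_M1 * 'I_M2) : bool :=
  [&& tau (rate1 g11) < dA1 y v.1 v.2, tau (rate2 g22) < dA2 y v.1 v.2
    & tau (rate2 g22) + tau (rate3 g11 g12 g22) < dA2 y v.1 v.2 + dA3 y v.1].

Definition cdec (w0 : 'I_M1 * 'I_M2) (y : n.-tuple R) : 'I_M1 * 'I_M2 :=
  odflt w0 [pick v | dtest y v].

Lemma measurable_dtest v : measurable [set y : n.-tuple R | dtest y v].
Proof.
have m1 b : mseqR n (stat l1 ^~ b) by rewrite /stat; msolve.
have m2 b : mseqR n (stat l2 ^~ b) by rewrite /stat; msolve.
have mA1 : mseqR n (fun y => dA1 y v.1 v.2).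
  apply: mseqR_sum => b; apply: mseqR_infod; first exact: mseqR_cst.
  by apply: mseqRB => //; exact: mseqR_cst.
have mA2 : mseqR n (fun y => dA2 y v.1 v.2).
  apply: mseqR_sum => b; apply: mseqR_infod; first exact: mseqR_cst.
  by apply: mseqRB => //; exact: mseqR_cst.
have mA3 : mseqR n (fun y => dA2 y v.1 v.2 + dA3 y v.1).
  apply: mseqRD => //; apply: mseqR_sum => b; apply: mseqR_infod; first exact: mseqR_cst.
  by apply: mseqRB => //; apply: mseqRM => //; exact: mseqR_cst.
have mgt (f : seq R -> R) c : mseqR n f -> measurable [set y : n.-tuple R | c < f y].
  move=> mf; have := mf measurableT `]c, +oo[%classic (measurable_itv _).
  rewrite setTI; congr measurable; apply/seteqP; split => y /=; rewrite in_itv/= andbT//.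
rewrite (_ : [set y | _] = [set y : n.-tuple R | tau (rate1 g11) < dA1 y v.1 v.2] `&`
  [set y : n.-tuple R | tau (rate2 g22) < dA2 y v.1 v.2] `&`
  [set y : n.-tuple R | tau (rate2 g22) + tau (rate3 g11 g12 g22) < dA2 y v.1 v.2 + dA3 y v.1]).
  by apply: measurableI; [apply: measurableI; [exact: (mgt _ _ mA1)|exact: (mgt _ _ mA2)]|exact: (mgt _ _ mA3)].
by apply/seteqP; split => y /=; [move=> /and3P[? ? ?]|move=> [[? ?] ?]; apply/and3P].
Qed.

(** The decision depends only on the finite table of test outcomes, so its level sets are finite
    unions of finite intersections of test events and their complements. *)
Lemma measurable_cdec w0 v : measurable [set y : n.-tuple R | cdec w0 y = v].
Proof.
pose T : finType := {ffun 'I_M1 * 'I_M2 -> bool}.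
pose ch (f : T) := odflt w0 [pick v | f v].
have -> : [set y : n.-tuple R | cdec w0 y = v] =
   \big[setU/set0]_(f : T | ch f == v) \big[setI/setT]_(u : 'I_M1 * 'I_M2)
     [set y : n.-tuple R | dtest y u = f u].
  apply/seteqP; split => y /=.
    move=> yv; rewrite -bigcup_seq_cond.
    pose f : T := [ffun u => dtest y u].
    exists f => /=.
      rewrite mem_index_enum/=; apply/eqP; rewrite -yv /ch /cdec; congr odflt.
      by apply: eq_pick => u; rewrite ffunE.
    by rewrite -bigcap_seq => u _ /=; rewrite ffunE.
  rewrite -bigcup_seq_cond => -[f /= /andP[_ /eqP <-]].
  rewrite -bigcap_seq => h; rewrite /ch /cdec; congr odflt.
  by apply: eq_pick => u; rewrite -h//= mem_index_enum.
apply: bigsetU_measurable => f _; apply: bigsetI_measurable => u _.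
case: (f u); first exact: measurable_dtest.
rewrite (_ : [set y | _] = ~` [set y : n.-tuple R | dtest y u]).
  by apply: measurableC; exact: measurable_dtest.
by apply/seteqP; split => y /=; case: (dtest y u).
Qed.

Section FixedPair.
Variables (w1 : 'I_M1) (w2 : 'I_M2) (p11 p12 p22 q11 q12 q22 sk1 sk2 : R).
Hypothesis gam0 : 0 < gam.
Hypothesis nb0 : (0 < nb)%N.
Local Notation bad := (bad n nb g11 g12 g22 c1 c2 p11 p12 p22 q11 q12 q22 sk1 sk2 gam w1 w2).

Lemma sq_ratio_lt1 (u s : R) : 0 < s -> sq_ratio nb u s < 1 -> `|u| < nb%:R * s.
Proof.
move=> s0; have ns0 : 0 < nb%:R * s by rewrite mulr_gt0 ?ltr0n.
rewrite /sq_ratio ltr_pdivrMr ?exprn_gt0// mul1r => h.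
by rewrite -(@ltr_pXn2r _ 2) ?nnegrE ?normr_ge0 ?(ltW ns0)// real_normK ?num_real.
Qed.

Lemma sum8_lt1 (a b c d e f g h : R) : 0 <= a -> 0 <= b -> 0 <= c -> 0 <= d -> 0 <= e ->
  0 <= f -> 0 <= g -> 0 <= h -> a + b + c + d + e + f + g + h < 1 ->
  [/\ a < 1, b < 1 & c < 1] /\ [/\ d < 1, e < 1 & f < 1].
Proof. by move=> *; split; split; lra. Qed.

Lemma sum_lt1_term (I : finType) (P : pred I) (f : I -> R) i :
  (forall i, 0 <= f i) -> \sum_(i | P i) f i < 1 -> P i -> f i < 1.
Proof.
move=> f0 h Pi; apply: le_lt_trans h; rewrite (bigD1 i)//= lerDl.
by apply: sumr_ge0.
Qed.

(** If [bad < 1], every summand is below one: the Chebyshev terms let the sent pair pass, and the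
    exponential terms keep each wrong density under its threshold. *)
Lemma decoding_error (w0 : 'I_M1 * 'I_M2) (zs g1 g2 : n.-tuple R) :
  cdec w0 (run_out N s1 s2 rho cenc1 cenc2 w1 w2 zs g1 g2) != (w1, w2) ->
  1 <= bad (flat zs g1 g2).
Proof.
set y := run_out _ _ _ _ _ _ _ _ _ _ _; set x := flat zs g1 g2.
have e1 v1 v2 : dA1 y v1 v2 = A1 w1 w2 v1 v2 x.
  apply: eq_bigr => b _; rewrite stat_run// h11 h12 /S1 !th1_cat// !th2_cat//.
have e2 v1 v2 : dA2 y v1 v2 = A2 w1 w2 v1 v2 x.
  apply: eq_bigr => b _; rewrite stat_run// h21 h22 /S2 !th1_cat// !th2_cat//.
have e3 v1 : dA3 y v1 = A3 w1 w2 v1 x.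
  apply: eq_bigr => b _; rewrite !stat_run// h11 h12 h21 h22 /S1 /S2 !th1_cat// !th2_cat//.
apply: contraNT; rewrite -ltNge => lt1.
have [t1 t2 t3] := bad_terms_ge0 n nb g11 g12 g22 c1 c2 gam w1 w2 x.
have [[b1 b2 b3] [b4 b5 b6]] := sum8_lt1 (sq_ratio_ge0 _ _ _) (sq_ratio_ge0 _ _ _)
  (sq_ratio_ge0 _ _ _) t1 t2 t3 (sq_ratio_ge0 _ _ _) (sq_ratio_ge0 _ _ _) lt1.
have tauE r : tau r = nb%:R * r - nb%:R * gam by rewrite /thr mulrBr.
have exp_lt u s : expR u * expR (- s) < 1 -> u < s.
  by rewrite -expRD expR_lt1 subr_lt0.
have p1 := sq_ratio_lt1 gam0 b1; have p2 := sq_ratio_lt1 gam0 b2; have p3 := sq_ratio_lt1 gam0 b3.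
have ok : dtest y (w1, w2).
  rewrite /dtest/= e1 e2 e3 !tauE; move: p1 p2 p3; rewrite !ltr_norml.
  by move=> /andP[p1 _] /andP[p2 _] /andP[p3 _]; apply/and3P; split; lra.
have uniq v : dtest y v -> v = (w1, w2).
  case: v => v1 v2; rewrite /dtest/= e1 e2 e3 => /and3P[q1 q2 q3].
  (* A pair wrong in one message is excluded by the density of that user, a pair wrong in both by
     the sum density alone. *)
  case: (eqVneq v1 w1) => [E1|n1]; case: (eqVneq v2 w2) => [E2|n2].
  - by rewrite E1 E2.
  - exfalso; rewrite E1 in q2.
    have : expR (A2 w1 w2 w1 v2 x) * expR (- tau (rate2 g22)) < 1.
      by apply: sum_lt1_term b5 n2 => v; rewrite mulr_ge0 ?expR_ge0.
    by move=> /exp_lt; move: q2; lra.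
  - exfalso; rewrite E2 in q1.
    have : expR (A1 w1 w2 v1 w2 x) * expR (- tau (rate1 g11)) < 1.
      by apply: sum_lt1_term b4 n1 => v; rewrite mulr_ge0 ?expR_ge0.
    by move=> /exp_lt; move: q1; lra.
  - exfalso.
    have : \sum_(v2 | v2 != w2) expR (A2 w1 w2 v1 v2 x + A3 w1 w2 v1 x) *
       expR (- (tau (rate2 g22) + tau (rate3 g11 g12 g22))) < 1.
      apply: sum_lt1_term b6 n1 => v.
      by apply: sumr_ge0 => v' _; rewrite mulr_ge0 ?expR_ge0.
    move=> b7; have : expR (A2 w1 w2 v1 v2 x + A3 w1 w2 v1 x) *
       expR (- (tau (rate2 g22) + tau (rate3 g11 g12 g22))) < 1.
      by apply: sum_lt1_term b7 n2 => v; rewrite mulr_ge0 ?expR_ge0.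
    by move=> /exp_lt; move: q3; lra.
rewrite /cdec; case: pickP => [v tv|/(_ (w1, w2))]; last by rewrite ok.
by rewrite /= (uniq v tv).
Qed.

End FixedPair.
End Codebook.

(** * Choice of a codebook good for error and power *)

Section GoodCode.
Variables (R : realType) (m n nb M1 M2 : nat) (N s1 s2 rho : R).
Local Notation eta := m.+1.
Hypothesis nbn : (nb * eta <= n)%N.
Hypothesis nb0 : (0 < nb)%N.
Hypotheses (M10 : (0 < M1)%N) (M20 : (0 < M2)%N).
Hypotheses (N0 : 0 <= N) (rho1 : rho ^+ 2 <= 1).
Variables (a1 a2 : 'cV[R]_eta) (B1 B2 : 'M[R]_eta).
Hypotheses (lo1 : strictly_lower B1) (lo2 : strictly_lower B2).
Local Notation K := (cbsize nb M1 M2).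
Local Notation cw1 := (th1 nb).
Local Notation cw2 := (th2 nb M1).
Local Notation gain1 := (gain1 a1 a2 B1 B2).
Local Notation gain2 := (gain2 a1 a2 B1 B2).
Local Notation icoef := (input_coef N s1 s2 rho B1 B2).
Local Notation cM := (((M1 * M2)%:R)^-1 : R).

(** [sel] picks the rows of one user in the stacked input. For standard normal letters the mean
    block power of that user is [pow11 + pow22 + pow_noise]; [pow12] enters only the deviation of an
    actual codebook. *)
Definition pow11 (sel : 'I_eta -> 'I_(eta + eta)) : R := \sum_i gain1 (sel i) ^+ 2.
Definition pow12 (sel : 'I_eta -> 'I_(eta + eta)) : R := \sum_i gain1 (sel i) * gain2 (sel i).
Definition pow22 (sel : 'I_eta -> 'I_(eta + eta)) : R := \sum_i gain2 (sel i) ^+ 2.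
Definition pow_noise (sel : 'I_eta -> 'I_(eta + eta)) : R := \sum_i \sum_p icoef (sel i) p ^+ 2.

Lemma cM_ge0 : 0 <= cM. Proof. by rewrite invr_ge0 ler0n. Qed.

Lemma cM_card : #|{: 'I_M1 * 'I_M2}|%:R * cM = 1.
Proof. by rewrite card_prod !card_ord divff// pnatr_eq0 -lt0n muln_gt0 M10 M20. Qed.

Lemma sum_pairE (f : 'I_M1 -> 'I_M2 -> \bar R) :
  (\sum_(w1 < M1) \sum_(w2 < M2) f w1 w2 = \sum_(p : 'I_M1 * 'I_M2) f p.1 p.2)%E.
Proof. by rewrite pair_big. Qed.

(** For a given codebook the total power is its ensemble mean plus the message average of [dev],
    which the slack [sk] absorbs. *)
Lemma power_sum (cb : seq R) (EX : nat -> \bar R) sel (sk P : R) : size cb = K ->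
  let dv p := dev nb p.1 p.2 (pow11 sel) (pow12 sel) (pow22 sel) cb in
  (forall b (i : 'I_eta), (b < nb)%N -> (EX (b * eta + i)%N = cM%:E *
     \sum_(w1 < M1) \sum_(w2 < M2) Enoise (fun zs g1 g2 : n.-tuple R =>
       ((inputs (run_hist N s1 s2 rho (cenc1 nb a1 B1 cb) (cenc2 nb M1 a2 B2 cb)
            w1 w2 zs g1 g2) b (sel i)) ^+ 2)%:E))%E) ->
  (forall t, (nb * eta <= t)%N -> (t < n)%N -> EX t = 0%E) ->
  \sum_(p : 'I_M1 * 'I_M2) dv p * cM <= nb%:R * sk ->
  0 <= P -> pow11 sel + pow22 sel + pow_noise sel + sk <= eta%:R * P ->
  ((n%:R)^-1%:E * \sum_(t < n) EX t <= P%:E)%E.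
Proof.
move=> szcb dv hEX hsil hdv P0 hP.
pose u (p : 'I_M1 * 'I_M2) b i := gain1 (sel i) * cw1 cb p.1 b + gain2 (sel i) * cw2 cb p.2 b.
pose H b i := \sum_(p : 'I_M1 * 'I_M2) u p b i ^+ 2 * cM + \sum_q icoef (sel i) q ^+ 2.
pose G t := if (t < nb * eta)%N then H (t %/ eta)%N (inord (t %% eta)) else 0.
have EXG t : (t < n)%N -> (EX t <= (G t)%:E)%E.
  move=> tn; rewrite /G; case: (ltnP t (nb * eta)) => tb; last by rewrite hsil.
  have bn : (t %/ eta < nb)%N by rewrite ltn_divLR.
  have tE : t = (t %/ eta * eta + (inord (t %% eta) : 'I_eta))%N.
    by rewrite inordK ?ltn_pmod// -divn_eq.
  rewrite {1}tE hEX// sum_pairE.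
  set i : 'I_eta := inord _; set b := (t %/ eta)%N.
  have -> : H b i = cM * \sum_(p : 'I_M1 * 'I_M2) (u p b i ^+ 2 + \sum_q icoef (sel i) q ^+ 2).
    rewrite big_split/= sumr_const mulrDr -[_ *+ #|_|]mulr_natl mulrA (mulrC cM _%:R) cM_card mul1r.
    by rewrite /H mulr_sumr; congr (_ + _); apply: eq_bigr => p _; rewrite mulrC.
  rewrite EFinM lee_wpmul2l ?lee_fin ?cM_ge0// -sumEFin; apply: lee_sum => p _.
  apply: le_trans (Enoise_affine_sq nbn szcb (u p b i) (icoef (sel i)) bn).
  apply: Enoise_le => zs g1 g2; first by rewrite lee_fin sqr_ge0.
  by rewrite inputs_run.
have sumG : \sum_(t < n) G t = \sum_(b < nb) \sum_(i < eta) H b i.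
  pose F t := H (t %/ eta)%N (inord (t %% eta)).
  transitivity (\sum_(t < nb * eta) F t).
    rewrite (eq_bigr (fun t : 'I_n => if (0 <= t < 0 + nb * eta)%N then F t else 0))//.
    by rewrite (sum_if_range F).
  rewrite sum_blocks; apply: eq_bigr => b _; apply: eq_bigr => i _.
  by rewrite /F divnMDl// divn_small// addn0 modnMDl modn_small// inord_val.
have total : \sum_(b < nb) \sum_(i < eta) H b i =
    \sum_(p : 'I_M1 * 'I_M2) dv p * cM + nb%:R * (pow11 sel + pow22 sel + pow_noise sel).
  transitivity (\sum_(p : 'I_M1 * 'I_M2) (dv p + nb%:R * (pow11 sel + pow22 sel)) * cM
     + nb%:R * pow_noise sel).
    transitivity (\sum_(b < nb) (\sum_(p : 'I_M1 * 'I_M2) (\sum_(i < eta) u p b i ^+ 2) * cM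
        + pow_noise sel)).
      apply: eq_bigr => b _; rewrite big_split/=; congr (_ + _).
      by rewrite exchange_big/=; apply: eq_bigr => p _; rewrite mulr_suml.
    rewrite big_split/= sumr_const card_ord -[_ *+ nb]mulr_natl; congr (_ + _).
    rewrite exchange_big/=; apply: eq_bigr => p _; rewrite -mulr_suml; congr (_ * _).
    have -> : nb%:R * (pow11 sel + pow22 sel) = \sum_(b < nb) (pow11 sel + pow22 sel).
      by rewrite sumr_const card_ord mulr_natl.
    rewrite /dv /dev -big_split/=.
    apply: eq_bigr => b _.
    rewrite (eq_bigr (fun i => gain1 (sel i) ^+ 2 * cw1 cb p.1 b ^+ 2 +
      gain1 (sel i) * gain2 (sel i) * (2 * cw1 cb p.1 b * cw2 cb p.2 b) +
      gain2 (sel i) ^+ 2 * cw2 cb p.2 b ^+ 2)); last by move=> i _; rewrite /u; ring.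
    by rewrite !big_split/= -!mulr_suml -/(pow11 sel) -/(pow12 sel) -/(pow22 sel); ring.
  rewrite (eq_bigr (fun p => dv p * cM + nb%:R * (pow11 sel + pow22 sel) * cM)); last by move=> p _; rewrite mulrDl.
  rewrite big_split/= sumr_const -[_ *+ #|_|]mulr_natl.
  rewrite (_ : #|_|%:R * (_ * cM) = nb%:R * (pow11 sel + pow22 sel)); first by ring.
  by rewrite mulrCA cM_card mulr1.
have n0 : (0 < n)%N by apply: leq_trans nbn; rewrite muln_gt0 nb0.
apply: (@le_trans _ _ ((n%:R)^-1%:E * (\sum_(t < n) G t)%:E)%E).
  rewrite lee_wpmul2l ?lee_fin ?invr_ge0// -sumEFin; apply: lee_sum => t _.
  exact: EXG.
rewrite -EFinM lee_fin sumG total ler_pdivrMl ?ltr0n//.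
(* The silent tail adds no power, so spending [P] on [nb * eta <= n] channel uses is enough. *)
apply: (@le_trans _ _ (nb%:R * (eta%:R * P))).
  apply: (@le_trans _ _ (nb%:R * (pow11 sel + pow22 sel + pow_noise sel + sk))).
    by rewrite [leRHS]mulrDr [leRHS]addrC lerD2r.
  by rewrite ler_wpM2l.
by rewrite mulrA -natrM ler_wpM2r// ler_nat.
Qed.

Variables (l1 l2 : 'rV[R]_eta) (g11 g12 g22 gam : R).
Hypotheses (h11 : (l1 *m a1) 0 0 = g11) (h12 : (l1 *m a2) 0 0 = g12)
  (h21 : (l2 *m a1) 0 0 = g12) (h22 : (l2 *m a2) 0 0 = g22).
Local Notation c1 := (stat_coef N s1 s2 rho B1 B2 l1).
Local Notation c2 := (stat_coef N s1 s2 rho B1 B2 l2).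
Hypotheses (c11 : \sum_p c1 p * c1 p = g11) (c12 : \sum_p c1 p * c2 p = g12)
  (c22 : \sum_p c2 p * c2 p = g22).
Hypothesis gam0 : 0 < gam.
Local Notation selL := (@lshift eta eta).
Local Notation selR := (@rshift eta eta).

(** If the letters do not reach this user's input, shrinking them frees no power, but then no
    deviation arises either. *)
Definition slack_ok sel (sk : R) : Prop :=
  0 < sk \/ [/\ pow11 sel = 0, pow12 sel = 0, pow22 sel = 0 & 0 <= sk].

Lemma inputs_lshift (h : seq (R * R)) b i : inputs h b (selL i) = (nth (0, 0) h (b * eta + i)).1.
Proof. by rewrite /inputs (unsplitK (inl i : 'I_eta + 'I_eta)). Qed.

Lemma inputs_rshift (h : seq (R * R)) b i : inputs h b (selR i) = (nth (0, 0) h (b * eta + i)).2.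
Proof. by rewrite /inputs (unsplitK (inr i : 'I_eta + 'I_eta)). Qed.

(** Jensen turns the averaged Chebyshev terms into the Chebyshev term of the averaged deviation;
    being below one, it bounds that deviation by the slack. *)
Lemma avg_dev_le sel sk (e : R) (cb : seq R) : slack_ok sel sk -> 2 * e < 1 ->
  let dv p := dev nb p.1 p.2 (pow11 sel) (pow12 sel) (pow22 sel) cb in
  \sum_(p : 'I_M1 * 'I_M2) sq_ratio nb (dv p) sk * cM <= 2 * e ->
  \sum_(p : 'I_M1 * 'I_M2) dv p * cM <= nb%:R * sk.
Proof.
move=> [sk0|[z1 z2 z3 sk0]] e1 dv h; last first.
  rewrite big1 ?mulr_ge0// => p _; rewrite /dv /dev z1 z2 z3 big1 ?mul0r// => b _.
  by rewrite !(mul0r, mulr0, addr0).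
set S := \sum_p _.
have : sq_ratio nb S sk < 1.
  apply: le_lt_trans e1; apply: le_trans h; rewrite /sq_ratio.
  rewrite (eq_bigr (fun p => dv p ^+ 2 * cM * (nb%:R * sk) ^- 2)); last by move=> p _; rewrite mulrAC.
  rewrite -mulr_suml ler_wpM2r ?invr_ge0 ?sqr_ge0//.
  by apply: sqr_avg_le; [exact: cM_ge0|exact: cM_card].
by move=> /(sq_ratio_lt1 nb0 sk0)/ltW; exact: le_trans (ler_norm _).
Qed.

Lemma good_code (P1 P2 sk1 sk2 e : R) :
  0 <= P1 -> 0 <= P2 -> 0 < e -> 2 * e < 1 ->
  slack_ok selL sk1 -> slack_ok selR sk2 ->
  pow11 selL + pow22 selL + pow_noise selL + sk1 <= eta%:R * P1 ->
  pow11 selR + pow22 selR + pow_noise selR + sk2 <= eta%:R * P2 ->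
  bad_bound nb M1 M2 g11 g12 g22 c1 c2 (pow11 selL) (pow12 selL) (pow22 selL)
    (pow11 selR) (pow12 selR) (pow22 selR) sk1 sk2 gam <= e ->
  exists (enc1 : 'I_M1 -> nat -> seq R -> R) (enc2 : 'I_M2 -> nat -> seq R -> R)
    (dec : n.-tuple R -> 'I_M1 * 'I_M2),
    is_code N s1 s2 rho enc1 enc2 dec P1 P2 /\
    (err_prob N s1 s2 rho enc1 enc2 dec <= (2 * e)%:E)%E.
Proof.
move=> P10 P20 e0 e1 ok1 ok2 hp1 hp2 hbound.
pose bd (p : 'I_M1 * 'I_M2) := bad n nb g11 g12 g22 c1 c2 (pow11 selL) (pow12 selL) (pow22 selL)
    (pow11 selR) (pow12 selR) (pow22 selR) sk1 sk2 gam p.1 p.2.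
pose Bad (x : seq R) := \sum_p bd p x * cM.
have bd0 p x : 0 <= bd p x by exact: bad_ge0.
have mbd p : mseqR (nvars n nb M1 M2) (bd p) by exact: mseqR_bad.
have EBad : (gE (nvars n nb M1 M2) (fun x => (Bad x)%:E) <= e%:E)%E.
  rewrite gE_avg ?cM_ge0//.
  apply: (@le_trans _ _ (cM%:E * \sum_(p : 'I_M1 * 'I_M2) e%:E)%E).
    rewrite lee_wpmul2l ?lee_fin ?cM_ge0//; apply: lee_sum => p _.
    by apply: le_trans (gE_bad nbn c11 c12 c22 _ _ _ _ _ _ _ _ _ _ _) _; rewrite lee_fin.
  by rewrite sumEFin sumr_const -EFinM lee_fin -[e *+ _]mulr_natl mulrA (mulrC cM) cM_card mul1r.
(* Separates the codebook from the noise: the former is fixed by averaging, the latter stays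
   random. *)
rewrite /nvars gE_cat in EBad.
have [cb szcb hcb] := gE_exists e0 EBad.
have mcb p : mseqR (n + (n + n)) (fun u => bd p (cb ++ u)).
  exact: (mseqR_cat szcb (mbd p)).
pose w0 : 'I_M1 * 'I_M2 := (Ordinal M10, Ordinal M20).
exists (cenc1 nb a1 B1 cb), (cenc2 nb M1 a2 B2 cb), (cdec nb B1 B2 cb l1 l2 g11 g12 g22 gam w0).
have dev_cat (p : 'I_M1 * 'I_M2) a11 a12 a22 u :
    dev nb p.1 p.2 a11 a12 a22 (cb ++ u) = dev nb p.1 p.2 a11 a12 a22 cb.
  by apply: eq_bigr => b _; rewrite !(th1_cat szcb)// !(th2_cat szcb).
(* The deviation depends on the codebook alone, so it equals its own expectation over the noise. *)
have dvle sel sk : (forall p x, sq_ratio nb (dev nb p.1 p.2 (pow11 sel) (pow12 sel) (pow22 sel) x) sk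
      <= bd p x) ->
    \sum_(p : 'I_M1 * 'I_M2) sq_ratio nb (dev nb p.1 p.2 (pow11 sel) (pow12 sel) (pow22 sel) cb) sk * cM
    <= 2 * e.
  move=> h; rewrite -lee_fin; apply: le_trans hcb.
  rewrite -(@gE_cst R (n + (n + n)) (_)%:E); last first.
    by rewrite lee_fin; apply: sumr_ge0 => p _; rewrite mulr_ge0 ?sq_ratio_ge0 ?cM_ge0.
  apply: le_gE => u; first by rewrite lee_fin; apply: sumr_ge0 => p _; rewrite mulr_ge0 ?sq_ratio_ge0 ?cM_ge0.
  move=> _; rewrite lee_fin; apply: ler_sum => p _; rewrite ler_wpM2r ?cM_ge0//.
  by apply: le_trans (h p (cb ++ u)); rewrite dev_cat.
have terms (p : 'I_M1 * 'I_M2) x := bad_terms_ge0 n nb g11 g12 g22 c1 c2 gam p.1 p.2 x.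
have sil w1 w2 (zs g1 g2 : n.-tuple R) t : (nb * eta <= t)%N -> (t < n)%N ->
    nth (0, 0) (run_hist N s1 s2 rho (cenc1 nb a1 B1 cb) (cenc2 nb M1 a2 B2 cb) w1 w2 zs g1 g2) t = (0, 0).
  by move=> tb tn; rewrite /run_hist nth_hist//= /cenc1 /cenc2 !lin_enc_silent.
have E0 : Enoise (fun zs g1 g2 : n.-tuple R => 0%E) = 0%E :> \bar R.
  by rewrite (Enoise_gE n (fun=> 0%E)) gE_cst.
split; first split; first split.
- exact: M10.
- exact: M20.
- by move=> w t; exact: measurable_lin_enc.
- by move=> w t; exact: measurable_lin_enc.
- by move=> ij; exact: measurable_cdec.
- split.
  + apply: (@power_sum cb _ selL sk1) => //.
    * move=> b i bn; rewrite /EX1sq; congr (_ * _)%E.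
      apply: eq_bigr => w1 _; apply: eq_bigr => w2 _; congr Enoise.
      by apply/funext => zs; apply/funext => g1; apply/funext => g2; rewrite inputs_lshift.
    * move=> t tb tn; rewrite /EX1sq big1 ?mule0// => w1 _; rewrite big1// => w2 _.
      rewrite -[RHS]E0; congr Enoise.
      by apply/funext => zs; apply/funext => g1; apply/funext => g2; rewrite sil//= expr0n.
    * apply: avg_dev_le e1 _ => //; apply: dvle => p x.
      have [? ? ?] := terms p x; rewrite /bd /bad -addrA [X in _ <= _ + X]addrC addrA.
      by rewrite lerDr !addr_ge0 ?sq_ratio_ge0.
  + apply: (@power_sum cb _ selR sk2) => //.
    * move=> b i bn; rewrite /EX2sq; congr (_ * _)%E.
      apply: eq_bigr => w1 _; apply: eq_bigr => w2 _; congr Enoise.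
      by apply/funext => zs; apply/funext => g1; apply/funext => g2; rewrite inputs_rshift.
    * move=> t tb tn; rewrite /EX2sq big1 ?mule0// => w1 _; rewrite big1// => w2 _.
      rewrite -[RHS]E0; congr Enoise.
      by apply/funext => zs; apply/funext => g1; apply/funext => g2; rewrite sil//= expr0n.
    * apply: avg_dev_le e1 _ => //; apply: dvle => p x.
      have [? ? ?] := terms p x; rewrite /bd /bad.
      by rewrite lerDr !addr_ge0 ?sq_ratio_ge0.
- apply: le_trans hcb; rewrite /err_prob sum_pairE gE_avg ?cM_ge0//.
  rewrite lee_wpmul2l ?lee_fin ?cM_ge0//; apply: lee_sum => -[w1 w2] _.
  rewrite -(Enoise_gE n (fun u => (bd (w1, w2) (cb ++ u))%:E)).
  apply: Enoise_le => zs g1 g2; first by rewrite lee_fin ler0n.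
  rewrite lee_fin; case: (boolP (_ != _)) => h; last exact: bd0.
  rewrite mulr1n /bd/=.
  by apply: decoding_error; eassumption.
Qed.

End GoodCode.

(** * Matched filters *)

Section Determinants.
Variable R : comUnitRingType.

(** Two block-triangular factorisations of one matrix. *)
Lemma det_sylvester k r (A : 'M[R]_(k, r)) (B : 'M[R]_(r, k)) :
  \det (1%:M + A *m B) = \det (1%:M + B *m A).
Proof.
pose M := block_mx 1%:M (- A) B 1%:M.
have e1 : M = block_mx 1%:M 0 B 1%:M *m block_mx 1%:M (- A) 0 (1%:M + B *m A).
  by rewrite mulmx_block !mul1mx !mul0mx !mulmx1 !addr0 mulmxN [- _ + _]addrC addrK.
have e2 : M = block_mx (1%:M + A *m B) (- A) 0 1%:M *m block_mx 1%:M 0 B 1%:M.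
  by rewrite mulmx_block !mul0mx !mulmx0 !mulmx1 mul1mx !add0r mulNmx addrK.
have := congr1 determinant e1; rewrite e2 !det_mulmx !det_ublock !det_lblock !det1.
by rewrite !mul1r !mulr1.
Qed.

(** Reduces a determinant ratio of the region to a determinant whose size is the number of users
    involved. *)
Lemma det_add_gram k r (K : 'M[R]_k) (U : 'M[R]_(k, r)) : K \in unitmx ->
  \det (U *m U^T + K) = \det K * \det (1%:M + U^T *m invmx K *m U).
Proof.
move=> uK; rewrite -mulmxA -(det_sylvester (invmx K *m U) U^T) -det_mulmx.
by rewrite mulmxDr mulmx1 addrC !mulmxA mulmxV// mul1mx.
Qed.

Lemma det_mx_1p1 (A : 'M[R]_(1 + 1)) :
  \det A = A (lshift 1 0) (lshift 1 0) * A (rshift 1 0) (rshift 1 0)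
         - A (lshift 1 0) (rshift 1 0) * A (rshift 1 0) (lshift 1 0).
Proof.
have l0 (x : 'I_1) : lift (lshift 1 (ord0 : 'I_1)) (x : 'I_(1 + 1).-1) = rshift 1 ord0 :> 'I_(1 + 1).
  by apply: val_inj; rewrite (ord1 x).
have l1 (x : 'I_1) : lift (rshift 1 (ord0 : 'I_1)) (x : 'I_(1 + 1).-1) = lshift 1 ord0 :> 'I_(1 + 1).
  by apply: val_inj; rewrite (ord1 x).
rewrite (expand_det_row A (lshift 1 0)) big_split_ord !big_ord1 /cofactor !det_mx11 !mxE.
rewrite !l0 !l1 /= expr0 expr1; ring.
Qed.

End Determinants.

(** * Filter gains and the input covariance *)

Section Filters.
Variables (R : realType) (m : nat) (N s1 s2 rho : R).
Local Notation eta := m.+1.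
Hypotheses (N0 : 0 < N) (rho1 : rho ^+ 2 <= 1).
Variables (B1 B2 : 'M[R]_eta).
Local Notation Q := (Qmat N s1 s2 rho B1 B2).
Local Notation scoef := (stat_coef N s1 s2 rho B1 B2).

Lemma Qmat_sym : Q^T = Q.
Proof.
have tD (A B : 'M[R]_eta) : (A + B)^T = A^T + B^T by apply/matrixP => i j; rewrite !mxE.
have tZ a (A : 'M[R]_eta) : (a *: A)^T = a *: A^T by apply/matrixP => i j; rewrite !mxE.
rewrite /Qmat !tD !tZ !tD tr_scalar_mx !trmx_mul !trmxK.
by rewrite [B2 *m B1^T + _]addrC.
Qed.

Lemma mul_tr_dot (u v : 'rV[R]_eta) : (u *m v^T) 0 0 = \sum_j u 0 j * v 0 j.
Proof. by rewrite mxE; apply: eq_bigr => j _; rewrite mxE. Qed.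

Lemma stat_coef_dot (l l' : 'rV[R]_eta) :
  \sum_p scoef l p * scoef l' p = (l *m Q *m l'^T) 0 0.
Proof.
rewrite noise_coef_dot ?(ltW N0)// /Qmat.
have e : l *m (N%:M + s1 ^+ 2 *: (B1 *m B1^T) + s2 ^+ 2 *: (B2 *m B2^T)
  + (rho * s1 * s2) *: (B1 *m B2^T + B2 *m B1^T)) *m l'^T =
  N *: (l *m l'^T) + s1 ^+ 2 *: ((l *m B1) *m (l' *m B1)^T) +
  s2 ^+ 2 *: ((l *m B2) *m (l' *m B2)^T) +
  (rho * s1 * s2) *: ((l *m B1) *m (l' *m B2)^T + (l *m B2) *m (l' *m B1)^T).
  rewrite !mulmxDr !mulmxDl -!scalemxAr -!scalemxAl !mulmxDr !mulmxDl mul_mx_scalar -scalemxAl.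
  by rewrite !trmx_mul !mulmxA.
have addE (A B : 'M[R]_1) : (A + B) 0 0 = A 0 0 + B 0 0 by rewrite mxE.
have scaleE a (A : 'M[R]_1) : (a *: A) 0 0 = a * A 0 0 by rewrite mxE.
by rewrite e !addE !scaleE !addE !mul_tr_dot big_split.
Qed.

(** The weights on [Z] contribute the left side; what [W_1] and [W_2] add is a sum of squares. *)
Lemma Qmat_form_ge (y : 'rV[R]_eta) : N * \sum_j y 0 j ^+ 2 <= (y *m Q *m y^T) 0 0.
Proof.
rewrite -stat_coef_dot.
rewrite (@sum_I3 R m _ (fun i j => scoef y (inord i, j) ^+ 2)); last first.
  by move=> [i j] /=; rewrite inord_val expr2.
rewrite -addrA mulr_sumr -[leLHS]addr0; apply: lerD.
  by apply: ler_sum => j _; rewrite /stat_coef /noise_coef /= inordK// exprMn sqr_sqrtr// ltW.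
by rewrite addr_ge0//; apply: sumr_ge0 => j _; exact: sqr_ge0.
Qed.

(** A null vector [v] makes the noise form vanish at [v *m c]; positivity of [N] forces
    [v *m c = 0], against the nonsingularity of [c *m c^T]. *)
Lemma filtered_noise_unit k (c : 'M[R]_(k, eta)) : \det (c *m c^T) != 0 ->
  c *m Q *m c^T \in unitmx.
Proof.
move=> dc; rewrite unitmxE unitfE; apply/negP => /det0P[v v0 vK].
have y0 : v *m c = 0.
  have := Qmat_form_ge (v *m c).
  have -> : v *m c *m Q *m (v *m c)^T = 0.
    transitivity (v *m (c *m Q *m c^T) *m v^T); first by rewrite trmx_mul !mulmxA.
    by rewrite vK mul0mx.
  rewrite mxE => h; have : \sum_j (v *m c) 0 j ^+ 2 <= 0 by rewrite -(pmulr_rle0 _ N0).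
  move=> h0; have : \sum_j (v *m c) 0 j ^+ 2 == 0.
    by rewrite eq_le h0 sumr_ge0// => j _; exact: sqr_ge0.
  rewrite psumr_eq0; last by move=> j _; exact: sqr_ge0.
  move=> /allP a; apply/matrixP => i j; rewrite ord1 [RHS]mxE.
  by have := a j; rewrite mem_index_enum sqrf_eq0 => /(_ isT)/eqP.
move/negP: dc; apply; apply/det0P; exists v => //.
by rewrite mulmxA y0 mul0mx.
Qed.

Variables (a1 a2 : 'cV[R]_eta).

Lemma matched_filters k (c : 'M[R]_(k, eta)) (r : R * R) : \det (c *m c^T) != 0 ->
  region_c c a1 a2 Q r ->
  exists (l1 l2 : 'rV[R]_eta) (g11 g12 g22 : R),
  [/\ [/\ (l1 *m a1) 0 0 = g11, (l1 *m a2) 0 0 = g12, (l2 *m a1) 0 0 = g12 & (l2 *m a2) 0 0 = g22],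
      [/\ \sum_p scoef l1 p * scoef l1 p = g11, \sum_p scoef l1 p * scoef l2 p = g12
        & \sum_p scoef l2 p * scoef l2 p = g22]
    & [/\ eta%:R * r.1 <= ln (1 + g11) / 2, eta%:R * r.2 <= ln (1 + g22) / 2
        & eta%:R * (r.1 + r.2) <= ln ((1 + g11) * (1 + g22) - g12 ^+ 2) / 2]].
Proof.
move=> dc [_ _ r1 r2 r12].
have uK := filtered_noise_unit dc; set K := c *m Q *m c^T in uK.
have symK : (invmx K)^T = invmx K.
  by rewrite trmx_inv /K !trmx_mul trmxK Qmat_sym mulmxA.
pose Gm := c^T *m invmx K *m c.
have symG : Gm^T = Gm by rewrite /Gm !trmx_mul trmxK symK mulmxA.
(* This identity is what makes the noise covariance of the statistics equal to their signal
   gains. *)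
have GQG : Gm *m Q *m Gm = Gm.
  rewrite /Gm !mulmxA -(mulmxA _ c Q) -(mulmxA _ (c *m Q)) -/K.
  by rewrite -(mulmxA (c^T) (invmx K) K) mulVmx// mulmx1.
pose l1 := a1^T *m Gm; pose l2 := a2^T *m Gm.
have lQ (b b' : 'cV[R]_eta) : b^T *m Gm *m Q *m (b'^T *m Gm)^T = b^T *m Gm *m b'.
  transitivity (b^T *m (Gm *m Q *m Gm) *m b'); last by rewrite GQG.
  by rewrite trmx_mul trmxK symG !mulmxA.
have sym12 : (l2 *m a1) 0 0 = (l1 *m a2) 0 0.
  have -> : l2 *m a1 = (l1 *m a2)^T.
    by rewrite /l1 /l2 (trmx_mul (a1^T *m Gm)) (trmx_mul a1^T) trmxK symG mulmxA.
  by rewrite mxE.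
exists l1, l2, ((l1 *m a1) 0 0), ((l1 *m a2) 0 0), ((l2 *m a2) 0 0); split.
- by split.
- by split; rewrite stat_coef_dot lQ.
(* Used three times: [H] is [a1], [a2] or the pair of both. *)
have ratio p (H : 'M[R]_(eta, p)) :
    \det (c *m (H *m H^T + Q) *m c^T) / \det (c *m Q *m c^T) = \det (1%:M + H^T *m Gm *m H).
  rewrite -/K.
  have -> : c *m (H *m H^T + Q) *m c^T = (c *m H) *m (c *m H)^T + K.
    by rewrite mulmxDr mulmxDl trmx_mul !mulmxA.
  rewrite det_add_gram// mulrAC divff ?mul1r; last by rewrite -unitfE -unitmxE.
  by rewrite trmx_mul /Gm !mulmxA.
have eta0 : (0 : R) < eta%:R by rewrite ltr0n.
have scale x y : x <= ((2 * eta)%:R)^-1 * y -> eta%:R * x <= y / 2 :> R.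
  move=> h; have := ler_wpM2l (ltW eta0) h.
  rewrite (_ : eta%:R * (((2 * eta)%:R)^-1 * y) = y / 2)// natrM; field.
  by rewrite gt_eqF.
move: r1 r2 r12; rewrite /rate_bd !ratio !det_mx11 => r1 r2 r12; split.
- by apply: scale; move: r1; rewrite mxE mxE eqxx.
- by apply: scale; move: r2; rewrite mxE mxE eqxx.
apply: scale; move: r12; rewrite det_mx_1p1 tr_row_mx mul_col_mx mul_col_row.
set M := block_mx _ _ _ _.
have dE i j : (1%:M + M) i j = (i == j)%:R + M i j by rewrite !mxE.
rewrite !dE !eqxx /M block_mxEul block_mxEdr block_mxEur block_mxEdl.
rewrite -/l1 -/l2 sym12 (_ : lshift 1 0 == rshift 1 0 = false)//.
by rewrite (_ : rshift 1 0 == lshift 1 0 = false)// !add0r expr2.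
Qed.

Hypotheses (lo1 : strictly_lower B1) (lo2 : strictly_lower B2).

(** [SigmaX] is the covariance of the stacked inputs driven by standard normal letters, so a
    diagonal entry is the sum of squared coefficients on independent normals. *)
Lemma SigmaX_diag k : SigmaX N s1 s2 rho a1 a2 B1 B2 k k =
  gain1 a1 a2 B1 B2 k ^+ 2 + gain2 a1 a2 B1 B2 k ^+ 2 + \sum_p input_coef N s1 s2 rho B1 B2 k p ^+ 2.
Proof.
under [X in _ = _ + X]eq_bigr do rewrite expr2.
rewrite /input_coef noise_coef_dot ?(ltW N0)//.
pose X : 'M[R]_(eta + eta, eta) := col_mx B1 0; pose Y : 'M[R]_(eta + eta, eta) := col_mx 0 B2.
set T := invmx (loop_mx B1 B2).
have eB : block_mx B1 0 0 B2 = row_mx X Y by rewrite block_mxEh.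
have e : SigmaX N s1 s2 rho a1 a2 B1 B2 =
  msg_gain a1 a2 B1 B2 *m (msg_gain a1 a2 B1 B2)^T + N *: (Z_gain B1 B2 *m (Z_gain B1 B2)^T) +
  (s1 ^+ 2 *: (W1_gain B1 B2 *m (W1_gain B1 B2)^T) + s2 ^+ 2 *: (W2_gain B1 B2 *m (W2_gain B1 B2)^T)
   + (rho * s1 * s2) *: (W1_gain B1 B2 *m (W2_gain B1 B2)^T + W2_gain B1 B2 *m (W1_gain B1 B2)^T)).
  rewrite /SigmaX eB /msg_gain /Z_gain /W1_gain /W2_gain -/X -/Y -/(loop_mx B1 B2) -/T.
  rewrite !mulmxDr !mulmxDl; congr (_ + _ + _).
  - by rewrite trmx_mul !mulmxA.
  - by rewrite -scalemxAr -scalemxAl trmx_mul !mulmxA.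
  rewrite mul_row_block tr_row_mx mul_row_col !mul_mx_scalar !mulmxDl -!scalemxAl.
  rewrite !mulmxDr !mulmxDl -!scalemxAr -!scalemxAl !trmx_mul !scalerDr !mulmxA.
  by rewrite [X in _ + X = _]addrC addrACA; congr (_ + _); rewrite addrC.
have addE (A B : 'M[R]_(eta + eta)) : (A + B) k k = A k k + B k k by rewrite mxE.
have scaleE a (A : 'M[R]_(eta + eta)) : (a *: A) k k = a * A k k by rewrite mxE.
have dotE p (A B : 'M[R]_(eta + eta, p)) : (A *m B^T) k k = \sum_j A k j * B k j.
  by rewrite mxE; apply: eq_bigr => j _; rewrite mxE.
rewrite e !addE !scaleE !addE !dotE big_split_ord !big_ord1 !expr2 -!addrA; congr (_ + (_ + (_ + (_ + (_ + _ * _))))).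
by rewrite big_split.
Qed.

Lemma SigmaX_power :
  \tr (ulsubmx (SigmaX N s1 s2 rho a1 a2 B1 B2)) =
    pow11 a1 a2 B1 B2 (@lshift eta eta) + pow22 a1 a2 B1 B2 (@lshift eta eta) +
    pow_noise N s1 s2 rho B1 B2 (@lshift eta eta) /\
  \tr (drsubmx (SigmaX N s1 s2 rho a1 a2 B1 B2)) =
    pow11 a1 a2 B1 B2 (@rshift eta eta) + pow22 a1 a2 B1 B2 (@rshift eta eta) +
    pow_noise N s1 s2 rho B1 B2 (@rshift eta eta).
Proof.
split; rewrite /mxtrace /pow11 /pow22 /pow_noise -!big_split/=; apply: eq_bigr => i _.
  by rewrite [LHS]mxE [LHS]mxE SigmaX_diag.
by rewrite [LHS]mxE [LHS]mxE SigmaX_diag.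
Qed.

End Filters.

(** * Achievability *)

Section Scaling.
Variables (R : realType) (m : nat) (a1 a2 : 'cV[R]_m.+1) (B1 B2 : 'M[R]_m.+1) (k : R).
Local Notation eta := m.+1.

Lemma msg_gain_scale : msg_gain (k *: a1) (k *: a2) B1 B2 = k *: msg_gain a1 a2 B1 B2.
Proof.
rewrite /msg_gain [RHS]scalemxAr; congr (_ *m _).
by rewrite scale_block_mx !scaler0.
Qed.

Lemma pow_scale sel : [/\ pow11 (k *: a1) (k *: a2) B1 B2 sel = k ^+ 2 * pow11 a1 a2 B1 B2 sel,
  pow12 (k *: a1) (k *: a2) B1 B2 sel = k ^+ 2 * pow12 a1 a2 B1 B2 sel &
  pow22 (k *: a1) (k *: a2) B1 B2 sel = k ^+ 2 * pow22 a1 a2 B1 B2 sel].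
Proof.
have e j u : gain (k *: a1) (k *: a2) B1 B2 u j = k * gain a1 a2 B1 B2 u j.
  by rewrite /gain msg_gain_scale mxE.
split; rewrite /pow11 /pow12 /pow22 mulr_sumr; apply: eq_bigr => i _;
  rewrite /gain1 /gain2 !e; ring.
Qed.

(** Shrinking the letters by [k] frees this much power. If it is zero, both gains vanish on the
    selected rows, and the cross term with them. *)
Lemma slack_ok_scale sel : 0 <= k -> k < 1 ->
  slack_ok (k *: a1) (k *: a2) B1 B2 sel
    ((1 - k ^+ 2) * (pow11 a1 a2 B1 B2 sel + pow22 a1 a2 B1 B2 sel)).
Proof.
move=> k0 k1; have [e1 e2 e3] := pow_scale sel.
have p1 : 0 <= pow11 a1 a2 B1 B2 sel by apply: sumr_ge0 => i _; exact: sqr_ge0.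
have p2 : 0 <= pow22 a1 a2 B1 B2 sel by apply: sumr_ge0 => i _; exact: sqr_ge0.
have q1 : 0 < 1 - k ^+ 2 by rewrite subr_gt0 expr_lt1.
rewrite /slack_ok e1 e2 e3.
have := addr_ge0 p1 p2; rewrite le_eqVlt => /orP[/eqP p0|p0]; last by left; rewrite mulr_gt0.
right; have /andP[/eqP z1 /eqP z2] : (pow11 a1 a2 B1 B2 sel == 0) && (pow22 a1 a2 B1 B2 sel == 0).
  by rewrite -paddr_eq0// -p0.
rewrite z1 z2 addr0 !mulr0; split => //.
rewrite /pow12 big1 ?mulr0// => i _.
have : gain1 a1 a2 B1 B2 (sel i) ^+ 2 == 0.
  have /eqP := z1; rewrite psumr_eq0; last by move=> j _; exact: sqr_ge0.
  by move=> /allP/(_ i); rewrite mem_index_enum; apply.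
by rewrite sqrf_eq0 => /eqP ->; rewrite mul0r.
Qed.

Lemma stat_coef_scale N s1 s2 rho (l : 'rV[R]_eta) p :
  stat_coef N s1 s2 rho B1 B2 (k *: l) p = k * stat_coef N s1 s2 rho B1 B2 l p.
Proof.
rewrite /stat_coef /noise_coef -!scalemxAl; case: (nat_of_ord p.1) => [|[|j]]; rewrite !mxE; ring.
Qed.

Lemma stat_coef_dot_scale N s1 s2 rho (l l' : 'rV[R]_eta) :
  \sum_p stat_coef N s1 s2 rho B1 B2 (k *: l) p * stat_coef N s1 s2 rho B1 B2 (k *: l') p =
  k ^+ 2 * \sum_p stat_coef N s1 s2 rho B1 B2 l p * stat_coef N s1 s2 rho B1 B2 l' p.
Proof.
by rewrite mulr_sumr; apply: eq_bigr => p _; rewrite !stat_coef_scale; ring.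
Qed.

End Scaling.

(** * Estimates for growing blocklength *)

Section Asymptotics.
Variable R : realType.

(** The at most [eta] leftover channel uses cost a constant factor, and
    [expR (- (nb * gam)) <= 1 / (nb * gam)] gives the term the same [1 / nb] form as the Chebyshev
    terms. *)
Lemma exp_tail (n nb eta : nat) (rho X gam : R) : (0 < nb)%N -> 0 < gam ->
  (nb * eta <= n)%N -> (n <= nb * eta + eta)%N -> eta%:R * rho + gam <= X ->
  expR (n%:R * rho) * expR (- (nb%:R * X)) <= expR (eta%:R * `|rho|) / gam / nb%:R.
Proof.
move=> nb0 gam0 h1 h2 hX.
have nbR : (0 : R) < nb%:R by rewrite ltr0n.
have e : n%:R = nb%:R * eta%:R + (n - nb * eta)%:R :> R by rewrite natrB// natrM addrC subrK.
have d : (n - nb * eta)%:R <= eta%:R :> R by rewrite ler_nat; lia.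
have d0 : 0 <= (n - nb * eta)%:R :> R by [].
have hr : (n - nb * eta)%:R * rho <= eta%:R * `|rho|.
  apply: (le_trans (ler_norm _)); rewrite normrM (ger0_norm d0).
  by rewrite ler_wpM2r.
have hn : n%:R * rho - nb%:R * X <= eta%:R * `|rho| - nb%:R * gam.
  rewrite e mulrDl; have := ler_wpM2l (ltW nbR) hX; rewrite mulrDr mulrA; lra.
rewrite -expRD; apply: (@le_trans _ _ (expR (eta%:R * `|rho| - nb%:R * gam))).
  by rewrite ler_expR.
rewrite expRD -!mulrA ler_wpM2l ?expR_ge0// -invfM expRN lef_pV2 ?posrE ?expR_gt0 ?mulr_gt0//.
by apply: le_trans (expR_ge1Dx _); rewrite mulrC lerDr.
Qed.

Lemma truncn_bounds (x : R) : 0 <= x ->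
  (Num.truncn x)%:R <= x /\ x < (Num.truncn x).+1%:R.
Proof. by move=> x0; split; [rewrite truncn_le|rewrite truncnS_gt]. Qed.

(** From [q * (1 + g) <= 1 + q * g]: lowering the power of the letters by [q] costs at most
    [- ln q]. *)
Lemma ln1_scale (g q : R) : 0 <= g -> 0 < q -> q <= 1 ->
  ln (1 + g) + ln q <= ln (1 + q * g).
Proof.
move=> g0 q0 q1; have g1 : 0 < 1 + g by rewrite ltr_pwDl.
have qg : 0 <= q * g by rewrite mulr_ge0// ltW.
have g1' : 0 < 1 + q * g by rewrite ltr_pwDl.
rewrite -lnM ?posrE// ler_ln ?posrE ?mulr_gt0//.
by rewrite mulrDl mul1r (mulrC g) lerD2r.
Qed.

Lemma ln_truncnS_gt (n : nat) (x delta : R) : (0 < n)%N -> 0 < delta ->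
  x - delta < ln ((Num.truncn (expR (n%:R * (x - delta / 2)))).+1%:R) / n%:R.
Proof.
move=> n0 d0; have nR : (0 : R) < n%:R by rewrite ltr0n.
apply: (@lt_trans _ _ (x - delta / 2)); first lra.
rewrite ltr_pdivlMr// mulrC; set y := n%:R * _.
rewrite -ltr_expR lnK ?posrE ?ltr0n//.
by have [] := truncn_bounds (expR_ge0 y).
Qed.

Lemma form_norm_ge0 eta (a : bvar eta -> bvar eta -> R) : 0 <= form_norm a.
Proof.
by rewrite mulr_ge0//; apply: sumr_ge0 => u _; apply: sumr_ge0 => v _; exact: sqr_ge0.
Qed.

Lemma cvg_le_over_blocks (f : nat -> \bar R) (K : R) (eta n0 : nat) : (0 < eta)%N -> (0 < n0)%N -> 0 <= K ->
  (forall n, 0 <= f n)%E ->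
  (forall n, (n0 * eta <= n)%N -> (f n <= (K / (n %/ eta)%:R)%:E)%E) ->
  f @ \oo --> 0%E.
Proof.
move=> eta0 n00 K0 f0 fK.
apply: (@squeeze_cvge _ _ _ _ (fun=> 0%E) _ (fun n => (4 * eta%:R * K * harmonic n)%:E)).
- near=> n; rewrite f0 /=.
  have hn : (n0 * eta <= n)%N by near: n; exact: nbhs_infty_ge.
  apply: (le_trans (fK n hn)); rewrite lee_fin /harmonic.
  have nb0 : (0 < n %/ eta)%N by rewrite divn_gt0//; nia.
  rewrite (_ : 4 * eta%:R * K / n.+1%:R = K * ((4 * eta)%:R / n.+1%:R)); last by rewrite natrM; ring.
  rewrite ler_wpM2l// ler_pdivlMr ?ltr0n// mulrC ler_pdivrMr ?ltr0n// -natrM ler_nat.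
  by have := divn_eq n eta; have := ltn_pmod n eta0; nia.
- exact: cvg_cst.
- apply: cvg_EFin; first exact: nearW.
  by rewrite -[X in _ --> X](mulr0 (4 * eta%:R * K)); apply: cvgMr; exact: cvg_harmonic.
Unshelve. all: by end_near. Qed.

End Asymptotics.

(** * Codes for one linear scheme *)

Section Achievability.
Variables (R : realType) (m : nat) (P1 P2 N s1 s2 rho : R).
Local Notation eta := m.+1.
Hypotheses (P10 : 0 < P1) (P20 : 0 < P2) (N0 : 0 < N) (rho1 : rho ^+ 2 <= 1).
Variables (a1 a2 : 'cV[R]_eta) (B1 B2 : 'M[R]_eta).
Hypotheses (lo1 : strictly_lower B1) (lo2 : strictly_lower B2).
Hypothesis pow : power_ok P1 P2 N s1 s2 rho a1 a2 B1 B2.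
Variables (l1 l2 : 'rV[R]_eta) (g11 g12 g22 : R) (r : R * R).
Local Notation scoef := (stat_coef N s1 s2 rho B1 B2).
Hypotheses (h11 : (l1 *m a1) 0 0 = g11) (h12 : (l1 *m a2) 0 0 = g12)
  (h21 : (l2 *m a1) 0 0 = g12) (h22 : (l2 *m a2) 0 0 = g22).
Hypotheses (c11 : \sum_p scoef l1 p * scoef l1 p = g11) (c12 : \sum_p scoef l1 p * scoef l2 p = g12)
  (c22 : \sum_p scoef l2 p * scoef l2 p = g22).
Hypotheses (r1 : eta%:R * r.1 <= ln (1 + g11) / 2) (r2 : eta%:R * r.2 <= ln (1 + g22) / 2)
  (r12 : eta%:R * (r.1 + r.2) <= ln ((1 + g11) * (1 + g22) - g12 ^+ 2) / 2).

Lemma filters_achievable : achievable P1 P2 N s1 s2 rho r.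
Proof.
move=> delta delta0.
(* Per block, lowering each rate by [delta / 2] frees [8 * gam] for one user and [16 * gam] for the
   sum. Shrinkage, threshold margins and the final decay together use at most [4 * gam]. *)
pose gam := eta%:R * delta / 16.
have eta0 : (0 : R) < eta%:R by rewrite ltr0n.
have gam0 : 0 < gam by rewrite divr_gt0 ?mulr_gt0.
(* Amplitude factor of the letters, chosen so that the power factor [q] has [ln q = - gam]. *)
pose k := expR (- gam / 2).
pose q := k ^+ 2.
have k0 : 0 < k by exact: expR_gt0.
have k1 : k < 1 by rewrite expR_lt1; lra.
have q0 : 0 < q by rewrite exprn_gt0.
have q1 : q < 1 by rewrite expr_lt1 ?ltW.
have lnq : ln q = - gam.
  by rewrite /q /k -expRM_natr divfK// expRK.
have g11p : 0 <= g11 by exact: g11_ge0 c11.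
have g22p : 0 <= g22 by exact: g22_ge0 c22.
pose G11 := q * g11; pose G12 := q * g12; pose G22 := q * g22.
(* Filters and gain vectors are both scaled by [k]: signal gains and noise covariances acquire the
   same factor [q] and stay equal. *)
pose L1 := k *: l1; pose L2 := k *: l2; pose A1 := k *: a1; pose A2 := k *: a2.
have lin (l : 'rV[R]_eta) (a : 'cV[R]_eta) : ((k *: l) *m (k *: a)) 0 0 = q * (l *m a) 0 0.
  by rewrite -scalemxAl -scalemxAr scalerA mxE /q expr2.
have H11 : (L1 *m A1) 0 0 = G11 by rewrite lin h11.
have H12 : (L1 *m A2) 0 0 = G12 by rewrite lin h12.
have H21 : (L2 *m A1) 0 0 = G12 by rewrite lin h21.
have H22 : (L2 *m A2) 0 0 = G22 by rewrite lin h22.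
have C11 : \sum_p scoef L1 p * scoef L1 p = G11 by rewrite stat_coef_dot_scale c11.
have C12 : \sum_p scoef L1 p * scoef L2 p = G12 by rewrite stat_coef_dot_scale c12.
have C22 : \sum_p scoef L2 p * scoef L2 p = G22 by rewrite stat_coef_dot_scale c22.
pose rho1' := r.1 - delta / 2; pose rho2' := r.2 - delta / 2.
have G11p : 0 <= G11 by exact: g11_ge0 C11.
have G22p : 0 <= G22 by exact: g22_ge0 C22.
have G3p : 0 <= g3 G11 G12 G22 by exact: (g3_ge0 C11 C12 C22).
have I1 : eta%:R * rho1' + gam <= rate1 G11 - gam.
  have := ln1_scale g11p q0 (ltW q1); rewrite lnq /rate1 -/G11 => h.
  by rewrite /rho1' mulrBr; move: r1 h gam0; rewrite /gam; lra.
have I2 : eta%:R * rho2' + gam <= rate2 G22 - gam.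
  have := ln1_scale g22p q0 (ltW q1); rewrite lnq /rate2 -/G22 => h.
  by rewrite /rho2' mulrBr; move: r2 h gam0; rewrite /gam; lra.
have I3 : eta%:R * (rho1' + rho2') + gam <= rate2 G22 - gam + (rate3 G11 G12 G22 - gam).
  (* The chain-rule rates add up to the joint one by the Schur complement identity for
     [det (1 + g)]. *)
  have e3 : rate2 G22 + rate3 G11 G12 G22 = ln ((1 + G11) * (1 + G22) - G12 ^+ 2) / 2.
    have p22 : 0 < 1 + G22 by rewrite ltr_pwDl.
    rewrite /rate2 /rate3 -mulrDl -lnM ?posrE// ?ltr_pwDl//; congr (ln _ / 2).
    by rewrite /g3 /mmse_coef; field; rewrite lt0r_neq0.
  have det0 : 0 < (1 + g11) * (1 + g22) - g12 ^+ 2.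
    have g3p := g3_ge0 c11 c12 c22; have p22 : 0 < 1 + g22 by rewrite ltr_pwDl.
    have -> : (1 + g11) * (1 + g22) - g12 ^+ 2 = (1 + g22) * (1 + g3 g11 g12 g22).
      by rewrite /g3 /mmse_coef; field; rewrite lt0r_neq0.
    by rewrite mulr_gt0// ltr_pwDl.
  have h : ln ((1 + g11) * (1 + g22) - g12 ^+ 2) - 2 * gam <= ln ((1 + G11) * (1 + G22) - G12 ^+ 2).
    have -> : - (2 * gam) = ln (q ^+ 2).
      by rewrite /q /k -!expRM_natr expRK; field.
    have q20 : 0 < q ^+ 2 by rewrite exprn_gt0.
    have le : ((1 + g11) * (1 + g22) - g12 ^+ 2) * q ^+ 2 <= (1 + G11) * (1 + G22) - G12 ^+ 2.
      rewrite /G11 /G12 /G22 -subr_ge0.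
      have -> : (1 + q * g11) * (1 + q * g22) - (q * g12) ^+ 2
         - ((1 + g11) * (1 + g22) - g12 ^+ 2) * q ^+ 2 = (1 - q) * (1 + q + q * (g11 + g22)) by ring.
      have qg : 0 <= q * (g11 + g22) by rewrite mulr_ge0 ?addr_ge0// ltW.
      by rewrite mulr_ge0 ?subr_ge0 ?(ltW q1)// addr_ge0// ltW// addr_gt0.
    rewrite -lnM ?posrE// ler_ln ?posrE ?mulr_gt0//.
    by apply: lt_le_trans le; rewrite mulr_gt0.
  have -> : rate2 G22 - gam + (rate3 G11 G12 G22 - gam) = rate2 G22 + rate3 G11 G12 G22 - 2 * gam by ring.
  rewrite e3 /rho1' /rho2'; move: r12 h gam0; rewrite /gam !mulrDr !mulrN; lra.
pose selL := @lshift eta eta; pose selR := @rshift eta eta.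
(* The power freed by the shrinkage becomes the slack for random deviations. *)
pose sk sel := (1 - q) * (pow11 a1 a2 B1 B2 sel + pow22 a1 a2 B1 B2 sel).
have [pwL pwR] := pow; rewrite (SigmaX_power s1 s2 N0 rho1 B1 B2 a1 a2).1 in pwL.
rewrite (SigmaX_power s1 s2 N0 rho1 B1 B2 a1 a2).2 in pwR.
have okL : slack_ok A1 A2 B1 B2 selL (sk selL) by apply: slack_ok_scale; rewrite ?ltW.
have okR : slack_ok A1 A2 B1 B2 selR (sk selR) by apply: slack_ok_scale; rewrite ?ltW.
have powE sel P : pow11 a1 a2 B1 B2 sel + pow22 a1 a2 B1 B2 sel + pow_noise N s1 s2 rho B1 B2 sel
     <= eta%:R * P ->
   pow11 A1 A2 B1 B2 sel + pow22 A1 A2 B1 B2 sel + pow_noise N s1 s2 rho B1 B2 sel + sk sel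
     <= eta%:R * P.
  apply: le_trans; have [-> _ ->] := pow_scale a1 a2 B1 B2 k sel.
  by rewrite /sk -/q le_eqVlt; apply/orP; left; apply/eqP; ring.
pose F1 := form_norm (infod_form G11 (@ev1 R eta) (evn (scoef L1))).
pose F2 := form_norm (infod_form G22 (@ev2 R eta) (evn (scoef L2))).
pose F3 := form_norm (infod_form (g3 G11 G12 G22) (@ev1 R eta) (cvec3 G12 G22 (scoef L1) (scoef L2))).
pose FP sel := form_norm (power_form (pow11 A1 A2 B1 B2 sel) (pow12 A1 A2 B1 B2 sel)
   (pow22 A1 A2 B1 B2 sel) : bvar eta -> bvar eta -> R).
pose C := F1 * gam ^- 2 + F2 * gam ^- 2 + F3 * gam ^- 2 +
  expR (eta%:R * `|rho1'|) / gam + expR (eta%:R * `|rho2'|) / gam +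
  expR (eta%:R * `|rho1' + rho2'|) / gam + FP selL * (sk selL) ^- 2 + FP selR * (sk selR) ^- 2.
have C0 : 0 <= C.
  have s0 (x y : R) : 0 <= x -> 0 <= x * y ^- 2 by move=> ?; rewrite mulr_ge0// invr_ge0 sqr_ge0.
  by rewrite /C !addr_ge0 ?s0 ?form_norm_ge0// divr_ge0 ?expR_ge0 ?ltW.
(* Floor plus one keeps the message set nonempty and meets the rate, while the number of wrong
   messages stays at most [expR (n%:R * rho1')]. *)
pose M1 n := (Num.truncn (expR (n%:R * rho1'))).+1.
pose M2 n := (Num.truncn (expR (n%:R * rho2'))).+1.
(* Ensures [2 * (C + 1) / nb < 1] as soon as [nb >= n0]; the added one keeps the error bound
   positive. *)
pose n0 := (Num.truncn (2 * (C + 1))).+1.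
have boundC n : (n0 * eta <= n)%N ->
  bad_bound (n %/ eta) (M1 n) (M2 n) G11 G12 G22 (scoef L1) (scoef L2)
    (pow11 A1 A2 B1 B2 selL) (pow12 A1 A2 B1 B2 selL) (pow22 A1 A2 B1 B2 selL)
    (pow11 A1 A2 B1 B2 selR) (pow12 A1 A2 B1 B2 selR) (pow22 A1 A2 B1 B2 selR)
    (sk selL) (sk selR) gam <= (C + 1) / (n %/ eta)%:R.
  move=> hn; set nb := (n %/ eta)%N.
  have nb0 : (0 < nb)%N by rewrite divn_gt0// (leq_trans _ hn)// leq_pmull.
  have nbR : (0 : R) < nb%:R by rewrite ltr0n.
  have nbn : (nb * eta <= n)%N by rewrite leq_trunc_div.
  have nbn' : (n <= nb * eta + eta)%N by rewrite {1}(divn_eq n eta) leq_add2l ltnW// ltn_pmod.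
  have sqE (F s : R) : nb%:R * F * (nb%:R * s) ^- 2 = F * s ^- 2 / nb%:R.
    by rewrite exprMn invfM; move: (s ^- 2) => v; field; rewrite gt_eqF.
  have tr (x : R) : (Num.truncn (expR x))%:R <= expR x by have [] := truncn_bounds (expR_ge0 x).
  have t1 : (M1 n).-1%:R * (1 * expR (- thr nb gam (rate1 G11))) <= expR (eta%:R * `|rho1'|) / gam / nb%:R.
    apply: le_trans (exp_tail nb0 gam0 nbn nbn' I1).
    by rewrite mul1r /thr ler_wpM2r ?expR_ge0//; exact: tr.
  have t2 : (M2 n).-1%:R * (1 * expR (- thr nb gam (rate2 G22))) <= expR (eta%:R * `|rho2'|) / gam / nb%:R.
    apply: le_trans (exp_tail nb0 gam0 nbn nbn' I2).
    by rewrite mul1r /thr ler_wpM2r ?expR_ge0//; exact: tr.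
  have t3 : (M1 n).-1%:R * ((M2 n).-1%:R * (1 * expR (- (thr nb gam (rate2 G22) + thr nb gam (rate3 G11 G12 G22)))))
      <= expR (eta%:R * `|rho1' + rho2'|) / gam / nb%:R.
    apply: le_trans (exp_tail nb0 gam0 nbn nbn' I3).
    rewrite mul1r mulrA /thr -mulrDr ler_wpM2r ?expR_ge0//.
    by rewrite mulrDr expRD ler_pM//; exact: tr.
  rewrite /bad_bound !sqE -/F1 -/F2 -/F3 -/(FP selL) -/(FP selR).
  apply: (@le_trans _ _ (C / nb%:R)); last by rewrite ler_wpM2r ?invr_ge0// lerDl.
  by rewrite /C !mulrDl !lerD.
have exists_code n : exists x : ('I_(M1 n) -> nat -> seq R -> R) *
    ('I_(M2 n) -> nat -> seq R -> R) * (n.-tuple R -> 'I_(M1 n) * 'I_(M2 n)),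
    (n0 * eta <= n)%N -> is_code N s1 s2 rho x.1.1 x.1.2 x.2 P1 P2 /\
    (err_prob N s1 s2 rho x.1.1 x.1.2 x.2 <= (2 * (C + 1) / (n %/ eta)%:R)%:E)%E.
  (* At short blocklengths an arbitrary code is the default, so that one code can be selected for
     every [n]. *)
  case: (leqP (n0 * eta) n) => hn; last by exists (fun _ _ _ => 0, fun _ _ _ => 0, fun=> (ord0, ord0)).
  have nb0 : (0 < n %/ eta)%N by rewrite divn_gt0// (leq_trans _ hn)// leq_pmull.
  have nbR : (0 : R) < (n %/ eta)%:R by rewrite ltr0n.
  have e0 : 0 < (C + 1) / (n %/ eta)%:R by rewrite divr_gt0// ltr_wpDl.
  have e1 : 2 * ((C + 1) / (n %/ eta)%:R) < 1.
    rewrite mulrA ltr_pdivrMr// mul1r; apply: (@lt_le_trans _ _ n0%:R).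
      by have [] := @truncn_bounds R (2 * (C + 1)) _ => //; rewrite mulr_ge0// addr_ge0.
    by rewrite ler_nat leq_divRL.
  have [e [e' [d [hc he]]]] := good_code (leq_trunc_div n eta) nb0 (ltn0Sn _) (ltn0Sn _) lo1 lo2
    H11 H12 H21 H22 C11 C12 C22 gam0 (ltW P10) (ltW P20) e0 e1 okL okR
    (powE _ _ pwL) (powE _ _ pwR) (boundC n hn).
  by exists (e, e', d) => _; rewrite -mulrA.
pose X n := sval (cid (exists_code n)).
have HX n := svalP (cid (exists_code n)).
exists M1, M2, (fun n => (X n).1.1), (fun n => (X n).1.2), (fun n => (X n).2), (n0 * eta)%N; split.
  move=> n hn; have [hc _] := HX n hn.
  have n1 : (0 < n)%N by rewrite (leq_trans _ hn).
  split => //.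
  - exact: ln_truncnS_gt.
  - exact: ln_truncnS_gt.
apply: (@cvg_le_over_blocks _ _ (2 * (C + 1)) eta n0) => //.
- by rewrite mulr_ge0// addr_ge0.
- move=> n; rewrite /err_prob mule_ge0 ?lee_fin ?invr_ge0//.
  apply: sume_ge0 => w1 _; apply: sume_ge0 => w2 _.
  by do 3 (apply: gexp_ge0 => ?); rewrite lee_fin.
- by move=> n hn; have [] := HX n hn.
Qed.

End Achievability.

(** An approximating pair within [delta / 2] leaves the other half of the tolerance for its own
    codes. *)
Lemma achievable_closed (R : realType) (P1 P2 N s1 s2 rho : R) (S : set (R * R)) :
  (forall r, S r -> achievable P1 P2 N s1 s2 rho r) ->
  forall r, closure S r -> achievable P1 P2 N s1 s2 rho r.
Proof.
move=> ach r clr delta delta0; have d0 : 0 < delta / 2 by rewrite divr_gt0.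
have [r' [Sr' [/= b1 b2]]] := clr _ (nbhsx_ballx r (delta / 2) d0).
have [m1 [m2 [e1 [e2 [dec [n0 [h1 h2]]]]]]] := ach _ Sr' _ d0.
exists m1, m2, e1, e2, dec, n0; split => // n hn; have [hc q1 q2] := h1 n hn.
move: b1 b2; rewrite /ball /= => /ltr_normlP[b1 b1'] /ltr_normlP[b2 b2'].
by split => //; lra.
Qed.

Lemma region_eta_achievable (R : realType) (P1 P2 N s1 s2 rho : R) (m : nat)
    (a1 a2 : 'cV[R]_m.+1) (B1 B2 : 'M[R]_m.+1) (C : 'M[R]_(2, m.+1)) (r : R * R) :
  0 < P1 -> 0 < P2 -> 0 < N -> rho ^+ 2 <= 1 ->
  strictly_lower B1 -> strictly_lower B2 -> power_ok P1 P2 N s1 s2 rho a1 a2 B1 B2 ->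
  region_eta N s1 s2 rho a1 a2 B1 B2 C r -> achievable P1 P2 N s1 s2 rho r.
Proof.
move=> P10 P20 N0 rho1 lo1 lo2 pow.
have by_filters k (c : 'M[R]_(k, m.+1)) : \det (c *m c^T) != 0 ->
    region_c c a1 a2 (Qmat N s1 s2 rho B1 B2) r -> achievable P1 P2 N s1 s2 rho r.
  move=> dc rc.
  have [l1 [l2 [g11 [g12 [g22 H]]]]] := matched_filters N0 rho1 dc rc.
  case: H => [[h11 h12 h21 h22] [c11 c12 c22] [r1 r2 r12]].
  exact: (filters_achievable P10 P20 N0 rho1 lo1 lo2 pow h11 h12 h21 h22 c11 c12 c22 r1 r2 r12).
rewrite /region_eta; case: ifPn => [|_]; first exact: by_filters.
case: ifPn => [_ [i [ci rc]]|_ ->].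
  apply: by_filters rc; apply: contraNneq ci => /eqP.
  rewrite det_mx11 mxE psumr_eq0 => [/allP z|j _]; last by rewrite [_^T _ _]mxE -expr2 sqr_ge0.
  apply/eqP/rowP => j; have := z j; rewrite mem_index_enum => /(_ isT) /=.
  by rewrite [_^T _ _]mxE -expr2 sqrf_eq0 [RHS]mxE => /eqP.
(* The case [C = 0]: zero filters have zero gains and realise the origin. *)
have s0 : stat_coef N s1 s2 rho B1 B2 0 = fun=> 0.
  apply/funext => p; have := stat_coef_scale B1 B2 0 N s1 s2 rho 0 p.
  by rewrite scale0r mul0r.
apply: (@filters_achievable _ _ _ _ _ _ _ _ P10 P20 N0 rho1 _ _ _ _ lo1 lo2 pow 0 0 0 0 0) => /=;
  rewrite ?s0 ?mul0mx ?mxE ?addr0 ?mulr0 ?mulr1 ?expr2 ?mul0r ?subr0 ?ln1 ?mul0r //;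
  by rewrite big1// => p _; rewrite mul0r.
Qed.

Theorem mainTheorem1 (R : realType) (P1 P2 N s1 s2 rho : R) :
  0 < P1 -> 0 < P2 -> 0 < N ->
  0 <= s1 -> 0 <= s2 -> -1 <= rho <= 1 ->
  R_region P1 P2 N s1 s2 rho `<=` C_NoisyFB P1 P2 N s1 s2 rho.
Proof.
move=> P10 P20 N0 _ _ /andP[rho0 rho1]; apply: achievable_closed => r.
have rho2 : rho ^+ 2 <= 1 by nra.
move=> [[|m] [a1 [a2 [B1 [B2 [C [//  _ lo1 lo2 pow reg]]]]]]].
exact: (region_eta_achievable P10 P20 N0 rho2 lo1 lo2 pow reg).
Qed.
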